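(* Assume Setting (S) and the Distinctness assumptions (D), and assume in addition that $|C_n|\le M|d_nD_n|$ for all $n\in\mathbb{N}$ (no condition relating $\gamma$ and $\alpha$ is imposed). Then for every $T>\frac{2\pi}{\gamma}$, $$\int_0^T\big(|u_1(t)|^2+|u_2(t)|^2\big)dt\asymp\sum_{n=1}^\infty\big(|C_n|^2+|d_nD_n|^2\big),$$ i.e. there are constants $0<A\le B$, independent of $C_n,D_n,R_n,\mathcal{E}$, with $A\sum_n(|C_n|^2+|d_nD_n|^2)\le\int_0^T(|u_1|^2+|u_2|^2)dt\le B\sum_n(|C_n|^2+|d_nD_n|^2)$.
   Context: Setting (S): $(\omega_n),(\zeta_n),(C_n),(D_n),(c_n),(d_n)$ ($n\ge1$) are complex sequences and $(r_n),(R_n)$ are real sequences. There are constants $\gamma>0$, $\alpha>0$, $\chi<0$, $n'\in\mathbb{N}$, $\mu>0$, $\nu>1/2$, $M>0$, $0<c_1\le c_2$ such that: (H1) $\liminf_{n\to\infty}(\operatorname{Re}\omega_{n+1}-\operatorname{Re}\omega_n)=\liminf_{n\to\infty}(\operatorname{Re}\zeta_{n+1}-\operatorname{Re}\zeta_n)=\gamma$; (H2) $\operatorname{Im}\omega_n\to\alpha$, $r_n\to\chi$, $\operatorname{Im}\zeta_n\to0$; (H3) $\omega_n\ne0$, $\zeta_n\neq0$, $c_1|\zeta_n|\le|d_n|\le c_2|\zeta_n|$ and $|c_n|\le M/|\omega_n|$ for all $n$; (H4) $|R_n|\le\mu n^{-\nu}(|C_n|^2+|d_nD_n|^2)^{1/2}$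 for $n\ge n'$ and $|R_n|\le\mu(|C_n|^2+|d_nD_n|^2)^{1/2}$ for $n\le n'$; (H5) $\sum_n(|C_n|^2+|d_nD_n|^2)<\infty$. For $n_0\in\mathbb{N}$ and $t\in\mathbb{R}$, $u_1^{n_0}(t)=\sum_{n\ge n_0}\big(C_ne^{i\omega_nt}+\overline{C_n}e^{-i\overline{\omega_n}t}+R_ne^{r_nt}+D_ne^{i\zeta_nt}+\overline{D_n}e^{-i\overline{\zeta_n}t}\big)$, $u_2^{n_0}(t)=\sum_{n\ge n_0}\big(d_nD_ne^{i\zeta_nt}+\overline{d_nD_n}e^{-i\overline{\zeta_n}t}+c_nC_ne^{i\omega_nt}+\overline{c_nC_n}e^{-i\overline{\omega_n}t}\big)$. Distinctness assumptions (D): $\eta\in\mathbb{R}$ and $\mathcal{E}\in\mathbb{R}$ with $|\mathcal{E}|^2\le M\sum_{n\ge1}(|C_n|^2+|d_nD_n|^2)$; the sequences $(\omega_n)$, $(r_n)$, $(\zeta_n)$ each consist of pairwise distinct numbers; $\omega_n\ne\zeta_m$, $\omega_n\ne\overline{\zeta_m}$, $r_n\ne i\omega_m$, $r_n\ne i\zeta_m$, $r_n\ne-\eta$ for all $n,m$; and $\operatorname{Re}\omega_n>0$, $\operatorname{Re}\zeta_n>0$ for all $n$. Set $u_1(t):=u_1^{1}(t)$ and $u_2(t):=u_2^{1}(t)+\mathcal{E}e^{-\eta t}$. *)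

(* Defs.v *)
From Stdlib Require Import Reals.
Open Scope R_scope.

Record Cplx := mkC { Re : R ; Im : R }.
Definition RtoC (x : R) : Cplx := mkC x 0.
Definition C0 : Cplx := mkC 0 0.
Definition Ci : Cplx := mkC 0 1.
Definition Cadd (z w : Cplx) : Cplx := mkC (Re z + Re w) (Im z + Im w).
Definition Copp (z : Cplx) : Cplx := mkC (- Re z) (- Im z).
Definition Csub (z w : Cplx) : Cplx := Cadd z (Copp w).
Definition Cmul (z w : Cplx) : Cplx :=
  mkC (Re z * Re w - Im z * Im w) (Re z * Im w + Im z * Re w).
Definition Cconj (z : Cplx) : Cplx := mkC (Re z) (- Im z).
Definition Cmod (z : Cplx) : R := sqrt (Re z ^ 2 + Im z ^ 2).
Definition Cexp (z : Cplx) : Cplx := mkC (exp (Re z) * cos (Im z)) (exp (Re z) * sin (Im z)).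

Fixpoint csum1 (f : nat -> Cplx) (N : nat) : Cplx :=
  match N with O => C0 | S k => Cadd (csum1 f k) (f (S k)) end.

Definition series1 (a : nat -> R) (l : R) : Prop :=
  infinite_sum (fun k => a (S k)) l.

Definition is_liminf (x : nat -> R) (l : R) : Prop :=
  (forall eps, eps > 0 -> exists N, forall n, (n >= N)%nat -> x n > l - eps) /\
  (forall eps, eps > 0 -> forall N, exists n, (n >= N)%nat /\ x n < l + eps).

Definition RInt_is (f : R -> R) (a b I : R) : Prop :=
  exists pr : Riemann_integrable f a b, RiemannInt pr = I.

Definition term1 (om ze Cc Dd : nat -> Cplx) (r Rr : nat -> R) (n : nat) (t : R) : Cplx :=
  Cadd (Cadd (Cadd (Cadd
    (Cmul (Cc n) (Cexp (Cmul Ci (Cmul (om n) (RtoC t)))))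
    (Cmul (Cconj (Cc n)) (Cexp (Copp (Cmul Ci (Cmul (Cconj (om n)) (RtoC t)))))))
    (RtoC (Rr n * exp (r n * t))))
    (Cmul (Dd n) (Cexp (Cmul Ci (Cmul (ze n) (RtoC t))))))
    (Cmul (Cconj (Dd n)) (Cexp (Copp (Cmul Ci (Cmul (Cconj (ze n)) (RtoC t)))))).

Definition term2 (om ze Cc Dd c d : nat -> Cplx) (n : nat) (t : R) : Cplx :=
  Cadd (Cadd (Cadd
    (Cmul (Cmul (d n) (Dd n)) (Cexp (Cmul Ci (Cmul (ze n) (RtoC t)))))
    (Cmul (Cconj (Cmul (d n) (Dd n))) (Cexp (Copp (Cmul Ci (Cmul (Cconj (ze n)) (RtoC t)))))))
    (Cmul (Cmul (c n) (Cc n)) (Cexp (Cmul Ci (Cmul (om n) (RtoC t))))))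
    (Cmul (Cconj (Cmul (c n) (Cc n))) (Cexp (Copp (Cmul Ci (Cmul (Cconj (om n)) (RtoC t)))))).

Definition u1N om ze Cc Dd r Rr (N : nat) (t : R) : Cplx :=
  csum1 (fun n => term1 om ze Cc Dd r Rr n t) N.
Definition u2N om ze Cc Dd c d (E eta : R) (N : nat) (t : R) : Cplx :=
  Cadd (csum1 (fun n => term2 om ze Cc Dd c d n t) N) (RtoC (E * exp (- eta * t))).

(* Main.v *)
(* Since |C_n| <= M |d_n D_n|, it suffices to observe the coefficients for large n
   and then the finitely many remaining d_n D_n.

   Large n. Ingham's inequality on an interval of length T1 in (2 pi / gamma, T)
   holds separately for the exponents i omega_n and for the exponents i zeta_n.
   In u_2 the omega-part is small because c_n -> 0, in u_1 the zeta-part is small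
   because D_n = (d_n D_n) / d_n with |d_n| -> oo; the two errors are absorbed in
   each other, so no joint gap condition is needed. The leading terms are removed
   beforehand by Haraux's averaging filters, which multiply the coefficient of
   e^{kt} by 1 - Phi (d (k - k0)). The multipliers need not be comparable at
   omega_n and zeta_n, since each family is estimated with its own multipliers.
   The terms R_n e^{r_n t} are made negligible by a high power of the filter
   attached to chi = lim r_n.

   Remaining n. The tail being controlled, subtract it from u_2 and isolate each
   d_n D_n by a filter killing the finitely many other exponentials. *)
From Stdlib Require Import Reals Lra Lia Psatz List ClassicalEpsilon.
From Coquelicot Require Import Coquelicot.
Require Import Defs.
Import ListNotations.
Open Scope R_scope.


(** * Complex exponentials, finite sums and L2 norms *)

(** The order in which constants are chosen shapes the argument. The index [n0] is fixed first, from
    the Ingham constants, the sizes of [c_n] and [1 / d_n], and the closeness of [r_n] to [chi]. It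
    determines the exponents to be killed, and with them how small the multipliers on the tail may
    become. Enlarging [n0] need not make the terms [R_n e^{r_n t}] relatively small, because the
    multipliers change with it; and since the [r_n] accumulate at [chi], no gap inequality applies
    to them. The order of the filter at [chi] is therefore chosen last. It gains at every
    application because the tail frequencies stay at distance at least 1 from the real axis. All
    filters together may shorten the time interval by at most [T - T1]. Their widths can be as small
    as desired at the expense of the constants, and small widths also keep [d (k - k0)] in a
    vertical strip around 0, away from the nonreal solutions of [e^z = 1 + z], where the multiplier
    would vanish as well. Every estimate concerns finite sums with constants independent of the
    number of terms, so that only integrals pass to the limit. *)

Lemma Cplx_eq (z w : Cplx) : Re z = Re w -> Im z = Im w -> z = w.
Proof. destruct z, w; simpl; intros; subst; reflexivity. Qed.

Ltac cring := apply Cplx_eq; cbn -[exp cos sin]; ring.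

(** Squared moduli are polynomial in the coordinates, so that [ring] and [nra] can treat them;
    [Cmod_sq] translates back to [Cmod]. *)
Definition N2 (z : Cplx) : R := Re z ^ 2 + Im z ^ 2.

Lemma Cmod_sq (z : Cplx) : Cmod z ^ 2 = N2 z.
Proof. unfold Cmod, N2. apply pow2_sqrt. nra. Qed.

Lemma Cmod_ge0 (z : Cplx) : 0 <= Cmod z.
Proof. apply sqrt_pos. Qed.

Lemma N2_ge0 (z : Cplx) : 0 <= N2 z.
Proof. unfold N2; nra. Qed.

Lemma N2_mul (z w : Cplx) : N2 (Cmul z w) = N2 z * N2 w.
Proof. unfold N2; cbn; ring. Qed.

Lemma N2_conj (z : Cplx) : N2 (Cconj z) = N2 z.
Proof. unfold N2; cbn; ring. Qed.

Lemma N2_add (z w : Cplx) : N2 (Cadd z w) <= 2 * N2 z + 2 * N2 w.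
Proof. unfold N2; cbn. pose proof (pow2_ge_0 (Re z - Re w)). pose proof (pow2_ge_0 (Im z - Im w)). nra. Qed.

Lemma N2_pos (z : Cplx) : z <> C0 -> 0 < N2 z.
Proof.
  intros H. destruct (Rle_lt_or_eq_dec 0 (N2 z) (N2_ge0 z)) as [h|h]; [exact h|].
  exfalso; apply H. unfold N2 in h.
  assert (Re z = 0) by nra. assert (Im z = 0) by nra. apply Cplx_eq; assumption.
Qed.

Lemma N2_C0 : N2 C0 = 0.
Proof. unfold N2; cbn; ring. Qed.

Lemma Re_sq_le_N2 (z : Cplx) : Re z ^ 2 <= N2 z.
Proof. unfold N2; nra. Qed.

(** The exponents will be [i omega_n] and [i zeta_n]: growth sits in the real part of [l], frequency
    in its imaginary part. *)
Definition cexp (l : Cplx) (t : R) : Cplx :=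
  mkC (exp (Re l * t) * cos (Im l * t)) (exp (Re l * t) * sin (Im l * t)).

Lemma ex_add_l (l m : Cplx) (t : R) : cexp (Cadd l m) t = Cmul (cexp l t) (cexp m t).
Proof.
  unfold cexp; apply Cplx_eq; cbn -[exp cos sin];
    rewrite !Rmult_plus_distr_r, exp_plus, ?cos_plus, ?sin_plus; ring.
Qed.

Lemma ex_add_r (l : Cplx) (t s : R) : cexp l (t + s) = Cmul (cexp l t) (cexp l s).
Proof.
  unfold cexp; apply Cplx_eq; cbn -[exp cos sin];
    rewrite !Rmult_plus_distr_l, exp_plus, ?cos_plus, ?sin_plus; ring.
Qed.

Lemma ex_conj (l : Cplx) (t : R) : cexp (Cconj l) t = Cconj (cexp l t).
Proof.
  unfold cexp; apply Cplx_eq; cbn -[exp cos sin];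
  replace (- Im l * t) with (- (Im l * t)) by ring; rewrite ?cos_neg, ?sin_neg; ring.
Qed.

Lemma N2_ex (l : Cplx) (t : R) : N2 (cexp l t) = exp (2 * Re l * t).
Proof.
  replace (2 * Re l * t) with (Re l * t + Re l * t) by ring. rewrite exp_plus.
  unfold N2, cexp; cbn -[exp cos sin pow].
  pose proof (sin2_cos2 (Im l * t)) as H. unfold Rsqr in H.
  transitivity (exp (Re l * t) * exp (Re l * t) *
   (sin (Im l * t) * sin (Im l * t) + cos (Im l * t) * cos (Im l * t))); [ring|rewrite H; ring].
Qed.

Lemma ex_0_r (l : Cplx) : cexp l 0 = RtoC 1.
Proof. unfold cexp. rewrite !Rmult_0_r, exp_0, cos_0, sin_0. cring. Qed.

Lemma ex_real (x t : R) : cexp (RtoC x) t = RtoC (exp (x * t)).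
Proof. unfold cexp; cbn -[exp cos sin]. rewrite Rmult_0_l, cos_0, sin_0. cring. Qed.

(** * Finite sums *)

Fixpoint csum (f : nat -> Cplx) (n : nat) : Cplx :=
  match n with O => C0 | S k => Cadd (csum f k) (f k) end.
Fixpoint rsum (f : nat -> R) (n : nat) : R :=
  match n with O => 0 | S k => rsum f k + f k end.

Lemma csum_ext f g n : (forall i, (i < n)%nat -> f i = g i) -> csum f n = csum g n.
Proof. induction n; intros H; cbn; [easy|]. rewrite IHn, H; auto. Qed.

Lemma rsum_ext f g n : (forall i, (i < n)%nat -> f i = g i) -> rsum f n = rsum g n.
Proof. induction n; intros H; cbn; [easy|]. rewrite IHn, H; auto. Qed.

Lemma rsum_le f g n : (forall i, (i < n)%nat -> f i <= g i) -> rsum f n <= rsum g n.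
Proof.
  induction n; intros H; cbn; [lra|].
  assert (f n <= g n) by auto. assert (rsum f n <= rsum g n) by auto. lra.
Qed.

Lemma rsum_ge0 f n : (forall i, (i < n)%nat -> 0 <= f i) -> 0 <= rsum f n.
Proof.
  induction n; intros H; cbn; [lra|].
  assert (0 <= f n) by auto. assert (0 <= rsum f n) by auto. lra.
Qed.

Lemma rsum_scal c f n : rsum (fun i => c * f i) n = c * rsum f n.
Proof. induction n; cbn; [ring|rewrite IHn; ring]. Qed.

Lemma rsum_plus f g n : rsum (fun i => f i + g i) n = rsum f n + rsum g n.
Proof. induction n; cbn; [ring|rewrite IHn; ring]. Qed.

Lemma rsum_const c n : rsum (fun _ => c) n = INR n * c.
Proof. induction n; [cbn; ring|]. cbn [rsum]. rewrite IHn, S_INR; ring. Qed.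

Lemma rsum_zero f n : (forall i, (i < n)%nat -> f i = 0) -> rsum f n = 0.
Proof. intros H. rewrite (rsum_ext _ (fun _ => 0)); auto. rewrite rsum_const; ring. Qed.

Lemma rsum_split f n k : rsum f (n + k) = rsum f n + rsum (fun i => f (n + i)%nat) k.
Proof.
  induction k; cbn; [rewrite Nat.add_0_r; ring|].
  rewrite Nat.add_succ_r; cbn. rewrite IHk; ring.
Qed.

Lemma csum_split f n k : csum f (n + k) = Cadd (csum f n) (csum (fun i => f (n + i)%nat) k).
Proof.
  induction k; cbn; [rewrite Nat.add_0_r; cring|].
  rewrite Nat.add_succ_r; cbn. rewrite IHk; cring.
Qed.

Lemma rsum_exchange f n k :
  rsum (fun i => rsum (fun j => f i j) k) n = rsum (fun j => rsum (fun i => f i j) n) k.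
Proof.
  induction n; cbn.
  - rewrite rsum_zero; auto.
  - rewrite IHn, <- rsum_plus. reflexivity.
Qed.

Lemma csum_add f g n : csum (fun i => Cadd (f i) (g i)) n = Cadd (csum f n) (csum g n).
Proof. induction n; cbn; [cring|rewrite IHn; cring]. Qed.

Lemma csum_zero f n : (forall i, (i < n)%nat -> f i = C0) -> csum f n = C0.
Proof. induction n; intros H; cbn; [easy|]. rewrite IHn, H; auto. cring. Qed.

Lemma csum_mul_r f w n : Cmul (csum f n) w = csum (fun i => Cmul (f i) w) n.
Proof. induction n; cbn; [cring|]. rewrite <- IHn. cring. Qed.

Lemma csum_rev f n : csum f n = csum (fun i => f (n - 1 - i)%nat) n.
Proof.
  assert (Hs : forall f n, csum f (S n) = Cadd (f O) (csum (fun i => f (S i)) n)).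
  { clear. intros f n. induction n; [cbn; cring|].
    change (csum f (S (S n))) with (Cadd (csum f (S n)) (f (S n))). rewrite IHn. cbn. cring. }
  revert f; induction n; intros f; [easy|].
  rewrite (Hs (fun i => f (S n - 1 - i)%nat)). cbn [csum].
  rewrite (IHn f). replace (S n - 1 - 0)%nat with n by lia.
  rewrite (csum_ext (fun i => f (S n - 1 - S i)%nat) (fun i => f (n - 1 - i)%nat)).
  - cring.
  - intros i Hi. f_equal; lia.
Qed.

Lemma rsum_rev f n : rsum f n = rsum (fun i => f (n - 1 - i)%nat) n.
Proof.
  assert (H : forall f n, csum (fun i => RtoC (f i)) n = RtoC (rsum f n)).
  { clear. intros f n; induction n; cbn; [easy|]. rewrite IHn. cring. }
  pose proof (H f n) as H1. rewrite csum_rev in H1.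
  pose proof (H (fun i => f (n - 1 - i)%nat) n) as H2. cbn in H2. rewrite H1 in H2.
  injection H2; auto.
Qed.

Lemma Re_csum f n : Re (csum f n) = rsum (fun i => Re (f i)) n.
Proof. induction n; cbn; [easy|rewrite IHn; easy]. Qed.

Lemma csum_conj f n : Cconj (csum f n) = csum (fun i => Cconj (f i)) n.
Proof. induction n; cbn; [cring|rewrite <- IHn; cring]. Qed.

Lemma N2_csum f n :
  N2 (csum f n) = rsum (fun j => rsum (fun l => Re (Cmul (f j) (Cconj (f l)))) n) n.
Proof.
  replace (N2 (csum f n)) with (Re (Cmul (csum f n) (Cconj (csum f n)))) by (unfold N2; cbn; ring).
  rewrite csum_mul_r, Re_csum. apply rsum_ext; intros j _.
  replace (Cmul (f j) (Cconj (csum f n))) with (Cmul (Cconj (csum f n)) (f j)) by cring.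
  rewrite csum_conj, csum_mul_r, Re_csum. apply rsum_ext; intros l _. cbn; ring.
Qed.

(** The quadratic polynomial [sum (f_i x + g_i)^2] in [x] is nonnegative. If its leading coefficient
    vanishes, it is affine, and a nonzero slope would give it the value -1. *)
Lemma rsum_CS f g n :
  (rsum (fun i => f i * g i) n) ^ 2 <= rsum (fun i => f i ^ 2) n * rsum (fun i => g i ^ 2) n.
Proof.
  set (a := rsum (fun i => f i ^ 2) n). set (b := rsum (fun i => f i * g i) n).
  set (c := rsum (fun i => g i ^ 2) n).
  assert (Ha : 0 <= a) by (apply rsum_ge0; intros; nra).
  assert (H : forall x, 0 <= a * x ^ 2 + 2 * b * x + c).
  { intros x. replace (a * x ^ 2 + 2 * b * x + c) with (rsum (fun i => (f i * x + g i) ^ 2) n).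
    - apply rsum_ge0; intros; apply pow2_ge_0.
    - unfold a, b, c. replace (rsum (fun i => f i ^ 2) n * x ^ 2) with (x ^ 2 * rsum (fun i => f i ^ 2) n) by ring.
      replace (2 * rsum (fun i => f i * g i) n * x) with (2 * x * rsum (fun i => f i * g i) n) by ring.
      rewrite <- !rsum_scal, <- !rsum_plus. apply rsum_ext; intros; ring. }
  destruct (Req_dec a 0) as [h|h].
  - destruct (Req_dec b 0) as [->|hb]; [rewrite h; lra|].
    specialize (H (- (c + 1) / (2 * b))). rewrite h in H.
    replace (0 * (- (c + 1) / (2 * b)) ^ 2 + 2 * b * (- (c + 1) / (2 * b)) + c) with (-1) in H by (field; auto).
    lra.
  - specialize (H (- b / a)).
    replace (a * (- b / a) ^ 2 + 2 * b * (- b / a) + c) with ((a * c - b ^ 2) / a) in H by (field; auto).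
    assert (0 <= (a * c - b ^ 2) / a * a) by (apply Rmult_le_pos; lra).
    replace ((a * c - b ^ 2) / a * a) with (a * c - b ^ 2) in H0 by (field; auto). lra.
Qed.

Lemma N2_csum_le f n : N2 (csum f n) <= INR n * rsum (fun i => N2 (f i)) n.
Proof.
  rewrite N2_csum.
  apply Rle_trans with (rsum (fun j => rsum (fun l => / 2 * N2 (f j) + / 2 * N2 (f l)) n) n).
  - apply rsum_le; intros j _; apply rsum_le; intros l _. unfold N2; cbn.
    pose proof (pow2_ge_0 (Re (f j) - Re (f l))). pose proof (pow2_ge_0 (Im (f j) - Im (f l))). nra.
  - rewrite (rsum_ext _ (fun j => INR n * / 2 * N2 (f j) + / 2 * rsum (fun l => N2 (f l)) n)).
    + rewrite rsum_plus, rsum_scal, rsum_const. lra.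
    + intros j _. rewrite rsum_plus, rsum_const, rsum_scal. ring.
Qed.

(** * Continuity and squared L2 norms *)

Definition cont (f : R -> Cplx) : Prop :=
  (forall t, continuous (fun t => Re (f t)) t) /\ (forall t, continuous (fun t => Im (f t)) t).

Lemma cont_add f g : cont f -> cont g -> cont (fun t => Cadd (f t) (g t)).
Proof.
  intros [H1 H2] [H3 H4]; split; intros t; cbn;
   apply (continuous_plus (V := R_NormedModule)); auto.
Qed.

Lemma cont_mul f g : cont f -> cont g -> cont (fun t => Cmul (f t) (g t)).
Proof.
  intros [H1 H2] [H3 H4]; split; intros t; cbn.
  - apply (continuous_minus (V := R_NormedModule)); apply (continuous_mult (K := R_AbsRing)); auto.
  - apply (continuous_plus (V := R_NormedModule)); apply (continuous_mult (K := R_AbsRing)); auto.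
Qed.

Lemma cont_const z : cont (fun _ => z).
Proof. split; intros; apply continuous_const. Qed.

Lemma continuous_derivable (f : R -> R) : (forall t, ex_derive f t) -> forall t, continuous f t.
Proof. intros H t. apply (ex_derive_continuous (K := R_AbsRing) (V := R_NormedModule)). auto. Qed.

Lemma cont_ex l : cont (fun t => cexp l t).
Proof. split; intros t; cbn -[exp cos sin]; revert t; apply continuous_derivable; intros t; auto_derive; auto. Qed.

Lemma cont_term p l : cont (fun t => Cmul p (cexp l t)).
Proof. apply (cont_mul (fun _ => p)); [apply cont_const|apply cont_ex]. Qed.

Lemma cont_csum (f : nat -> R -> Cplx) n : (forall i, cont (f i)) -> cont (fun t => csum (fun i => f i t) n).
Proof. intros H; induction n; cbn; [apply cont_const|]. apply cont_add; auto. Qed.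

Lemma cont_ext f g : (forall t, f t = g t) -> cont f -> cont g.
Proof.
  intros H [H1 H2]; split; intros t.
  - apply continuous_ext with (fun t => Re (f t)); auto. intros x; rewrite H; auto.
  - apply continuous_ext with (fun t => Im (f t)); auto. intros x; rewrite H; auto.
Qed.

Lemma cont_sub f g : cont f -> cont g -> cont (fun t => Csub (f t) (g t)).
Proof.
  intros Hf Hg. apply cont_ext with (fun t => Cadd (f t) (Cmul (RtoC (-1)) (g t))); [intros; cring|].
  apply cont_add; auto. apply (cont_mul (fun _ => RtoC (-1))); auto. apply cont_const.
Qed.

Lemma cont_affine h a b : cont h -> cont (fun s => h (a + b * s)).
Proof.
  intros [h1 h2]. split; intros s;
    [apply (continuous_comp (fun s => a + b * s) (fun s => Re (h s)))
    |apply (continuous_comp (fun s => a + b * s) (fun s => Im (h s)))]; auto;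
    apply (ex_derive_continuous (K := R_AbsRing) (V := R_NormedModule)); auto_derive; auto.
Qed.

Lemma cont_N2 f : cont f -> forall t, continuous (fun t => N2 (f t)) t.
Proof.
  intros [H1 H2] t. unfold N2.
  apply continuous_ext with (fun t => Re (f t) * Re (f t) + Im (f t) * Im (f t)).
  { intros x; cbn; ring. }
  apply (continuous_plus (V := R_NormedModule)); apply (continuous_mult (K := R_AbsRing)); auto.
Qed.

Lemma cont_ex_RInt (f : R -> R) a b : (forall t, continuous f t) -> ex_RInt f a b.
Proof. intros H. apply (ex_RInt_continuous (V := R_CompleteNormedModule)). auto. Qed.

Definition RI (f : R -> Cplx) (T : R) : R := RInt (fun t => N2 (f t)) 0 T.

Lemma ex_RI f a b : cont f -> ex_RInt (fun t => N2 (f t)) a b.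
Proof. intros H. apply cont_ex_RInt, cont_N2, H. Qed.

Lemma RI_ge0 f T : 0 <= T -> cont f -> 0 <= RI f T.
Proof. intros HT H. apply RInt_ge_0; auto. apply ex_RI; auto. intros; apply N2_ge0. Qed.

Lemma RI_ext f g T : (forall t, f t = g t) -> RI f T = RI g T.
Proof. intros H. unfold RI. apply RInt_ext. intros t _. rewrite H; auto. Qed.

Lemma RI_incr f S T : 0 <= S <= T -> cont f -> RI f S <= RI f T.
Proof.
  intros HT H. unfold RI. rewrite <- (RInt_Chasles (fun t => N2 (f t)) 0 S T); try (apply ex_RI; auto).
  assert (0 <= RInt (fun t => N2 (f t)) S T).
  { apply RInt_ge_0; [lra|apply ex_RI; auto|intros; apply N2_ge0]. }
  match goal with |- ?a <= plus ?b ?c => change (a <= b + c) end. lra.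
Qed.

Lemma RInt_scalR (f : R -> R) a b c : ex_RInt f a b -> RInt (fun t => c * f t) a b = c * RInt f a b :> R.
Proof. exact (RInt_scal (V := R_CompleteNormedModule) f a b c). Qed.

Lemma ex_RInt_scalR (f : R -> R) a b c : ex_RInt f a b -> ex_RInt (fun t => c * f t) a b.
Proof. exact (ex_RInt_scal (V := R_NormedModule) f a b c). Qed.

Lemma RInt_plusR (f g : R -> R) a b : ex_RInt f a b -> ex_RInt g a b ->
  RInt (fun t => f t + g t) a b = RInt f a b + RInt g a b :> R.
Proof. exact (RInt_plus (V := R_CompleteNormedModule) f g a b). Qed.

Lemma ex_RInt_plusR (f g : R -> R) a b : ex_RInt f a b -> ex_RInt g a b ->
  ex_RInt (fun t => f t + g t) a b.
Proof. exact (ex_RInt_plus (V := R_NormedModule) f g a b). Qed.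

Lemma RInt_constR a b c : RInt (fun _ => c) a b = (b - a) * c :> R.
Proof. exact (RInt_const (V := R_CompleteNormedModule) a b c). Qed.

(** Every splitting of an L2 norm is obtained by integrating a pointwise inequality of this form, so
    that Minkowski's inequality and square roots are avoided. *)
Lemma RI_le2 f g h a b T : 0 <= T -> cont f -> cont g -> cont h ->
  (forall t, 0 < t < T -> N2 (f t) <= a * N2 (g t) + b * N2 (h t)) -> RI f T <= a * RI g T + b * RI h T.
Proof.
  intros HT Hf Hg Hh H. unfold RI.
  rewrite <- !RInt_scalR by (apply ex_RI; auto).
  rewrite <- RInt_plusR by (apply ex_RInt_scalR, ex_RI; auto).
  apply RInt_le; auto.
  - apply ex_RI; auto.
  - apply ex_RInt_plusR; apply ex_RInt_scalR, ex_RI; auto.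
Qed.

Lemma RI_le f g c T : 0 <= T -> cont f -> cont g -> (forall t, 0 < t < T -> N2 (f t) <= c * N2 (g t)) ->
  RI f T <= c * RI g T.
Proof.
  intros HT Hf Hg H.
  replace (c * RI g T) with (c * RI g T + 0 * RI g T) by ring.
  apply RI_le2; auto. intros t Ht. specialize (H t Ht). lra.
Qed.

Lemma RI_add f g T : 0 <= T -> cont f -> cont g ->
  RI (fun t => Cadd (f t) (g t)) T <= 2 * RI f T + 2 * RI g T.
Proof. intros. apply RI_le2; auto. apply cont_add; auto. intros; apply N2_add. Qed.

Lemma RI_const_bound f c T : 0 <= T -> cont f -> (forall t, 0 < t < T -> N2 (f t) <= c) -> RI f T <= T * c.
Proof.
  intros HT Hf H. unfold RI.
  replace (T * c) with ((T - 0) * c) by ring. rewrite <- RInt_constR.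
  apply RInt_le; auto. apply ex_RI; auto. apply ex_RInt_const.
Qed.

Lemma is_RInt_rsum (f : nat -> R -> R) (I : nat -> R) n a b : (forall i, (i < n)%nat -> is_RInt (f i) a b (I i)) ->
  is_RInt (fun t => rsum (fun i => f i t) n) a b (rsum I n).
Proof.
  induction n; intros H; cbn.
  - pose proof (is_RInt_const (V := R_NormedModule) a b 0) as h.
    assert (E : scal (b - a) (0 : R) = 0 :> R) by exact (Rmult_0_r (b - a)).
    exact (eq_rect _ (fun v : R => is_RInt (fun _ : R => 0) a b v) h 0 E).
  - apply (is_RInt_plus (V := R_NormedModule)); auto.
Qed.

Lemma exp_ge_1 x : 0 <= x -> 1 <= exp x.
Proof. intros. pose proof (exp_ineq1_le x). lra. Qed.

Lemma exp_mono x y : x <= y -> exp x <= exp y.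
Proof. intros [h| ->]; [left; apply exp_increasing; auto|lra]. Qed.


(** * Ingham inequalities *)

Lemma Rabs_le_of_sq (x y : R) : 0 <= y -> x ^ 2 <= y ^ 2 -> Rabs x <= y.
Proof. intros Hy H. apply Rabs_le. split; nra. Qed.

Lemma is_RInt_FTC (f df : R -> R) a b :
  (forall x, is_derive f x (df x)) -> (forall x, continuous df x) -> is_RInt df a b (f b - f a).
Proof.
  intros H1 H2. apply (is_RInt_derive (V := R_CompleteNormedModule) f df); auto.
Qed.

(** A primitive of [sin (a t) e^{zt}] is [e^{zt} (z sin (a t) - a cos (a t)) / (z^2 + a^2)]; since
    [a L = pi], the sine vanishes at both ends. The inverse of [z^2 + a^2] enters as [q] with its
    defining equation, in place of a complex division. *)
Lemma is_RInt_sin_ex (z q c : Cplx) (a L : R) : a * L = PI ->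
  Cmul q (Cadd (Cmul z z) (RtoC (a * a))) = RtoC 1 ->
  is_RInt (fun t => sin (a * t) * Re (Cmul c (cexp z t))) 0 L
    (a * Re (Cmul (Cmul c q) (Cadd (RtoC 1) (cexp z L)))).
Proof.
  intros HL Hq. set (k := Cmul c q). set (w := Cadd (Cmul z z) (RtoC (a * a))) in *.
  assert (Hc : c = Cmul k w).
  { unfold k. transitivity (Cmul c (Cmul q w)); [rewrite Hq; cring|cring]. }
  set (V := fun t => Re (Cmul k (Cmul (cexp z t) (Csub (Cmul z (RtoC (sin (a * t)))) (RtoC (a * cos (a * t))))))).
  replace (a * Re (Cmul k (Cadd (RtoC 1) (cexp z L)))) with (V L - V 0).
  - apply is_RInt_FTC.
    + intros t. rewrite Hc. unfold V, w. cbn -[exp cos sin]. auto_derive; auto. ring.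
    + apply continuous_derivable. intros t. cbn -[exp cos sin]. auto_derive; auto.
  - unfold V. rewrite ex_0_r, HL, sin_PI, cos_PI, Rmult_0_r, sin_0, cos_0. cbn -[exp cos sin]. ring.
Qed.

(** The real part of [z^2 + a^2] is at most [-D], so its modulus is at least [D]: an off-diagonal
    Gram entry decays quadratically in the frequency difference. The numerator [1 + e^{zL}] has
    modulus at most [1 + Q]. *)
Lemma sin_ex_bound (p p' z : Cplx) (a L D Q : R) : 0 < a -> a * L = PI -> 0 < D ->
  D <= Im z ^ 2 - Re z ^ 2 - a ^ 2 -> exp (Re z * L) <= Q ->
  Rabs (RInt (fun t => sin (a * t) * Re (Cmul (Cmul p (Cconj p')) (cexp z t))) 0 L)
   <= a * ((1 + Q) / D * ((N2 p + N2 p') / 2)).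
Proof.
  intros Ha HL HD H HQ. set (w := Cadd (Cmul z z) (RtoC (a * a))).
  assert (Hw : D ^ 2 <= N2 w). { unfold N2, w; cbn. nra. }
  assert (Hw0 : 0 < N2 w) by nra.
  set (q := mkC (Re w / N2 w) (- Im w / N2 w)).
  assert (Hq : Cmul q w = RtoC 1).
  { apply Cplx_eq; unfold q; cbn -[N2 w].
    - transitivity (N2 w / N2 w); [unfold N2 at 3; field; lra|field; lra].
    - field; lra. }
  assert (Hnq : N2 q * N2 w = 1).
  { rewrite <- N2_mul, Hq. unfold N2; cbn; ring. }
  rewrite (is_RInt_unique _ _ _ _ (is_RInt_sin_ex z q (Cmul p (Cconj p')) a L HL Hq)).
  rewrite Rabs_mult, (Rabs_pos_eq a) by lra. apply Rmult_le_compat_l; [lra|].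
  pose proof (exp_pos (Re z * L)) as He.
  assert (HE : N2 (Cadd (RtoC 1) (cexp z L)) <= (1 + Q) ^ 2).
  { unfold N2; cbn -[exp cos sin].
    pose proof (sin2_cos2 (Im z * L)) as S1. unfold Rsqr in S1.
    pose proof (COS_bound (Im z * L)) as S2.
    set (e := exp (Re z * L)) in *. set (x := cos (Im z * L)) in *. set (y := sin (Im z * L)) in *.
    replace ((1 + e * x) * ((1 + e * x) * 1) + (0 + e * y) * ((0 + e * y) * 1))
      with (1 + 2 * (e * x) + e * e * (y * y + x * x)) by ring.
    rewrite S1. assert (e * x <= e) by nra. nra. }
  apply Rabs_le_of_sq.
  - pose proof (N2_ge0 p). pose proof (N2_ge0 p').
    apply Rmult_le_pos; [|lra]. apply Rmult_le_pos; [lra|]. left; apply Rinv_0_lt_compat; auto.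
  - eapply Rle_trans; [apply Re_sq_le_N2|]. rewrite !N2_mul, N2_conj.
    replace (((1 + Q) / D * ((N2 p + N2 p') / 2)) ^ 2)
      with (((N2 p + N2 p') / 2) ^ 2 * (/ D ^ 2) * (1 + Q) ^ 2) by (field; lra).
    assert (Hq2 : N2 q <= / D ^ 2).
    { apply Rmult_le_reg_r with (N2 w); auto. rewrite Hnq.
      apply Rmult_le_reg_l with (D ^ 2); [nra|]. rewrite <- Rmult_assoc, Rinv_r by nra. lra. }
    apply Rmult_le_compat; auto; try apply N2_ge0.
    + apply Rmult_le_pos; [apply Rmult_le_pos|]; apply N2_ge0.
    + apply Rmult_le_compat; auto; try apply N2_ge0.
      * apply Rmult_le_pos; apply N2_ge0.
      * pose proof (pow2_ge_0 (N2 p - N2 p')). nra.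
Qed.

Lemma rsum2_lin (f h : nat -> nat -> R) c n m :
  rsum (fun j => rsum (fun k => f j k + c * h j k) m) n =
  rsum (fun j => rsum (fun k => f j k) m) n + c * rsum (fun j => rsum (fun k => h j k) m) n.
Proof.
  rewrite <- rsum_scal, <- rsum_plus. apply rsum_ext; intros j _.
  rewrite rsum_plus, rsum_scal. reflexivity.
Qed.

Lemma INR_diff_odd (j l : nat) : 2 * (INR l - INR j) - 1 <> 0.
Proof.
  rewrite !INR_IZR_INZ, <- minus_IZR, <- mult_IZR, <- minus_IZR. apply not_0_IZR. lia.
Qed.

(** By partial fractions the full row telescopes to [(G 0 - G n) / 2], which is negative. The full
    row contains the diagonal value -1, so removing it adds 1. *)
Lemma row_sum (j n : nat) : (j < n)%nat ->
  rsum (fun l => if Nat.eqb j l then 0 else / (4 * (INR j - INR l) ^ 2 - 1)) n <= 1.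
Proof.
  intros Hj. set (G := fun l => / (2 * (INR l - INR j) - 1)).
  assert (HG : forall n, rsum (fun l => / (4 * (INR j - INR l) ^ 2 - 1)) n = / 2 * (G O - G n)).
  { clear n Hj. induction n; [cbn; ring|]. cbn [rsum]. rewrite IHn. unfold G.
    pose proof (INR_diff_odd j n) as h1. pose proof (INR_diff_odd j (S n)) as h2.
    rewrite S_INR in *.
    assert (4 * (INR j - INR n) ^ 2 - 1 <> 0).
    { replace (4 * (INR j - INR n) ^ 2 - 1) with ((2 * (INR n - INR j) - 1) * (2 * (INR n + 1 - INR j) - 1)) by ring.
      apply Rmult_integral_contrapositive; auto. }
    field. repeat split; auto. pose proof (INR_diff_odd j O) as h3. exact h3. }
  assert (Hd : forall m, rsum (fun l => if Nat.eqb j l then 0 else / (4 * (INR j - INR l) ^ 2 - 1)) m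
     = rsum (fun l => / (4 * (INR j - INR l) ^ 2 - 1)) m + (if Nat.ltb j m then 1 else 0)).
  { induction m; [cbn; ring|]. cbn [rsum]. rewrite IHm.
    destruct (Nat.eqb_spec j m), (Nat.ltb_spec j m), (Nat.ltb_spec j (S m)); try lia; try ring.
    subst. replace (4 * (INR m - INR m) ^ 2 - 1) with (-1) by ring. field. }
  rewrite Hd, HG. destruct (Nat.ltb_spec j n); [|lia].
  assert (G O < 0). { apply Rinv_lt_0_compat. pose proof (pos_INR j). cbn [INR]. lra. }
  assert (0 < G n). { apply Rinv_0_lt_compat. apply lt_INR in Hj as h.
    assert (INR n >= INR j + 1) by (rewrite <- S_INR; apply Rle_ge, le_INR; lia). lra. }
  lra.
Qed.

Lemma sin_int (a L : R) : 0 < a -> a * L = PI -> is_RInt (fun t => sin (a * t)) 0 L (2 / a).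
Proof.
  intros Ha HL. set (V := fun t => - cos (a * t) / a). replace (2 / a) with (V L - V 0).
  - apply is_RInt_FTC.
    + intros t. unfold V. auto_derive; auto. field; lra.
    + apply continuous_derivable. intros; auto_derive; auto.
  - unfold V. rewrite HL, Rmult_0_r, cos_PI, cos_0. field; lra.
Qed.

(* Ingham's argument: with the weight [sin (a t)], the Gram matrix of the
   exponentials is diagonally dominant as soon as the gap exceeds [2 pi / L]. *)
Lemma ingham_weighted (a L Q eps g : R) (l p : nat -> Cplx) (n : nat) :
  0 < a -> a * L = PI -> 1 < Q -> 0 <= eps -> exp (2 * eps * L) <= Q ->
  4 * eps ^ 2 <= a ^ 2 * (Q ^ 2 - 1) -> 2 * a * Q ^ 2 <= g ->
  (forall i, (i < n)%nat -> Rabs (Re (l i)) <= eps) ->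
  (forall i j, (i < n)%nat -> (j < n)%nat -> g * Rabs (INR i - INR j) <= Rabs (Im (l i) - Im (l j))) ->
  let W := RInt (fun t => sin (a * t) * N2 (csum (fun i => Cmul (p i) (cexp (l i) t)) n)) 0 L in
  (Q - 1) / (a * Q ^ 2) * rsum (fun i => N2 (p i)) n <= W /\
  W <= (2 * Q / a + (1 + Q) / (a * Q ^ 2)) * rsum (fun i => N2 (p i)) n.
Proof.
  intros Ha HL HQ Heps Hexp Heps2 Hg Hre Him W.
  assert (HL0 : 0 < L) by (pose proof PI_RGT_0; nra).
  set (J := fun j k => RInt (fun t => sin (a * t) *
       Re (Cmul (Cmul (p j) (Cconj (p k))) (cexp (Cadd (l j) (Cconj (l k))) t))) 0 L).
  assert (HW : W = rsum (fun j => rsum (fun k => J j k) n) n).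
  { unfold W. apply is_RInt_unique.
    apply is_RInt_ext with (fun t => rsum (fun j => rsum (fun k => sin (a * t) *
       Re (Cmul (Cmul (p j) (Cconj (p k))) (cexp (Cadd (l j) (Cconj (l k))) t))) n) n).
    - intros t _. rewrite N2_csum, <- rsum_scal. apply rsum_ext; intros j _.
      rewrite <- rsum_scal. apply rsum_ext; intros k _. f_equal. f_equal.
      rewrite ex_add_l, ex_conj. cring.
    - apply is_RInt_rsum; intros j _. apply is_RInt_rsum; intros k _.
      apply (RInt_correct (V := R_CompleteNormedModule)). apply cont_ex_RInt, continuous_derivable.
      intros t; cbn -[exp cos sin]; auto_derive; auto. }
  set (s := (1 + Q) / (a * Q ^ 2)).
  assert (Hs : 0 <= s). { apply Rmult_le_pos; [lra|]. left; apply Rinv_0_lt_compat. nra. }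
  set (K := fun j k : nat => if Nat.eqb j k then 0 else / (4 * (INR j - INR k) ^ 2 - 1)).
  set (d := fun (x : R) (j k : nat) => if Nat.eqb j k then x * N2 (p j) else 0).
  (* On the diagonal the weight has integral [2 / a] and the exponential factor lies between [1 / Q]
     and [Q]. Off the diagonal the entry is at most [s] times the kernel of [row_sum]. The margin is
     [2 / (a Q) - s = (Q - 1) / (a Q^2) > 0]. *)
  assert (HJ : forall j k, (j < n)%nat -> (k < n)%nat ->
    d (2 / (a * Q)) j k - s * (K j k * ((N2 (p j) + N2 (p k)) / 2)) <= J j k /\
    J j k <= d (2 * Q / a) j k + s * (K j k * ((N2 (p j) + N2 (p k)) / 2))).
  { intros j k Hj Hk. unfold d, K. destruct (Nat.eqb_spec j k) as [<-|hjk].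
    - assert (Hsin : ex_RInt (fun t => sin (a * t)) 0 L) by (eexists; apply sin_int; auto).
      assert (HS : RInt (fun t => sin (a * t)) 0 L = 2 / a :> R) by (apply is_RInt_unique, sin_int; auto).
      assert (Hcont : ex_RInt (fun t => sin (a * t) *
         Re (Cmul (Cmul (p j) (Cconj (p j))) (cexp (Cadd (l j) (Cconj (l j))) t))) 0 L).
      { apply cont_ex_RInt, continuous_derivable. intros t; cbn -[exp cos sin]; auto_derive; auto. }
      assert (Hpt : forall t, 0 < t < L -> 0 <= sin (a * t) /\
         Re (Cmul (Cmul (p j) (Cconj (p j))) (cexp (Cadd (l j) (Cconj (l j))) t)) = N2 (p j) * exp (2 * Re (l j) * t)
         /\ / Q <= exp (2 * Re (l j) * t) <= Q).
      { intros t Ht. split; [|split].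
        - apply sin_ge_0; [nra|]. rewrite <- HL. nra.
        - rewrite <- N2_ex. rewrite ex_add_l, ex_conj. unfold N2. cbn -[exp cos sin]. ring.
        - specialize (Hre j Hj). apply Rabs_le_between in Hre.
          split.
          + apply Rle_trans with (/ exp (2 * eps * L)).
            * apply Rinv_le_contravar; auto. apply exp_pos.
            * rewrite <- exp_Ropp. apply exp_mono. nra.
          + eapply Rle_trans; [|exact Hexp]. apply exp_mono. nra. }
      pose proof (N2_ge0 (p j)) as HP.
      split.
      + replace (2 / (a * Q) * N2 (p j) - s * (0 * ((N2 (p j) + N2 (p j)) / 2)))
          with (N2 (p j) * / Q * RInt (fun t => sin (a * t)) 0 L) by (rewrite HS; field; lra).
        rewrite <- RInt_scalR by auto. apply RInt_le; auto; [lra|apply ex_RInt_scalR; auto|].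
        intros t Ht. destruct (Hpt t Ht) as (h1 & -> & h2 & h3).
        rewrite (Rmult_comm (sin _)). apply Rmult_le_compat_r; auto. apply Rmult_le_compat_l; auto.
      + replace (2 * Q / a * N2 (p j) + s * (0 * ((N2 (p j) + N2 (p j)) / 2)))
          with (N2 (p j) * Q * RInt (fun t => sin (a * t)) 0 L) by (rewrite HS; field; lra).
        rewrite <- RInt_scalR by auto. apply RInt_le; auto; [lra|apply ex_RInt_scalR; auto|].
        intros t Ht. destruct (Hpt t Ht) as (h1 & -> & h2 & h3).
        rewrite (Rmult_comm (sin _)). apply Rmult_le_compat_r; auto. apply Rmult_le_compat_l; auto.
    - set (x := INR j - INR k). assert (Hx : 1 <= x ^ 2).
      { unfold x. destruct (Nat.lt_total j k) as [h|[h|h]]; [|lia|].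
        - assert (INR j + 1 <= INR k) by (rewrite <- S_INR; apply le_INR; lia). nra.
        - assert (INR k + 1 <= INR j) by (rewrite <- S_INR; apply le_INR; lia). nra. }
      set (z := Cadd (l j) (Cconj (l k))).
      (* The gap gives [(Im z)^2 >= 4 a^2 Q^4 x^2]. One factor [Q^2] is given up to absorb
         [(Re z)^2 <= 4 eps^2] and [a^2], so that the shape [4 x^2 - 1] of the telescoping rows
         remains. *)
      set (D := a ^ 2 * Q ^ 2 * (4 * x ^ 2 - 1)).
      assert (Ha2 : 0 < a ^ 2) by nra. assert (HQ2 : 1 < Q ^ 2) by nra.
      assert (HD : 0 < D). { unfold D. apply Rmult_lt_0_compat; [|lra]. apply Rmult_lt_0_compat; lra. }
      assert (HB := sin_ex_bound (p j) (p k) z a L D Q Ha HL HD).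
      assert (Hz1 : Rabs (Re z) <= 2 * eps).
      { unfold z; cbn. eapply Rle_trans; [apply Rabs_triang|]. pose proof (Hre j Hj). pose proof (Hre k Hk). lra. }
      assert (Hz2 : g ^ 2 * x ^ 2 <= Im z ^ 2).
      { specialize (Him j k Hj Hk). fold x in Him. unfold z; cbn -[pow].
        rewrite <- (pow2_abs x), <- (pow2_abs (Im (l j) + - Im (l k))), <- Rpow_mult_distr.
        apply pow_incr. split; auto. apply Rmult_le_pos; [nra|apply Rabs_pos]. }
      assert (Hg2 : 4 * a ^ 2 * Q ^ 4 <= g ^ 2).
      { replace (4 * a ^ 2 * Q ^ 4) with ((2 * a * Q ^ 2) ^ 2) by ring. apply pow_incr. split; auto. nra. }
      assert (Hz3 : Re z ^ 2 <= 4 * eps ^ 2).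
      { rewrite <- pow2_abs. replace (4 * eps ^ 2) with ((2 * eps) ^ 2) by ring. apply pow_incr. split; auto. apply Rabs_pos. }
      assert (h1 : D <= Im z ^ 2 - Re z ^ 2 - a ^ 2).
      { unfold D. assert (4 * a ^ 2 * Q ^ 4 * x ^ 2 <= g ^ 2 * x ^ 2) by (apply Rmult_le_compat_r; lra).
        assert (a ^ 2 * (Q ^ 2 - 1) <= a ^ 2 * (Q ^ 2 * (Q ^ 2 - 1)) * x ^ 2).
        { rewrite Rmult_assoc. apply Rmult_le_compat_l; [lra|]. rewrite Rmult_comm.
          assert (0 < Q ^ 2 - 1) by lra.
          assert (1 * 1 <= Q ^ 2 * x ^ 2) by (apply Rmult_le_compat; lra).
          replace (Q ^ 2 * (Q ^ 2 - 1) * x ^ 2) with ((Q ^ 2 * x ^ 2) * (Q ^ 2 - 1)) by ring. nra. }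
        assert (0 <= a ^ 2 * (Q ^ 2 * (Q ^ 2 - 1)) * x ^ 2).
        { apply Rmult_le_pos; [|nra]. apply Rmult_le_pos; [lra|]. apply Rmult_le_pos; lra. }
        replace (4 * a ^ 2 * Q ^ 4 * x ^ 2) with
          (4 * a ^ 2 * Q ^ 2 * x ^ 2 + 4 * (a ^ 2 * (Q ^ 2 * (Q ^ 2 - 1)) * x ^ 2)) in * by ring.
        nra. }
      assert (h2 : exp (Re z * L) <= Q).
      { eapply Rle_trans; [|exact Hexp]. apply exp_mono. apply Rabs_le_between in Hz1. nra. }
      specialize (HB h1 h2). fold (J j k) in HB.
      replace (a * ((1 + Q) / D * ((N2 (p j) + N2 (p k)) / 2)))
        with (s * (/ (4 * x ^ 2 - 1) * ((N2 (p j) + N2 (p k)) / 2))) in HB by (unfold s, D; field; repeat split; nra).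
      apply Rabs_le_between in HB. unfold J in *. fold z. lra. }
  (* Schur test: by symmetry of [K], both halves of [(N2 (p j) + N2 (p k)) / 2] lead to row sums of
     [K], each at most 1. *)
  assert (HK : rsum (fun j => rsum (fun k => s * (K j k * ((N2 (p j) + N2 (p k)) / 2))) n) n
     <= s * rsum (fun j => N2 (p j)) n).
  { assert (Ksym : forall j k, K j k = K k j).
    { intros j k. unfold K. rewrite Nat.eqb_sym. replace ((INR j - INR k) ^ 2) with ((INR k - INR j) ^ 2) by ring. auto. }
    rewrite (rsum_ext _ (fun j => s * (/ 2 * (N2 (p j) * rsum (K j) n) + / 2 * rsum (fun k => K k j * N2 (p k)) n))).
    - rewrite rsum_scal, rsum_plus, !rsum_scal, (rsum_exchange (fun j k => K k j * N2 (p k))).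
      rewrite (rsum_ext (fun k => rsum (fun j => K k j * N2 (p k)) n) (fun k => N2 (p k) * rsum (K k) n)).
      + apply Rmult_le_compat_l; auto.
        assert (rsum (fun j => N2 (p j) * rsum (K j) n) n <= rsum (fun j => N2 (p j)) n).
        { apply rsum_le; intros j Hj. pose proof (row_sum j n Hj) as hr. fold (K j) in hr.
          pose proof (N2_ge0 (p j)). assert (rsum (K j) n <= 1) by exact hr. nra. }
        lra.
      + intros k _. rewrite <- rsum_scal. apply rsum_ext; intros; ring.
    - intros j _. rewrite rsum_scal. f_equal. rewrite <- !rsum_scal, <- rsum_plus.
      apply rsum_ext; intros k _. rewrite (Ksym k j). field. }
  assert (Hd : forall x, rsum (fun j => rsum (fun k => d x j k) n) n = x * rsum (fun j => N2 (p j)) n).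
  { intros x. rewrite <- rsum_scal. apply rsum_ext; intros j Hj. unfold d.
    assert (forall m, rsum (fun k => if Nat.eqb j k then x * N2 (p j) else 0) m =
       if Nat.ltb j m then x * N2 (p j) else 0) as ->.
    { induction m; [cbn; auto|]. cbn [rsum]. rewrite IHm.
      destruct (Nat.eqb_spec j m), (Nat.ltb_spec j m), (Nat.ltb_spec j (S m)); try lia; ring. }
    destruct (Nat.ltb_spec j n); [auto|lia]. }
  rewrite HW. split.
  - apply Rle_trans with (rsum (fun j => rsum (fun k => d (2 / (a * Q)) j k + (-1) * (s * (K j k * ((N2 (p j) + N2 (p k)) / 2)))) n) n).
    + rewrite (rsum2_lin (d (2 / (a * Q)))), Hd.
      replace ((Q - 1) / (a * Q ^ 2)) with (2 / (a * Q) - s) by (unfold s; field; lra). lra.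
    + apply rsum_le; intros j Hj; apply rsum_le; intros k Hk. destruct (HJ j k Hj Hk). lra.
  - apply Rle_trans with (rsum (fun j => rsum (fun k => d (2 * Q / a) j k + 1 * (s * (K j k * ((N2 (p j) + N2 (p k)) / 2)))) n) n).
    + apply rsum_le; intros j Hj; apply rsum_le; intros k Hk. destruct (HJ j k Hj Hk). lra.
    + rewrite (rsum2_lin (d (2 * Q / a))), Hd. lra.
Qed.


(** Factoring out [e^{yt}], which is bounded above and below on the interval, brings the real parts
    of the exponents within [eps] of 0, where [ingham_weighted] applies. The sine weight is at most
    1, which gives the lower bound. *)
Lemma ingham (y g T : R) : 0 < T -> 2 * PI < g * T ->
  exists eps A B, 0 < eps /\ 0 < A /\ 0 < B /\
  forall (l p : nat -> Cplx) (n : nat),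
  (forall i, (i < n)%nat -> Rabs (Re (l i) - y) <= eps) ->
  (forall i j, (i < n)%nat -> (j < n)%nat -> g * Rabs (INR i - INR j) <= Rabs (Im (l i) - Im (l j))) ->
  A * rsum (fun i => N2 (p i)) n <= RI (fun t => csum (fun i => Cmul (p i) (cexp (l i) t)) n) T /\
  RI (fun t => csum (fun i => Cmul (p i) (cexp (l i) t)) n) T <= B * rsum (fun i => N2 (p i)) n.
Proof.
  intros HT HgT. pose proof PI_RGT_0 as Hpi.
  (* The weight [sin (a t)] on [(0, T)] serves the lower bound. The upper bound uses [sin (b t)] on
     [(0, 3 T)], which is at least 1/2 on the middle third. *)
  set (a := PI / T). set (b := PI / (3 * T)).
  assert (Ha : 0 < a) by (apply Rdiv_lt_0_compat; lra).
  assert (Hb : 0 < b) by (apply Rdiv_lt_0_compat; lra).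
  assert (HaT : a * T = PI) by (unfold a; field; lra).
  assert (HbT : b * (3 * T) = PI) by (unfold b; field; lra).
  set (k := g / (2 * a)).
  assert (Hk : 1 < k).
  { unfold k. apply Rmult_lt_reg_r with (2 * a); [lra|]. unfold Rdiv. rewrite Rmult_assoc, Rinv_l by lra.
    apply Rmult_lt_reg_r with T; [lra|]. rewrite Rmult_1_l, Rmult_1_r. replace (2 * a * T) with (2 * PI) by lra. lra. }
  (* With this choice [2 a Q^2 = g], and [Q > 1] expresses [g T > 2 pi]. *)
  set (Q := sqrt k). assert (HQ2 : Q ^ 2 = k) by (apply pow2_sqrt; lra).
  assert (HQ : 1 < Q). { unfold Q. rewrite <- sqrt_1. apply sqrt_lt_1_alt; lra. }
  assert (Hga : 2 * a * Q ^ 2 <= g). { rewrite HQ2. unfold k. right; field; lra. }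
  assert (Hba : b <= a) by nra.
  assert (Hgb : 2 * b * Q ^ 2 <= g) by nra.
  assert (HlnQ : 0 < ln Q) by (rewrite <- ln_1; apply ln_increasing; lra).
  set (s := sqrt (Q ^ 2 - 1)). assert (Hs2 : s ^ 2 = Q ^ 2 - 1) by (apply pow2_sqrt; nra).
  assert (Hs : 0 < s) by (apply sqrt_lt_R0; nra).
  (* The first bound keeps the exponential factor below [Q] even over length [3 T]. The second gives
     [4 eps^2 <= b^2 (Q^2 - 1)], and hence the same with [a >= b]. *)
  set (eps := Rmin (ln Q / (6 * T)) (b * s / 2)).
  assert (He0 : 0 < eps). { apply Rmin_glb_lt; [apply Rdiv_lt_0_compat; lra|nra]. }
  assert (He1 : 6 * eps * T <= ln Q).
  { apply Rle_trans with (6 * (ln Q / (6 * T)) * T); [|right; field; lra].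
    apply Rmult_le_compat_r; [lra|]. apply Rmult_le_compat_l; [lra|apply Rmin_l]. }
  assert (He2 : eps <= b * s / 2) by apply Rmin_r.
  assert (He2b : 4 * eps ^ 2 <= b ^ 2 * (Q ^ 2 - 1)).
  { rewrite <- Hs2. replace (b ^ 2 * s ^ 2) with (4 * (b * s / 2) ^ 2) by field.
    apply Rmult_le_compat_l; [lra|]. apply pow_incr; lra. }
  assert (He2a : 4 * eps ^ 2 <= a ^ 2 * (Q ^ 2 - 1)).
  { eapply Rle_trans; [exact He2b|]. apply Rmult_le_compat_r; [nra|]. apply pow_incr; lra. }
  assert (He3 : exp (2 * eps * T) <= Q).
  { rewrite <- (exp_ln Q) by lra. apply exp_mono. nra. }
  assert (He4 : exp (2 * eps * (3 * T)) <= Q).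
  { rewrite <- (exp_ln Q) by lra. apply exp_mono. nra. }
  set (A0 := (Q - 1) / (a * Q ^ 2)). set (B0 := 2 * Q / b + (1 + Q) / (b * Q ^ 2)).
  assert (HA0 : 0 < A0). { apply Rdiv_lt_0_compat; nra. }
  assert (HB0 : 0 < B0). { apply Rplus_lt_0_compat; apply Rdiv_lt_0_compat; nra. }
  set (Y := exp (2 * Rabs y * T)). assert (HY : 0 < Y) by apply exp_pos.
  (* [Y] compensates [e^{2yt}], the 2 comes from the weight being at least 1/2, and [Q] from the
     translation of the coefficients by [T]. *)
  exists eps, (A0 / Y), (Y * (2 * (B0 * Q))).
  split; [auto|]. split; [apply Rdiv_lt_0_compat; auto|]. split; [apply Rmult_lt_0_compat; auto; nra|].
  intros l p n Hre Him.
  set (f := fun t => csum (fun i => Cmul (p i) (cexp (l i) t)) n).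
  set (m := fun i => Csub (l i) (RtoC y)).
  set (h := fun t => csum (fun i => Cmul (p i) (cexp (m i) t)) n).
  assert (Hf : cont f) by (apply cont_csum; intros; apply cont_term).
  assert (Hh : cont h) by (apply cont_csum; intros; apply cont_term).
  assert (Hfh : forall t, N2 (f t) = exp (2 * y * t) * N2 (h t)).
  { intros t. change (2 * y * t) with (2 * Re (RtoC y) * t). rewrite <- N2_ex, Rmult_comm, <- N2_mul.
    f_equal. unfold f, h. rewrite csum_mul_r. apply csum_ext; intros i _.
    replace (l i) with (Cadd (m i) (RtoC y)) at 1 by (unfold m; cring). rewrite ex_add_l. cring. }
  assert (Hrem : forall i, (i < n)%nat -> Rabs (Re (m i)) <= eps).
  { intros i Hi. unfold m; cbn. apply Hre; auto. }
  assert (Himm : forall i j, (i < n)%nat -> (j < n)%nat -> g * Rabs (INR i - INR j) <= Rabs (Im (m i) - Im (m j))).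
  { intros i j Hi Hj. replace (Im (m i) - Im (m j)) with (Im (l i) - Im (l j)) by (unfold m; cbn; ring). auto. }
  assert (Hint : forall T, RInt (fun t => N2 (f t)) 0 T = RI f T) by reflexivity.
  set (X := rsum (fun i => N2 (p i)) n).
  assert (Hyt : forall t, 0 < t < T -> Rabs (2 * y * t) <= 2 * Rabs y * T).
  { intros t Ht. rewrite !Rabs_mult, (Rabs_pos_eq 2), (Rabs_pos_eq t) by lra. pose proof (Rabs_pos y). nra. }
  split.
  - destruct (ingham_weighted a T Q eps g m p n) as [H _]; auto; try lra.
    fold A0 X in H. fold h in H.
    apply Rmult_le_reg_l with Y; auto. replace (Y * (A0 / Y * X)) with (A0 * X) by (field; lra).
    eapply Rle_trans; [exact H|]. unfold RI. rewrite <- RInt_scalR by (apply ex_RI; auto).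
    apply RInt_le; [lra| |apply ex_RInt_scalR, ex_RI; auto|].
    + apply cont_ex_RInt. intros t. apply (continuous_mult (K := R_AbsRing)); [|apply cont_N2; auto].
      revert t; apply continuous_derivable. intros; auto_derive; auto.
    + intros t Ht. fold (h t). rewrite Hfh, <- Rmult_assoc. pose proof (N2_ge0 (h t)).
      apply Rmult_le_compat_r; auto. apply Rle_trans with 1; [apply SIN_bound|].
      unfold Y. rewrite <- exp_plus. apply exp_ge_1. specialize (Hyt t Ht). apply Rabs_le_between in Hyt. lra.
  (* The translated sum [F (t + T)] equals [h t], so the middle third of [(0, 3 T)] carries the norm
     of [h] on [(0, T)]. *)
  - set (p' := fun i => Cmul (p i) (cexp (m i) (- T))).
    destruct (ingham_weighted b (3 * T) Q eps g m p' n) as [_ H]; auto; try lra.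
    fold B0 in H. set (F := fun t => csum (fun i => Cmul (p' i) (cexp (m i) t)) n) in *.
    assert (HF : cont F) by (apply cont_csum; intros; apply cont_term).
    set (k0 := fun t => sin (b * t) * N2 (F t)).
    assert (Hk0 : forall t, continuous k0 t).
    { intros t. apply (continuous_mult (K := R_AbsRing)); [|apply cont_N2; auto].
      revert t; apply continuous_derivable. intros; auto_derive; auto. }
    assert (Hk0p : forall t, 0 < t < 3 * T -> 0 <= k0 t).
    { intros t Ht. apply Rmult_le_pos; [|apply N2_ge0]. apply sin_ge_0; [nra|]. rewrite <- HbT. nra. }
    assert (Hk0h : forall t, T < t < 2 * T -> / 2 * N2 (F t) <= k0 t).
    { intros t Ht. apply Rmult_le_compat_r; [apply N2_ge0|].
      replace (/ 2) with (sin (PI / 6)) by (rewrite sin_PI6; lra). destruct (Rle_dec (b * t) (PI / 2)).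
      - apply sin_incr_1; nra.
      - rewrite <- (sin_PI_x (b * t)). apply sin_incr_1; nra. }
    assert (HR : RInt k0 0 (3 * T) >= / 2 * RI h T).
    { rewrite <- (RInt_Chasles k0 0 T (3 * T)) by (apply cont_ex_RInt; auto).
      rewrite <- (RInt_Chasles k0 T (2 * T) (3 * T)) by (apply cont_ex_RInt; auto).
      match goal with |- plus ?u (plus ?v ?w) >= _ => change (u + (v + w) >= / 2 * RI h T) end.
      assert (0 <= RInt k0 0 T) by (apply RInt_ge_0; [lra|apply cont_ex_RInt; auto|intros; apply Hk0p; lra]).
      assert (0 <= RInt k0 (2 * T) (3 * T)) by (apply RInt_ge_0; [lra|apply cont_ex_RInt; auto|intros; apply Hk0p; lra]).
      assert (/ 2 * RI h T <= RInt k0 T (2 * T)).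
      { replace (RI h T) with (RInt (fun t => N2 (F t)) T (2 * T)).
        - rewrite <- RInt_scalR by (apply ex_RI; auto). apply RInt_le; [lra|apply ex_RInt_scalR, ex_RI; auto|apply cont_ex_RInt; auto|auto].
        - pose proof (RInt_comp_lin (V := R_CompleteNormedModule) (fun t => N2 (F t)) 1 T 0 T) as E.
          replace (1 * 0 + T) with T in E by ring. replace (1 * T + T) with (2 * T) in E by ring.
          rewrite <- E by (apply ex_RI; auto). apply RInt_ext. intros t _.
          transitivity (1 * N2 (F (1 * t + T))); [reflexivity|]. rewrite !Rmult_1_l. f_equal.
          unfold F, h, p'. apply csum_ext; intros i _.
          rewrite ex_add_r. replace (Cmul (p i) (cexp (m i) t)) with (Cmul (Cmul (p i) (cexp (m i) t)) (cexp (m i) 0)) by (rewrite ex_0_r; cring).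
          replace 0 with (- T + T) by ring. rewrite ex_add_r. cring. }
      lra. }
    assert (HX : rsum (fun i => N2 (p' i)) n <= Q * X).
    { unfold X. rewrite <- rsum_scal. apply rsum_le; intros i Hi. unfold p'. rewrite N2_mul, N2_ex, Rmult_comm.
      apply Rmult_le_compat_r; [apply N2_ge0|]. eapply Rle_trans; [|exact He3]. apply exp_mono.
      specialize (Hrem i Hi). apply Rabs_le_between in Hrem. nra. }
    apply Rle_trans with (Y * RI h T).
    + apply RI_le; auto; [lra|]. intros t Ht. rewrite Hfh. apply Rmult_le_compat_r; [apply N2_ge0|].
      apply exp_mono. specialize (Hyt t Ht). apply Rabs_le_between in Hyt. lra.
    + rewrite Rmult_assoc. apply Rmult_le_compat_l; [lra|].
      fold (k0) in H. assert (RInt k0 0 (3 * T) <= B0 * (Q * X)).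
      { eapply Rle_trans; [exact H|]. apply Rmult_le_compat_l; lra. }
      lra.
Qed.

(** * Consequences of the gap condition, and exponents in conjugate pairs *)

Lemma gap_iter (x : nat -> R) (g : R) (N : nat) : (forall n, (n >= N)%nat -> g <= x (S n) - x n) ->
  forall n k, (n >= N)%nat -> g * INR k <= x (n + k)%nat - x n.
Proof.
  intros H n k Hn. induction k.
  - rewrite Nat.add_0_r. cbn. lra.
  - rewrite Nat.add_succ_r, S_INR. specialize (H (n + k)%nat). assert (g <= x (S (n + k)) - x (n + k)%nat) by (apply H; lia). lra.
Qed.

Lemma gap_unbounded (x : nat -> R) (g : R) (N : nat) : 0 < g -> (forall n, (n >= N)%nat -> g <= x (S n) - x n) ->
  forall K, exists n1, forall n, (n >= n1)%nat -> K <= x n.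
Proof.
  intros Hg H K. destruct (INR_unbounded ((K - x N) / g)) as [k Hk].
  exists (N + k)%nat. intros n Hn.
  pose proof (gap_iter x g N H N (n - N)%nat (le_n _)) as h. replace (N + (n - N))%nat with n in h by lia.
  assert (INR k <= INR (n - N)) by (apply le_INR; lia).
  assert ((K - x N) / g * g < INR k * g) by (apply Rmult_lt_compat_r; lra).
  replace ((K - x N) / g * g) with (K - x N) in H1 by (field; lra). nra.
Qed.

(** Conjugates in reverse order, followed by the exponents themselves, form a list with increasing
    frequencies. Beyond [n1] every frequency is at least [g], so the gap persists across the middle.
    The constants serve all [n0 >= n1], which allows [n0] to be enlarged afterwards. *)
Lemma ingham_two_sided (lam : nat -> Cplx) (y g T : R) (N : nat) : 0 < T -> 0 < g -> 2 * PI < g * T ->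
  Un_cv (fun n => Re (lam n)) y ->
  (forall n, (n >= N)%nat -> g <= Im (lam (S n)) - Im (lam n)) ->
  exists n1 A B, 0 < A /\ 0 < B /\ forall n0, (n0 >= n1)%nat -> forall p q n,
  let f := fun t => csum (fun i => Cadd (Cmul (p i) (cexp (lam (n0 + i)%nat) t)) (Cmul (q i) (cexp (Cconj (lam (n0 + i)%nat)) t))) n in
  A * rsum (fun i => N2 (p i) + N2 (q i)) n <= RI f T /\ RI f T <= B * rsum (fun i => N2 (p i) + N2 (q i)) n.
Proof.
  intros HT Hg HgT Hy Hgap.
  destruct (ingham y g T HT HgT) as (eps & A & B & He & HA & HB & H).
  destruct (Hy eps He) as [N1 HN1].
  destruct (gap_unbounded _ g N Hg Hgap g) as [N2' HN2].
  exists (N + N1 + N2')%nat, A, B. split; [auto|]. split; [auto|].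
  intros n0 Hn0 p q n.
  set (l := fun j => if Nat.ltb j n then Cconj (lam (n0 + (n - 1 - j))%nat) else lam (n0 + (j - n))%nat).
  set (c := fun j => if Nat.ltb j n then q (n - 1 - j)%nat else p (j - n)%nat).
  assert (Hl1 : forall j, (j < n)%nat -> l j = Cconj (lam (n0 + (n - 1 - j))%nat)).
  { intros j Hj. unfold l. destruct (Nat.ltb_spec j n); [auto|lia]. }
  assert (Hl2 : forall j, l (n + j)%nat = lam (n0 + j)%nat).
  { intros j. unfold l. destruct (Nat.ltb_spec (n + j) n); [lia|]. f_equal. lia. }
  assert (Hc1 : forall j, (j < n)%nat -> c j = q (n - 1 - j)%nat).
  { intros j Hj. unfold c. destruct (Nat.ltb_spec j n); [auto|lia]. }
  assert (Hc2 : forall j, c (n + j)%nat = p j).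
  { intros j. unfold c. destruct (Nat.ltb_spec (n + j) n); [lia|]. f_equal. lia. }
  assert (Hsum : rsum (fun i => N2 (c i)) (n + n) = rsum (fun i => N2 (p i) + N2 (q i)) n).
  { rewrite rsum_split, rsum_plus, Rplus_comm. f_equal.
    - apply rsum_ext; intros i _. rewrite Hc2; auto.
    - rewrite (rsum_rev (fun i => N2 (q i))). apply rsum_ext; intros i Hi. rewrite Hc1; auto. }
  assert (Hf : forall t, csum (fun i => Cmul (c i) (cexp (l i) t)) (n + n) =
     csum (fun i => Cadd (Cmul (p i) (cexp (lam (n0 + i)%nat) t)) (Cmul (q i) (cexp (Cconj (lam (n0 + i)%nat)) t))) n).
  { intros t. rewrite csum_split, csum_add.
    rewrite (csum_ext (fun i => Cmul (c (n + i)%nat) (cexp (l (n + i)%nat) t)) (fun i => Cmul (p i) (cexp (lam (n0 + i)%nat) t)))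
     by (intros i _; rewrite Hc2, Hl2; auto).
    rewrite (csum_rev (fun i => Cmul (q i) _)).
    rewrite (csum_ext (fun i => Cmul (c i) _) (fun i => Cmul (q (n - 1 - i)%nat) (cexp (Cconj (lam (n0 + (n - 1 - i))%nat)) t)))
      by (intros i Hi; rewrite Hc1, Hl1; auto).
    cring. }
  cbv zeta. rewrite <- Hsum. rewrite <- (RI_ext _ _ T Hf). apply H.
  - intros i Hi. assert (Hr : exists k, (k >= n0)%nat /\ Re (l i) = Re (lam k)).
    { destruct (Nat.lt_ge_cases i n).
      - exists (n0 + (n - 1 - i))%nat. split; [lia|]. rewrite Hl1 by auto. reflexivity.
      - exists (n0 + (i - n))%nat. split; [lia|]. replace i with (n + (i - n))%nat at 1 by lia. rewrite Hl2. reflexivity. }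
    destruct Hr as (k & Hk & ->). left. apply HN1. lia.
  - assert (Hm : forall a b, (a <= b)%nat -> g * (INR b - INR a) <= Im (lam (n0 + b)%nat) - Im (lam (n0 + a)%nat)).
    { intros a b Hab. pose proof (gap_iter _ g N Hgap (n0 + a)%nat (b - a)%nat) as h.
      rewrite minus_INR in h by lia. replace (n0 + a + (b - a))%nat with (n0 + b)%nat in h by lia. apply h; lia. }
    assert (Hp : forall a, g <= Im (lam (n0 + a)%nat)) by (intros; apply HN2; lia).
    assert (Hlt : forall i j, (i <= j)%nat -> (j < n + n)%nat -> g * (INR j - INR i) <= Im (l j) - Im (l i)).
    { intros i j Hij Hj. destruct (Nat.lt_ge_cases j n) as [h|h].
      - rewrite !Hl1 by lia. cbn. pose proof (Hm (n - 1 - j)%nat (n - 1 - i)%nat ltac:(lia)) as h1.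
        rewrite !minus_INR in h1 by lia. lra.
      - replace (l j) with (lam (n0 + (j - n))%nat) by (replace j with (n + (j - n))%nat at 2 by lia; rewrite Hl2; auto).
        destruct (Nat.lt_ge_cases i n) as [h'|h'].
        + rewrite Hl1 by auto. cbn. pose proof (Hm 0%nat (j - n)%nat ltac:(lia)) as h1.
          pose proof (Hm 0%nat (n - 1 - i)%nat ltac:(lia)) as h2.
          rewrite !minus_INR in * by lia. cbn [INR] in *. pose proof (Hp 0%nat). lra.
        + replace (l i) with (lam (n0 + (i - n))%nat) by (replace i with (n + (i - n))%nat at 2 by lia; rewrite Hl2; auto).
          pose proof (Hm (i - n)%nat (j - n)%nat ltac:(lia)) as h1. rewrite !minus_INR in h1 by lia. lra. }
    intros i j Hi Hj. destruct (Nat.le_ge_cases i j) as [h|h].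
    + pose proof (Hlt i j h Hj). apply le_INR in h. rewrite Rabs_minus_sym, (Rabs_pos_eq (INR j - INR i)) by lra.
      rewrite Rabs_minus_sym. eapply Rle_trans; [eassumption|apply Rle_abs].
    + pose proof (Hlt j i h Hi). apply le_INR in h. rewrite (Rabs_pos_eq (INR i - INR j)) by lra.
      eapply Rle_trans; [eassumption|apply Rle_abs].
Qed.


(** * Filters killing finitely many exponentials *)

Lemma RInt_extR (f h : R -> R) a b : (forall x, f x = h x) -> RInt f a b = RInt h a b :> R.
Proof. intros H. apply RInt_ext. intros x _. apply H. Qed.

Lemma RInt_lin2 (f h : R -> R) a b u v : ex_RInt f a b -> ex_RInt h a b ->
  RInt (fun t => u * f t + v * h t) a b = u * RInt f a b + v * RInt h a b :> R.
Proof.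
  intros Hf Hh. rewrite (RInt_plusR (fun t => u * f t) (fun t => v * h t)) by (apply ex_RInt_scalR; auto).
  rewrite (RInt_scalR f), (RInt_scalR h) by auto. reflexivity.
Qed.

(** * Averages over the unit interval and the size of [1 - Phi] *)

Definition CI (h : R -> Cplx) : Cplx :=
  mkC (RInt (fun s => Re (h s)) 0 1) (RInt (fun s => Im (h s)) 0 1).

Lemma ex_RInt_Re h : cont h -> ex_RInt (fun s => Re (h s)) 0 1.
Proof. intros [H _]. apply cont_ex_RInt; auto. Qed.

Lemma ex_RInt_Im h : cont h -> ex_RInt (fun s => Im (h s)) 0 1.
Proof. intros [_ H]. apply cont_ex_RInt; auto. Qed.

Lemma CI_ext f h : (forall s, f s = h s) -> CI f = CI h.
Proof. intros H. unfold CI. f_equal; apply RInt_extR; intros; rewrite H; auto. Qed.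

Lemma CI_add f h : cont f -> cont h -> CI (fun s => Cadd (f s) (h s)) = Cadd (CI f) (CI h).
Proof.
  intros Hf Hh. unfold CI. apply Cplx_eq; cbn.
  - apply (RInt_plusR (fun s => Re (f s)) (fun s => Re (h s))); apply ex_RInt_Re; auto.
  - apply (RInt_plusR (fun s => Im (f s)) (fun s => Im (h s))); apply ex_RInt_Im; auto.
Qed.

Lemma CI_mul c h : cont h -> CI (fun s => Cmul c (h s)) = Cmul c (CI h).
Proof.
  intros Hh. pose proof (ex_RInt_Re h Hh) as h1. pose proof (ex_RInt_Im h Hh) as h2.
  unfold CI. apply Cplx_eq; cbn [Re Im Cmul].
  - transitivity (RInt (fun s => Re c * Re (h s) + (- Im c) * Im (h s)) 0 1).
    + apply RInt_extR; intros; ring.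
    + rewrite (RInt_lin2 (fun s => Re (h s)) (fun s => Im (h s))) by auto. ring.
  - rewrite (RInt_lin2 (fun s => Im (h s)) (fun s => Re (h s))) by auto. reflexivity.
Qed.

Lemma CI_const c : CI (fun _ => c) = c.
Proof. unfold CI. apply Cplx_eq; cbn [Re Im]; rewrite RInt_constR; ring. Qed.

(** The variance [int (h - m)^2] with [m = int h] is nonnegative. *)
Lemma RInt_sq_le (h : R -> R) : (forall s, continuous h s) -> (RInt h 0 1) ^ 2 <= RInt (fun s => h s ^ 2) 0 1.
Proof.
  intros Hh. set (m := RInt h 0 1).
  assert (h1 : ex_RInt h 0 1) by (apply cont_ex_RInt; auto).
  assert (h2 : ex_RInt (fun s => h s ^ 2) 0 1).
  { apply cont_ex_RInt. intros s. apply continuous_ext with (fun s => h s * h s); [intros; cbn; ring|].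
    apply (continuous_mult (K := R_AbsRing)); auto. }
  assert (E : RInt (fun s => h s ^ 2 + (-2 * m * h s + m ^ 2)) 0 1 = RInt (fun s => h s ^ 2) 0 1 + (-2 * m * m + m ^ 2) :> R).
  { rewrite (RInt_plusR (fun s => h s ^ 2) (fun s => -2 * m * h s + m ^ 2)); auto.
    - rewrite (RInt_plusR (fun s => -2 * m * h s) (fun _ => m ^ 2)), (RInt_scalR h), RInt_constR; auto.
      + fold m. ring.
      + apply ex_RInt_scalR; auto.
      + apply ex_RInt_const.
    - apply ex_RInt_plusR; [apply ex_RInt_scalR; auto|apply ex_RInt_const]. }
  assert (0 <= RInt (fun s => h s ^ 2 + (-2 * m * h s + m ^ 2)) 0 1).
  { apply RInt_ge_0; [lra| |].
    - apply ex_RInt_plusR; auto. apply ex_RInt_plusR; [apply ex_RInt_scalR; auto|apply ex_RInt_const].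
    - intros s _. pose proof (pow2_ge_0 (h s - m)). nra. }
  lra.
Qed.

Lemma N2_CI h : cont h -> N2 (CI h) <= RInt (fun s => N2 (h s)) 0 1.
Proof.
  intros Hh. destruct Hh as [h1 h2]. unfold N2 at 2, N2; cbn [Re Im CI].
  assert (E : forall k : R -> R, (forall s, continuous k s) -> ex_RInt (fun s => k s ^ 2) 0 1).
  { intros k Hk. apply cont_ex_RInt. intros s. apply continuous_ext with (fun s => k s * k s); [intros; cbn; ring|].
    apply (continuous_mult (K := R_AbsRing)); auto. }
  rewrite (RInt_plusR (fun s => Re (h s) ^ 2) (fun s => Im (h s) ^ 2)) by (apply E; auto).
  apply Rplus_le_compat; apply RInt_sq_le; auto.
Qed.

(** This is [(e^z - 1) / z] with the value 1 at 0; the integral form needs no case distinction. *)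
Definition Phi (z : Cplx) : Cplx := CI (fun s => cexp z s).

Lemma N2_Phi z : N2 (Phi z) <= exp (2 * Rabs (Re z)).
Proof.
  eapply Rle_trans; [apply N2_CI, cont_ex|].
  replace (exp (2 * Rabs (Re z))) with ((1 - 0) * exp (2 * Rabs (Re z))) by ring. rewrite <- RInt_constR.
  apply RInt_le; [lra|apply ex_RI, cont_ex|apply ex_RInt_const|].
  intros s Hs. rewrite N2_ex. apply exp_mono. pose proof (Rle_abs (Re z)). pose proof (Rabs_pos (Re z)). nra.
Qed.

Lemma Phi_0 : Phi C0 = RtoC 1.
Proof.
  unfold Phi. rewrite (CI_ext _ (fun _ => RtoC 1)); [apply CI_const|].
  intros s. change C0 with (RtoC 0). rewrite ex_real, Rmult_0_l, exp_0. reflexivity.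
Qed.

Lemma exp_small v : -1/4 <= v <= 1/4 -> v <= exp v - 1 /\ exp v - 1 <= v / (1 - v).
Proof.
  intros Hv. pose proof (exp_ineq1_le v). pose proof (exp_ineq1_le (- v)).
  rewrite exp_Ropp in *. pose proof (exp_pos v).
  split; [lra|].
  assert (exp v * (1 - v) <= 1).
  { apply Rle_trans with (exp v * / exp v); [apply Rmult_le_compat_l; lra|right; field; lra]. }
  apply Rmult_le_reg_r with (1 - v); [lra|]. unfold Rdiv. rewrite Rmult_assoc, Rinv_l by lra. lra.
Qed.

(** Applied at the exponents [r_n], where [w = d (r_n - chi)], this makes the filter at [chi]
    small. *)
Lemma Phi_real_small w : Rabs w <= 1/4 -> N2 (Csub (RtoC 1) (Phi (RtoC w))) <= 2 * w ^ 2.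
Proof.
  intros Hw. apply Rabs_le_between in Hw.
  replace (Csub (RtoC 1) (Phi (RtoC w))) with (CI (fun s => Cadd (RtoC 1) (Cmul (RtoC (-1)) (cexp (RtoC w) s)))).
  2:{ rewrite CI_add, CI_mul, CI_const; [unfold Phi; cring|apply cont_ex|apply cont_const|].
      apply cont_term. }
  assert (Hc : cont (fun s => Cadd (RtoC 1) (Cmul (RtoC (-1)) (cexp (RtoC w) s)))).
  { apply (cont_add (fun _ => RtoC 1)); [apply cont_const|apply cont_term]. }
  eapply Rle_trans; [apply N2_CI; auto|].
  replace (2 * w ^ 2) with ((1 - 0) * (2 * w ^ 2)) by ring. rewrite <- RInt_constR.
  apply RInt_le; [lra|apply ex_RI; auto|apply ex_RInt_const|].
  intros s Hs. rewrite ex_real. unfold N2; cbn -[exp pow].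
  assert (Hv : -1/4 <= w * s <= 1/4) by nra.
  destruct (exp_small (w * s) Hv) as [h1 h2].
  set (v := w * s) in *. set (e := exp v) in *.
  assert (hv : v ^ 2 <= w ^ 2) by (unfold v; rewrite Rpow_mult_distr; assert (s ^ 2 <= 1) by nra; pose proof (pow2_ge_0 w); nra).
  assert (h3 : Rabs (e - 1) <= 4 / 3 * Rabs v).
  { destruct (Rle_dec 0 v) as [h|h].
    - rewrite !Rabs_pos_eq by lra. eapply Rle_trans; [exact h2|].
      rewrite Rmult_comm. apply Rmult_le_compat_l; auto.
      apply Rmult_le_reg_r with (1 - v); [lra|]. rewrite Rinv_l by lra. lra.
    - assert (e <= 1). { unfold e. rewrite <- exp_0. apply exp_mono; lra. }
      rewrite (Rabs_left1 (e - 1)), (Rabs_left1 v) by lra. lra. }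
  assert (h4 : (e - 1) ^ 2 <= (4 / 3) ^ 2 * v ^ 2).
  { rewrite <- (pow2_abs (e - 1)), <- (pow2_abs v), <- Rpow_mult_distr. apply pow_incr. split; auto. apply Rabs_pos. }
  nra.
Qed.

Lemma sin_upper y : 0 <= y <= 2 -> sin y <= y - y ^ 3 / 6 + y ^ 5 / 120.
Proof.
  intros Hy. pose proof PI2_1. destruct (sin_bound y 0) as [_ h]; [lra|lra|].
  eapply Rle_trans; [exact h|]. unfold sin_approx, sin_term. cbn. right; field.
Qed.

Lemma sin_lower y : 0 <= y <= 1 -> 5 / 6 * y <= sin y.
Proof.
  intros Hy. pose proof PI2_1. destruct (sin_bound y 0) as [h _]; [lra|lra|].
  eapply Rle_trans; [|exact h]. unfold sin_approx, sin_term. cbn.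
  assert (0 <= y * (1 - y ^ 2)) by (apply Rmult_le_pos; nra).
  lra.
Qed.

Lemma cos_lower y : 0 <= y -> 1 - y ^ 2 / 2 <= cos y.
Proof.
  intros Hy. replace y with (2 * (y / 2)) at 2 by field. rewrite cos_2a_sin.
  destruct (Req_dec y 0) as [->|h]; [replace (0/2) with 0 by field; rewrite sin_0; lra|].
  assert (h1 : Rabs (sin (y / 2)) <= y / 2).
  { apply Rabs_le. split.
    - pose proof (SIN_bound (y/2)). pose proof PI2_1. destruct (Rle_dec (y / 2) PI).
      + assert (0 <= sin (y/2)) by (apply sin_ge_0; lra). lra.
      + lra.
    - left; apply sin_lt_x; lra. }
  apply Rabs_le_between in h1. nra.
Qed.

(** The Taylor polynomial of degree 5 settles [1 <= y <= 2]; beyond 2 the bound [sin y <= 1] is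
    enough. *)
Lemma sinc_le y : 1 <= y -> sin y / y <= 17 / 20.
Proof.
  intros Hy. apply Rmult_le_reg_r with y; [lra|]. unfold Rdiv at 1. rewrite Rmult_assoc, Rinv_l, Rmult_1_r by lra.
  destruct (Rle_dec y 2).
  - eapply Rle_trans; [apply sin_upper; lra|].
    assert (h : 1 - y ^ 2 / 6 + y ^ 4 / 120 <= 17 / 20).
    { assert (h1 : 1 <= y ^ 2) by nra. assert (h2 : y ^ 2 <= 4) by nra.
      replace (y ^ 4) with (y ^ 2 * y ^ 2) by ring. set (u := y ^ 2) in *. nra. }
    replace (y - y ^ 3 / 6 + y ^ 5 / 120) with ((1 - y ^ 2 / 6 + y ^ 4 / 120) * y) by field. nra.
  - pose proof (SIN_bound y). lra.
Qed.

(** The zeros of [1 - Phi] are 0 and the nonzero solutions of [e^z = 1 + z], all of which lie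
    outside the strip. Inside it, the real part of [Phi] stays away from 1 for [y >= 1]; near 0,
    [Phi z - 1] behaves like [z / 2], and the larger coordinate of [z] decides which part of it is
    estimated. *)
Lemma Phi_lower_pos z : Rabs (Re z) <= 1/20 -> 0 <= Im z ->
  1/1000 * Rmin 1 (N2 z) <= N2 (Csub (RtoC 1) (Phi z)).
Proof.
  intros Hx Hy. set (x := Re z) in *. set (y := Im z) in *. apply Rabs_le_between in Hx.
  set (I1 := RInt (fun s => exp (x * s) * cos (y * s)) 0 1).
  set (I2 := RInt (fun s => exp (x * s) * sin (y * s)) 0 1).
  assert (EQ : N2 (Csub (RtoC 1) (Phi z)) = (1 - I1) ^ 2 + I2 ^ 2).
  { unfold N2. cbn -[pow]. fold x y I1 I2. ring. }
  rewrite EQ.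
  assert (C1 : ex_RInt (fun s => exp (x * s) * cos (y * s)) 0 1).
  { apply cont_ex_RInt, continuous_derivable; intros; auto_derive; auto. }
  assert (C2 : ex_RInt (fun s => exp (x * s) * sin (y * s)) 0 1).
  { apply cont_ex_RInt, continuous_derivable; intros; auto_derive; auto. }
  assert (Hlin : forall a b, is_RInt (fun s => a + b * s) 0 1 (a + b / 2)).
  { intros a b. set (V := fun s => a * s + b * s ^ 2 / 2).
    replace (a + b / 2) with (V 1 - V 0) by (unfold V; field).
    apply is_RInt_FTC; unfold V.
    - intros; auto_derive; auto; field.
    - apply continuous_derivable; intros; auto_derive; auto. }
  assert (Hes : forall s, 0 < s < 1 -> Rabs (exp (x * s) - 1) <= 3/50).
  { intros s Hs. assert (Hv : -1/20 <= x * s <= 1/20) by nra.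
    destruct (exp_small (x * s)) as [h1 h2]; [lra|].
    apply Rabs_le; split; [lra|]. eapply Rle_trans; [exact h2|].
    apply Rmult_le_reg_r with (1 - x * s); [lra|]. unfold Rdiv. rewrite Rmult_assoc, Rinv_l by lra. lra. }
  pose proof (Rmin_l 1 (N2 z)) as m1. pose proof (Rmin_r 1 (N2 z)) as m2.
  assert (EN : N2 z = x ^ 2 + y ^ 2) by reflexivity.
  destruct (Rle_dec 1 y) as [hy|hy].
  (* The exponential factor differs from 1 by at most 3/50 and [sin y / y <= 17/20]. *)
  - assert (h : I1 <= 1 - 1/25).
    { assert (HV : is_RInt (fun s => cos (y * s)) 0 1 (sin y / y)).
      { set (V := fun s => sin (y * s) / y).
        replace (sin y / y) with (V 1 - V 0) by (unfold V; rewrite Rmult_1_r, Rmult_0_r, sin_0; field; lra).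
        apply is_RInt_FTC; unfold V.
        - intros; auto_derive; auto; field; lra.
        - apply continuous_derivable; intros; auto_derive; auto. }
      apply Rle_trans with (RInt (fun s => cos (y * s) + (3/50 + 0 * s)) 0 1).
      - apply RInt_le; [lra|auto| |].
        + apply ex_RInt_plusR; [eexists; exact HV|eexists; apply Hlin].
        + intros s Hs. specialize (Hes s Hs). apply Rabs_le_between in Hes.
          pose proof (COS_bound (y * s)). nra.
      - rewrite (RInt_plusR (fun s => cos (y * s)) (fun s => 3/50 + 0 * s)); [|eexists; exact HV|eexists; apply Hlin].
        assert (E1 : RInt (fun s => cos (y * s)) 0 1 = sin y / y :> R) by (apply is_RInt_unique; auto).
        assert (E2 : RInt (fun s => 3/50 + 0 * s) 0 1 = 3/50 + 0 / 2 :> R) by (apply is_RInt_unique; auto).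
        rewrite E1, E2. pose proof (sinc_le y hy). lra. }
    pose proof (pow2_ge_0 I2). nra.
  (* The constant 3/4 under the integral is [9/10 * 5/6], from [e^{xs} >= 9/10] and
     [sin u >= 5/6 u]; integrating [s] halves it. *)
  - assert (h2 : 3/8 * y <= I2).
    { replace (3/8 * y) with (RInt (fun s => 0 + (3/4 * y) * s) 0 1).
      - apply RInt_le; [lra|eexists; apply Hlin|auto|].
        intros s Hs. specialize (Hes s Hs). apply Rabs_le_between in Hes.
        assert (h : 5/6 * (y * s) <= sin (y * s)) by (apply sin_lower; nra).
        assert (0 <= y * s) by nra.
        apply Rle_trans with (9/10 * (5/6 * (y * s))); [lra|]. apply Rmult_le_compat; lra.
      - apply is_RInt_unique. replace (3/8 * y) with (0 + (3/4 * y) / 2) by field. apply Hlin. }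
    destruct (Rle_dec (Rabs x) y) as [hxy|hxy].
    + apply Rabs_le_between in hxy. assert (x ^ 2 <= y ^ 2) by nra.
      assert ((3/8 * y) ^ 2 <= I2 ^ 2) by (apply pow_incr; lra).
      pose proof (pow2_ge_0 (1 - I1)). nra.
    (* Here [y < |x| <= 1/20], so the quadratic loss from the cosine is small against [|x|], and the
       slope 1/2 of [Phi] at 0 survives as 2/5. *)
    + assert (h1 : (2/5 * x) ^ 2 <= (1 - I1) ^ 2).
      { destruct (Rle_dec 0 x) as [h|h].
        - rewrite Rabs_pos_eq in hxy by auto.
          assert (1 + 2/5 * x <= I1).
          { apply Rle_trans with (1 + (x - 2/3 * y ^ 2) / 2); [nra|].
            rewrite <- (is_RInt_unique _ _ _ _ (Hlin 1 (x - 2/3 * y ^ 2))).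
            apply RInt_le; [lra|eexists; apply Hlin|auto|].
            intros s Hs. specialize (Hes s Hs). apply Rabs_le_between in Hes.
            pose proof (exp_ineq1_le (x * s)).
            pose proof (cos_lower (y * s)) as hc. assert (0 <= y * s) by nra. specialize (hc H0).
            assert ((y * s) ^ 2 <= y ^ 2 * s).
            { rewrite Rpow_mult_distr. apply Rmult_le_compat_l; nra. }
            assert (exp (x * s) * (1 - (y * s) ^ 2 / 2) <= exp (x * s) * cos (y * s)).
            { apply Rmult_le_compat_l; auto. left; apply exp_pos. }
            assert (exp (x * s) * ((y * s) ^ 2 / 2) <= 53/50 * ((y * s) ^ 2 / 2)).
            { apply Rmult_le_compat_r; [|lra]. pose proof (pow2_ge_0 (y * s)). lra. }
            assert (0 <= y ^ 2 * s) by (apply Rmult_le_pos; nra). lra. }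
          nra.
        - assert (I1 <= 1 + 2/5 * x).
          { replace (1 + 2/5 * x) with (1 + (4/5 * x) / 2) by field.
            rewrite <- (is_RInt_unique _ _ _ _ (Hlin 1 (4/5 * x))).
            apply RInt_le; [lra|auto|eexists; apply Hlin|].
            intros s Hs. assert (Hv : -1/20 <= x * s <= 0) by nra.
            destruct (exp_small (x * s)) as [e1 e2]; [lra|].
            apply Rle_trans with (exp (x * s)).
            + pose proof (exp_pos (x * s)). pose proof (COS_bound (y * s)). nra.
            + assert (x * s / (1 - x * s) <= 4/5 * (x * s)).
              { apply Rmult_le_reg_r with (1 - x * s); [lra|]. unfold Rdiv at 1. rewrite Rmult_assoc, Rinv_l by lra. nra. }
              lra. }
          nra. }
      assert (y ^ 2 <= x ^ 2). { rewrite <- (pow2_abs x). apply pow_incr; lra. }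
      pose proof (pow2_ge_0 I2). nra.
Qed.

Lemma Phi_conj z : Phi (Cconj z) = Cconj (Phi z).
Proof.
  unfold Phi, CI. apply Cplx_eq; cbn [Re Im Cconj].
  - apply RInt_extR; intros s. rewrite ex_conj. reflexivity.
  - transitivity (RInt (fun s => (-1) * Im (cexp z s)) 0 1).
    + apply RInt_extR; intros s. rewrite ex_conj. cbn [Im Cconj]. ring.
    + rewrite (RInt_scalR (fun s => Im (cexp z s))); [ring|apply ex_RInt_Im, cont_ex].
Qed.

Lemma Phi_lower z : Rabs (Re z) <= 1/20 -> 1/1000 * Rmin 1 (N2 z) <= N2 (Csub (RtoC 1) (Phi z)).
Proof.
  intros Hx. destruct (Rle_dec 0 (Im z)) as [h|h]; [apply Phi_lower_pos; auto|].
  rewrite <- (N2_conj z), <- (N2_conj (Csub _ _)).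
  replace (Cconj (Csub (RtoC 1) (Phi z))) with (Csub (RtoC 1) (Phi (Cconj z))) by (rewrite Phi_conj; cring).
  apply Phi_lower_pos; cbn; lra.
Qed.


(** * Exponential polynomials and multipliers *)

Fixpoint esum (l : list (Cplx * Cplx)) (t : R) : Cplx :=
  match l with nil => C0 | (p, k) :: l' => Cadd (esum l' t) (Cmul p (cexp k t)) end.

(** Exponents may repeat in the list: the action is pair by pair, so that addition of exponential
    polynomials is concatenation. *)
Definition emap (m : Cplx -> Cplx) (l : list (Cplx * Cplx)) : list (Cplx * Cplx) :=
  map (fun pk => (Cmul (m (snd pk)) (fst pk), snd pk)) l.

(* The exponential polynomial [g] is obtained from [f] by multiplying the
   coefficient of each [e^{k t}] by [m k]. *)
Definition filt (m : Cplx -> Cplx) (f g : R -> Cplx) : Prop :=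
  exists l, (forall t, f t = esum l t) /\ (forall t, g t = esum (emap m l) t).

Lemma emap_cons m p k l : emap m ((p, k) :: l) = (Cmul (m k) p, k) :: emap m l.
Proof. reflexivity. Qed.

Lemma cont_esum l : cont (esum l).
Proof.
  induction l as [|[p k] l IH]; cbn.
  - apply cont_const.
  - apply cont_add; [exact IH|apply cont_term].
Qed.

Lemma esum_app l l' t : esum (l ++ l') t = Cadd (esum l t) (esum l' t).
Proof. induction l as [|[p k] l IH]; cbn; [cring|]. rewrite IH. cring. Qed.

Lemma filt_cont m f g : filt m f g -> cont f /\ cont g.
Proof.
  intros (l & H1 & H2). split.
  - apply cont_ext with (esum l); [auto|apply cont_esum].
  - apply cont_ext with (esum (emap m l)); [auto|apply cont_esum].
Qed.

Lemma filt_zero m : filt m (fun _ => C0) (fun _ => C0).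
Proof. exists nil. split; reflexivity. Qed.

Lemma filt_term m p k : filt m (fun t => Cmul p (cexp k t)) (fun t => Cmul (Cmul (m k) p) (cexp k t)).
Proof. exists [(p, k)]. split; intros t; cbn; cring. Qed.

Lemma filt_add m f g f' g' : filt m f g -> filt m f' g' ->
  filt m (fun t => Cadd (f t) (f' t)) (fun t => Cadd (g t) (g' t)).
Proof.
  intros (l & H1 & H2) (l' & H3 & H4). exists (l ++ l'). unfold emap in *. rewrite map_app. split; intros t.
  - rewrite esum_app, H1, H3. reflexivity.
  - rewrite esum_app, H2, H4. reflexivity.
Qed.

Lemma filt_ext m f g f' g' : (forall t, f t = f' t) -> (forall t, g t = g' t) -> filt m f g -> filt m f' g'.
Proof. intros H1 H2 (l & H3 & H4). exists l. split; intros t; [rewrite <- H1|rewrite <- H2]; auto. Qed.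

Lemma filt_csum m (f g : nat -> R -> Cplx) n : (forall i, (i < n)%nat -> filt m (f i) (g i)) ->
  filt m (fun t => csum (fun i => f i t) n) (fun t => csum (fun i => g i t) n).
Proof. intros H; induction n; cbn; [apply filt_zero|]. apply filt_add; auto. Qed.

Lemma filt_kill m p k : p = C0 \/ m k = C0 -> filt m (fun t => Cmul p (cexp k t)) (fun _ => C0).
Proof.
  intros H. eapply filt_ext; [intros; reflexivity| |apply filt_term].
  intros t; cbn beta. destruct H as [-> | ->]; cring.
Qed.

Definition fmul (d : R) (k0 k : Cplx) : Cplx := Csub (RtoC 1) (Phi (Cmul (RtoC d) (Csub k k0))).

(** Term by term, [e^{-k0 d s} e^{k (t + d s)} = e^{kt} e^{d (k - k0) s}], whose average over [s] is
    [e^{kt}] times a value of [Phi]. *)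
Lemma CI_esum k0 d t l :
  CI (fun s => Cmul (cexp k0 (- (d * s))) (esum l (t + d * s))) =
  esum (emap (fun k => Phi (Cmul (RtoC d) (Csub k k0))) l) t.
Proof.
  assert (Hk : cont (fun s => cexp k0 (- (d * s)))).
  { apply cont_ext with (fun s => cexp k0 (0 + (- d) * s)); [intros; f_equal; ring|]. apply (cont_affine (cexp k0)), cont_ex. }
  induction l as [|[p k] l IH]; cbn [esum emap map fst snd].
  - transitivity (CI (fun _ => C0)); [apply CI_ext; intros; cring|apply CI_const].
  - fold (emap (fun k => Phi (Cmul (RtoC d) (Csub k k0))) l). rewrite <- IH.
    rewrite (CI_ext _ (fun s => Cadd (Cmul (cexp k0 (- (d * s))) (esum l (t + d * s)))
       (Cmul (Cmul p (cexp k t)) (cexp (Cmul (RtoC d) (Csub k k0)) s)))).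
    + rewrite CI_add, CI_mul; [unfold Phi; cring|apply cont_ex| |apply cont_term].
      apply cont_mul; [exact Hk|]. apply cont_affine, cont_esum.
    + intros s. rewrite ex_add_r.
      assert (E : cexp (Cmul (RtoC d) (Csub k k0)) s = Cmul (cexp k (d * s)) (cexp k0 (- (d * s)))).
      { unfold cexp. apply Cplx_eq; cbn -[exp cos sin].
        - replace ((d * (Re k + - Re k0) - 0 * (Im k + - Im k0)) * s) with (Re k * (d * s) + Re k0 * - (d * s)) by ring.
          replace ((d * (Im k + - Im k0) + 0 * (Re k + - Re k0)) * s) with (Im k * (d * s) + Im k0 * - (d * s)) by ring.
          rewrite exp_plus, cos_plus. ring.
        - replace ((d * (Re k + - Re k0) - 0 * (Im k + - Im k0)) * s) with (Re k * (d * s) + Re k0 * - (d * s)) by ring.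
          replace ((d * (Im k + - Im k0) + 0 * (Re k + - Re k0)) * s) with (Im k * (d * s) + Im k0 * - (d * s)) by ring.
          rewrite exp_plus, sin_plus. ring. }
      rewrite E. cring.
Qed.

(* The multiplier [fmul d k0] is realised by
   [f t - int_0^1 e^{- k0 d s} f (t + d s) ds], which kills [e^{k0 t}]. *)
Lemma filt_step k0 d T : 0 < d -> 0 <= T -> exists K, 0 < K /\ forall f g, filt (fmul d k0) f g ->
  RI g T <= K * RI f (T + d).
Proof.
  intros Hd HT. set (E := exp (2 * Rabs (Re k0) * d)). assert (HE : 0 < E) by apply exp_pos.
  exists (2 + 2 * (E / d) * T). split.
  { assert (0 <= 2 * (E / d) * T); [|lra]. apply Rmult_le_pos; auto. apply Rmult_le_pos; [lra|].
    left; apply Rdiv_lt_0_compat; auto. }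
  intros f g Hfg. destruct (filt_cont _ _ _ Hfg) as [Hf Hg]. destruct Hfg as (l & H1 & H2).
  set (h := fun t s => Cmul (cexp k0 (- (d * s))) (esum l (t + d * s))).
  assert (Hh : forall t, cont (h t)).
  { intros t. apply cont_mul; [|apply cont_affine, cont_esum].
    apply cont_ext with (fun s => cexp k0 (0 + (- d) * s)); [intros; f_equal; ring|]. apply (cont_affine (cexp k0)), cont_ex. }
  assert (Hgt : forall t, g t = Csub (f t) (CI (h t))).
  { intros t. rewrite H2, H1. unfold h. rewrite CI_esum. clear.
    induction l as [|[p k] l IH]; [cring|]. rewrite !emap_cons. cbn [esum]. rewrite IH. unfold fmul. cring. }
  (* The substitution [t + d s] turns the average into an integral over [(t, t + d)], a part of
     [(0, T + d)]. The bound is therefore uniform in [t], with a factor [1 / d]. *)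
  assert (HI : forall t, 0 < t < T -> N2 (CI (h t)) <= E / d * RI f (T + d)).
  { intros t Ht. eapply Rle_trans; [apply N2_CI; auto|].
    assert (HF : cont (fun s => f (t + d * s))) by (apply (cont_affine f); auto).
    apply Rle_trans with (E / d * RInt (fun s => d * N2 (f (t + d * s))) 0 1).
    - assert (Hc : ex_RInt (fun s => N2 (f (t + d * s))) 0 1).
      { apply (ex_RI (fun s => f (t + d * s))); auto. }
      rewrite (RInt_scalR (fun s => N2 (f (t + d * s)))) by auto.
      replace (E / d * (d * RInt (fun s => N2 (f (t + d * s))) 0 1)) with (E * RInt (fun s => N2 (f (t + d * s))) 0 1)
        by (field; lra).
      rewrite <- RInt_scalR by auto. apply RInt_le; [lra|apply ex_RI; auto|apply ex_RInt_scalR; auto|].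
      intros s Hs. unfold h. rewrite N2_mul, N2_ex, <- H1. apply Rmult_le_compat_r; [apply N2_ge0|].
      apply exp_mono. pose proof (Rle_abs (- Re k0)) as ha. rewrite Rabs_Ropp in ha. pose proof (Rabs_pos (Re k0)).
      assert (- Re k0 * (d * s) <= Rabs (Re k0) * (d * s)) by (apply Rmult_le_compat_r; nra).
      assert (Rabs (Re k0) * (d * s) <= Rabs (Re k0) * d) by (apply Rmult_le_compat_l; nra). lra.
    - apply Rmult_le_compat_l; [left; apply Rdiv_lt_0_compat; auto|].
      pose proof (RInt_comp_lin (V := R_CompleteNormedModule) (fun s => N2 (f s)) d t 0 1) as EQ.
      replace (d * 0 + t) with t in EQ by ring. replace (d * 1 + t) with (t + d) in EQ by ring.
      apply Rle_trans with (RInt (fun s => N2 (f s)) t (t + d)).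
      + rewrite <- EQ by (apply ex_RI; auto). right. apply RInt_extR. intros s.
        rewrite (Rplus_comm t). reflexivity.
      + unfold RI. rewrite <- (RInt_Chasles (fun s => N2 (f s)) 0 t (T + d)) by (apply ex_RI; auto).
        rewrite <- (RInt_Chasles (fun s => N2 (f s)) t (t + d) (T + d)) by (apply ex_RI; auto).
        match goal with |- ?v <= plus ?u (plus ?v ?w) => change (v <= u + (v + w)) end.
        assert (0 <= RInt (fun s => N2 (f s)) 0 t) by (apply RInt_ge_0; [lra|apply ex_RI; auto|intros; apply N2_ge0]).
        assert (0 <= RInt (fun s => N2 (f s)) (t + d) (T + d)) by (apply RInt_ge_0; [lra|apply ex_RI; auto|intros; apply N2_ge0]).
        lra. }
  set (J := RI f (T + d)) in *.
  (* The uniform bound is written as a multiple of the constant function 1, so that [RI_le2] can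
     integrate it. *)
  apply Rle_trans with (2 * RI f T + (2 * (E / d * J)) * RI (fun _ => RtoC 1) T).
  - apply RI_le2; auto; [apply cont_const|]. intros t Ht. rewrite Hgt.
    eapply Rle_trans; [apply N2_add|]. specialize (HI t Ht).
    replace (N2 (Copp (CI (h t)))) with (N2 (CI (h t))) by (unfold N2; cbn -[CI]; ring).
    unfold N2 at 4. cbn [RtoC Re Im]. lra.
  - assert (RI f T <= J) by (apply RI_incr; auto; lra).
    assert (E1 : RI (fun _ => RtoC 1) T = T).
    { unfold RI. transitivity (RInt (fun _ => 1) 0 T).
      - apply RInt_extR. intros; unfold N2; cbn; ring.
      - rewrite RInt_constR. ring. }
    rewrite E1. lra.
Qed.

(** * Products of filters *)

Fixpoint mult (ks : list (Cplx * R)) (k : Cplx) : Cplx :=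
  match ks with nil => RtoC 1 | (k0, d) :: ks' => Cmul (mult ks' k) (fmul d k0 k) end.

(** The length by which the composed filter shortens the time interval. *)
Fixpoint shift (ks : list (Cplx * R)) : R :=
  match ks with nil => 0 | (_, d) :: ks' => shift ks' + d end.

Lemma shift_ge0 ks : (forall kd, In kd ks -> 0 < snd kd) -> 0 <= shift ks.
Proof.
  induction ks as [|[k0 d] ks IH]; intros H; cbn [shift]; [lra|].
  assert (0 < d) by (apply (H (k0, d)); left; auto).
  assert (0 <= shift ks) by (apply IH; intros; apply H; right; auto). lra.
Qed.

Lemma filt_norm ks T : 0 <= T -> (forall kd, In kd ks -> 0 < snd kd) -> exists K, 0 < K /\
  forall f g, filt (mult ks) f g -> RI g T <= K * RI f (T + shift ks).
Proof.
  revert T; induction ks as [|[k0 d] ks IH]; intros T HT Hks.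
  - exists 1. split; [lra|]. intros f g (l & H1 & H2). cbn [shift]. rewrite Rplus_0_r, Rmult_1_l. right.
    apply RI_ext. intros t. rewrite H1, H2. clear.
    induction l as [|[p k] l IH]; [auto|]. rewrite emap_cons. cbn [esum]. rewrite IH. cbn [mult]. cring.
  - assert (Hd : 0 < d) by (apply (Hks (k0, d)); left; auto).
    destruct (filt_step k0 d T Hd HT) as (K1 & HK1 & h1).
    destruct (IH (T + d)) as (K2 & HK2 & h2); [lra|intros; apply Hks; right; auto|].
    exists (K1 * K2). split; [apply Rmult_lt_0_compat; auto|].
    intros f g (l & H1 & H2). set (h := esum (emap (mult ks) l)).
    cbn [shift]. replace (T + (shift ks + d)) with (T + d + shift ks) by ring.
    apply Rle_trans with (K1 * RI h (T + d)).
    + apply h1. exists (emap (mult ks) l). split; [reflexivity|]. intros t. rewrite H2. clear.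
      induction l as [|[p k] l IH]; [auto|]. rewrite !emap_cons. cbn [esum]. rewrite IH. cbn [mult]. cring.
    + rewrite Rmult_assoc. apply Rmult_le_compat_l; [lra|]. apply h2. exists l. split; auto.
Qed.

Lemma mult_app l l' k : mult (l ++ l') k = Cmul (mult l k) (mult l' k).
Proof. induction l as [|[k0 d] l IH]; cbn -[fmul]; [cring|]. rewrite IH. cring. Qed.

Lemma shift_app l l' : shift (l ++ l') = shift l + shift l'.
Proof. induction l as [|[k0 d] l IH]; cbn; [ring|]. rewrite IH. ring. Qed.

Definition pair_with (d : R) (l : list Cplx) : list (Cplx * R) := map (fun k => (k, d)) l.

Lemma shift_pair d l : shift (pair_with d l) = INR (length l) * d.
Proof.
  induction l as [|k l IH]; [cbn; ring|]. change (shift (pair_with d l) + d = INR (S (length l)) * d).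
  rewrite IH, S_INR. ring.
Qed.

Lemma mult_kill d l k : In k l -> mult (pair_with d l) k = C0.
Proof.
  induction l as [|k0 l IH]; intros H; [destruct H|]. cbn -[fmul].
  destruct H as [->|H].
  - unfold fmul. replace (Cmul (RtoC d) (Csub k k)) with C0 by cring. rewrite Phi_0. cring.
  - unfold pair_with in IH. rewrite IH by auto. cring.
Qed.

Lemma fmul_lower d k0 k : 0 < d -> d * Rabs (Re k - Re k0) <= 1/20 ->
  1/1000 * Rmin 1 (d ^ 2 * N2 (Csub k k0)) <= N2 (fmul d k0 k).
Proof.
  intros Hd H. unfold fmul.
  replace (d ^ 2 * N2 (Csub k k0)) with (N2 (Cmul (RtoC d) (Csub k k0))) by (rewrite N2_mul; unfold N2 at 1; cbn; ring).
  apply Phi_lower. cbn.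
  replace (d * (Re k + - Re k0) - 0 * (Im k + - Im k0)) with (d * (Re k - Re k0)) by ring.
  rewrite Rabs_mult, Rabs_pos_eq by lra. auto.
Qed.

Lemma fmul_upper d k0 k : 0 < d -> d * Rabs (Re k - Re k0) <= 1 -> N2 (fmul d k0 k) <= 2 + 2 * exp 2.
Proof.
  intros Hd H. unfold fmul. eapply Rle_trans; [apply N2_add|].
  set (z := Cmul (RtoC d) (Csub k k0)).
  replace (N2 (Copp (Phi z))) with (N2 (Phi z)) by (unfold N2; cbn -[Phi]; ring).
  assert (N2 (Phi z) <= exp 2).
  { eapply Rle_trans; [apply N2_Phi|]. apply exp_mono. unfold z; cbn.
    replace (d * (Re k + - Re k0) - 0 * (Im k + - Im k0)) with (d * (Re k - Re k0)) by ring.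
    rewrite Rabs_mult, (Rabs_pos_eq d) by lra. lra. }
  unfold N2 at 1; cbn -[N2 Phi exp]. lra.
Qed.

Lemma mult_upper d l k : 0 < d -> (forall k0, In k0 l -> d * Rabs (Re k - Re k0) <= 1) ->
  N2 (mult (pair_with d l) k) <= (2 + 2 * exp 2) ^ length l.
Proof.
  intros Hd. induction l as [|k0 l IH]; intros H.
  - unfold N2; cbn; lra.
  - change (N2 (Cmul (mult (pair_with d l) k) (fmul d k0 k)) <= (2 + 2 * exp 2) * (2 + 2 * exp 2) ^ length l).
    rewrite N2_mul, Rmult_comm. apply Rmult_le_compat; try apply N2_ge0.
    + apply fmul_upper; auto. apply H; left; auto.
    + apply IH. intros; apply H; right; auto.
Qed.

Lemma mult_lower d l k c : 0 < d -> 0 < c -> (forall k0, In k0 l -> d * Rabs (Re k - Re k0) <= 1/20) ->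
  (forall k0, In k0 l -> c <= N2 (Csub k k0)) ->
  (1/1000 * Rmin 1 (d ^ 2 * c)) ^ length l <= N2 (mult (pair_with d l) k).
Proof.
  intros Hd Hc. assert (Hc' : 0 <= 1/1000 * Rmin 1 (d ^ 2 * c)).
  { apply Rmult_le_pos; [lra|]. apply Rmin_glb; [lra|]. nra. }
  induction l as [|k0 l IH]; intros H H'.
  - unfold N2; cbn; lra.
  - change ((1/1000 * Rmin 1 (d ^ 2 * c)) * (1/1000 * Rmin 1 (d ^ 2 * c)) ^ length l <= N2 (Cmul (mult (pair_with d l) k) (fmul d k0 k))).
    rewrite N2_mul, (Rmult_comm (N2 _)). apply Rmult_le_compat; auto.
    + apply pow_le; auto.
    + eapply Rle_trans; [|apply fmul_lower; auto; apply H; left; auto].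
      apply Rmult_le_compat_l; [lra|]. apply Rle_min_compat_l. apply Rmult_le_compat_l; [nra|]. apply H'; left; auto.
    + apply IH; intros; [apply H|apply H']; right; auto.
Qed.


(** * Filters with quantitative bounds *)

(** A common width [d] is taken so small that the total shift is at most [tau] and that [d (k - k0)]
    lies in the strip of [Phi_lower]. Since only real parts are restricted, both bounds are uniform
    over unbounded frequencies. *)
Lemma kill_filter (l : list Cplx) (S : Cplx -> Prop) (tau rho c0 : R) :
  0 < tau -> 0 < rho -> 0 < c0 ->
  (forall k, In k l -> Rabs (Re k) <= rho) ->
  (forall k, S k -> Rabs (Re k) <= rho) ->
  (forall k k0, S k -> In k0 l -> c0 <= N2 (Csub k k0)) ->
  exists d c, 0 < d /\ 0 < c /\ INR (length l) * d <= tau /\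
   (forall k, S k -> c <= N2 (mult (pair_with d l) k)) /\
   (forall k, Rabs (Re k) <= rho -> N2 (mult (pair_with d l) k) <= (2 + 2 * exp 2) ^ length l).
Proof.
  intros Ht Hr Hc Hl HS Hsep.
  set (d := Rmin (tau / (INR (length l) + 1)) (/ (40 * rho))).
  pose proof (pos_INR (length l)) as Hn.
  assert (Hd : 0 < d). { apply Rmin_glb_lt; [apply Rdiv_lt_0_compat; lra|apply Rinv_0_lt_compat; lra]. }
  assert (Hd2 : d * (2 * rho) <= 1/20).
  { apply Rle_trans with (/ (40 * rho) * (2 * rho)); [|right; field; lra].
    apply Rmult_le_compat_r; [lra|apply Rmin_r]. }
  assert (Hd3 : forall k k0, Rabs (Re k) <= rho -> Rabs (Re k0) <= rho -> d * Rabs (Re k - Re k0) <= 1/20).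
  { intros k k0 h1 h2. eapply Rle_trans; [|exact Hd2]. apply Rmult_le_compat_l; [lra|].
    unfold Rminus. eapply Rle_trans; [apply Rabs_triang|]. rewrite Rabs_Ropp. lra. }
  exists d, ((1/1000 * Rmin 1 (d ^ 2 * c0)) ^ length l). split; [auto|]. split.
  { apply pow_lt. apply Rmult_lt_0_compat; [lra|]. apply Rmin_glb_lt; [lra|]. apply Rmult_lt_0_compat; auto. apply pow_lt; auto. }
  split.
  { apply Rle_trans with (INR (length l) * (tau / (INR (length l) + 1))).
    - apply Rmult_le_compat_l; [auto|apply Rmin_l].
    - apply Rmult_le_reg_r with (INR (length l) + 1); [lra|].
      replace (INR (length l) * (tau / (INR (length l) + 1)) * (INR (length l) + 1)) with (INR (length l) * tau) by (field; lra). nra. }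
  split.
  - intros k Hk. apply mult_lower; auto.
  - intros k Hk. apply mult_upper; auto. intros k0 Hk0. pose proof (Hd3 k k0 Hk (Hl k0 Hk0)). lra.
Qed.

Lemma N2_mult_repeat d k0 p k : N2 (mult (pair_with d (repeat k0 p)) k) = N2 (fmul d k0 k) ^ p.
Proof.
  induction p; [unfold N2; cbn; ring|].
  change (N2 (Cmul (mult (pair_with d (repeat k0 p)) k) (fmul d k0 k)) = N2 (fmul d k0 k) * N2 (fmul d k0 k) ^ p).
  rewrite N2_mul, IHp. ring.
Qed.

(* A high power of the filter killing [e^{chi t}] makes the multiplier at the
   exponents close to [chi] negligible against the multiplier on [S]; its order is
   chosen after all the constants attached to the list [l]. *)
Lemma separating_filter (l : list Cplx) (S : Cplx -> Prop) (P : R -> Prop) (chi tau rho c0 eps : R) :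
  0 < tau -> 0 < rho -> 0 < c0 -> 0 < eps ->
  (forall k, In k l -> Rabs (Re k) <= rho) ->
  (forall k, S k -> Rabs (Re k) <= rho) ->
  (forall k k0, S k -> In k0 l -> c0 <= N2 (Csub k k0)) ->
  Rabs chi <= rho -> (forall k, S k -> 1 <= N2 (Csub k (RtoC chi))) ->
  (forall x, P x -> Rabs x <= rho /\ Rabs (x - chi) <= 1/100) ->
  exists ks c, 0 < c /\ (forall kd, In kd ks -> 0 < snd kd) /\ shift ks <= tau /\
   (forall k, In k l -> mult ks k = C0) /\
   (forall k, S k -> c <= N2 (mult ks k)) /\
   (forall k x, S k -> P x -> N2 (mult ks (RtoC x)) <= eps * N2 (mult ks k)).
Proof.
  intros Ht Hr Hc He Hl HS Hsep Hchi Hchi1 HP.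
  destruct (kill_filter l S (tau / 2) rho c0) as (d & c & Hd & Hcc & Hlen & Hlow & Hup); auto; [lra|].
  set (K := (2 + 2 * exp 2) ^ length l) in *.
  assert (HK : 0 < K). { apply pow_lt. pose proof (exp_pos 2). lra. }
  (* [K] bounds the multiplier of [l] from above at the exponents in [P], and [c] bounds it from
     below on [S]; [p] factors 4/5 outweigh their ratio. *)
  assert (Hp : exists p, (4/5) ^ p * K <= eps * c).
  { destruct (pow_lt_1_zero (4/5)) with (y := eps * c / K) as [N HN].
    - rewrite Rabs_pos_eq; lra.
    - apply Rdiv_lt_0_compat; auto. nra.
    - exists N. specialize (HN N (le_n _)). rewrite Rabs_pos_eq in HN by (apply pow_le; lra).
      apply Rmult_lt_compat_r with (r := K) in HN; auto. replace (eps * c / K * K) with (eps * c) in HN by (field; lra). lra. }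
  destruct Hp as [p Hp]. pose proof (pos_INR p) as Hp0.
  (* Besides keeping the shift and the strip, [d2 <= 1] makes [d2^2] at most 1, so that the minimum
     in [fmul_lower] is at least [d2^2] on [S]. *)
  set (d2 := Rmin 1 (Rmin (tau / 2 / (INR p + 1)) (/ (40 * rho)))).
  assert (Hd2 : 0 < d2).
  { apply Rmin_glb_lt; [lra|]. apply Rmin_glb_lt; [apply Rdiv_lt_0_compat; lra|apply Rinv_0_lt_compat; lra]. }
  assert (Hd2a : d2 <= 1) by apply Rmin_l.
  assert (Hd2b : d2 <= tau / 2 / (INR p + 1)) by (eapply Rle_trans; [apply Rmin_r|apply Rmin_l]).
  assert (Hd2c : d2 <= / (40 * rho)) by (eapply Rle_trans; [apply Rmin_r|apply Rmin_r]).
  assert (Hd2d : d2 * (2 * rho) <= 1/20).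
  { apply Rle_trans with (/ (40 * rho) * (2 * rho)); [|right; field; lra]. apply Rmult_le_compat_r; lra. }
  assert (Hf1 : forall k, S k -> 1/1000 * d2 ^ 2 <= N2 (fmul d2 (RtoC chi) k)).
  { intros k Hk. eapply Rle_trans; [|apply fmul_lower; auto].
    - apply Rmult_le_compat_l; [lra|]. apply Rmin_glb; [nra|]. specialize (Hchi1 k Hk). nra.
    - eapply Rle_trans; [|exact Hd2d]. apply Rmult_le_compat_l; [lra|].
      unfold Rminus. eapply Rle_trans; [apply Rabs_triang|]. rewrite Rabs_Ropp. cbn. specialize (HS k Hk). lra. }
  assert (Hf2 : forall x, P x -> N2 (fmul d2 (RtoC chi) (RtoC x)) <= 2 * (d2 ^ 2 * (x - chi) ^ 2)).
  { intros x Hx. destruct (HP x Hx) as [_ h]. unfold fmul.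
    replace (Cmul (RtoC d2) (Csub (RtoC x) (RtoC chi))) with (RtoC (d2 * (x - chi))) by cring.
    rewrite <- Rpow_mult_distr. apply Phi_real_small.
    rewrite Rabs_mult, (Rabs_pos_eq d2) by lra. pose proof (Rabs_pos (x - chi)). nra. }
  (* Within 1/100 of [chi] the squared factor is at most [d2^2 / 5000], while on [S] it is at least
     [d2^2 / 1000]; the ratio is well below 4/5. *)
  assert (Hf3 : forall k x, S k -> P x -> N2 (fmul d2 (RtoC chi) (RtoC x)) <= 4/5 * N2 (fmul d2 (RtoC chi) k)).
  { intros k x Hk Hx. specialize (Hf1 k Hk). specialize (Hf2 x Hx). destruct (HP x Hx) as [_ h].
    assert ((x - chi) ^ 2 <= 1/10000).
    { rewrite <- pow2_abs. replace (1/10000) with ((1/100) ^ 2) by field. apply pow_incr. split; auto. apply Rabs_pos. }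
    assert (0 < d2 ^ 2) by nra. nra. }
  exists (pair_with d l ++ pair_with d2 (repeat (RtoC chi) p)), (c * (1/1000 * d2 ^ 2) ^ p).
  split. { apply Rmult_lt_0_compat; auto. apply pow_lt. nra. }
  split. { intros kd H. apply in_app_iff in H. destruct H as [H|H]; apply in_map_iff in H; destruct H as (k & <- & _); auto. }
  split. { rewrite shift_app, !shift_pair, repeat_length.
    assert (INR p * d2 <= tau / 2); [|lra].
    apply Rle_trans with (INR p * (tau / 2 / (INR p + 1))); [apply Rmult_le_compat_l; auto|].
    apply Rmult_le_reg_r with (INR p + 1); [lra|].
    replace (INR p * (tau / 2 / (INR p + 1)) * (INR p + 1)) with (INR p * (tau / 2)) by (field; lra). nra. }
  split. { intros k Hk. rewrite mult_app, mult_kill by auto. cring. }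
  split.
  - intros k Hk. rewrite mult_app, N2_mul, N2_mult_repeat. apply Rmult_le_compat; [lra| |auto|].
    + apply pow_le. nra.
    + apply pow_incr. split; [nra|auto].
  - intros k x Hk Hx. rewrite !mult_app, !N2_mul, !N2_mult_repeat.
    set (a := N2 (fmul d2 (RtoC chi) k)). assert (Ha : 0 <= a) by apply N2_ge0.
    assert (h1 : N2 (fmul d2 (RtoC chi) (RtoC x)) ^ p <= (4/5) ^ p * a ^ p).
    { rewrite <- Rpow_mult_distr. apply pow_incr. split; [apply N2_ge0|apply Hf3; auto]. }
    assert (h2 : N2 (mult (pair_with d l) (RtoC x)) <= K) by (apply Hup; apply HP; auto).
    specialize (Hlow k Hk). assert (0 <= a ^ p) by (apply pow_le; auto).
    apply Rle_trans with (K * ((4/5) ^ p * a ^ p)).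
    + apply Rmult_le_compat; auto; [apply N2_ge0|apply pow_le, N2_ge0].
    + replace (K * ((4/5) ^ p * a ^ p)) with ((4/5) ^ p * K * a ^ p) by ring.
      rewrite <- Rmult_assoc. apply Rmult_le_compat_r; auto. nra.
Qed.

(** * Uniform separation and weighted Cauchy-Schwarz inequalities *)

Lemma inf_pos (x : nat -> R) : (forall n, 0 < x n) -> (exists n1, forall n, (n >= n1)%nat -> 1 <= x n) ->
  exists c, 0 < c /\ forall n, c <= x n.
Proof.
  intros Hx [n1 H].
  assert (h : forall m, exists c, 0 < c /\ c <= 1 /\ forall n, (n < m)%nat -> c <= x n).
  { induction m as [|m (c & h1 & h2 & h3)]; [exists 1; split; [lra|]; split; [lra|intros; lia]|].
    exists (Rmin c (x m)). split; [apply Rmin_glb_lt; auto|]. split; [eapply Rle_trans; [apply Rmin_l|auto]|].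
    intros n Hn. destruct (Nat.eq_dec n m) as [->|h]; [apply Rmin_r|].
    eapply Rle_trans; [apply Rmin_l|apply h3; lia]. }
  destruct (h n1) as (c & h1 & h2 & h3). exists c. split; auto. intros n.
  destruct (Nat.lt_ge_cases n n1); [auto|]. specialize (H n H0). lra.
Qed.

Lemma Un_cv_bounded (x : nat -> R) (l : R) : Un_cv x l -> exists B, 0 < B /\ forall n, Rabs (x n) <= B.
Proof.
  intros H. destruct (H 1) as [N HN]; [lra|].
  assert (h : forall m, exists B, 0 < B /\ forall n, (n < m)%nat -> Rabs (x n) <= B).
  { induction m as [|m (B & h1 & h2)]; [exists 1; split; [lra|intros; lia]|].
    exists (B + Rabs (x m)). pose proof (Rabs_pos (x m)). split; [lra|].
    intros n Hn. destruct (Nat.eq_dec n m) as [->|h]; [lra|]. specialize (h2 n). 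
    assert (Rabs (x n) <= B) by (apply h2; lia). lra. }
  destruct (h N) as (B & h1 & h2). exists (B + Rabs l + 1). pose proof (Rabs_pos l). split; [lra|].
  intros n. destruct (Nat.lt_ge_cases n N) as [hn|hn].
  - specialize (h2 n hn). lra.
  - specialize (HN n hn). unfold R_dist in HN. replace (x n) with ((x n - l) + l) by ring.
    eapply Rle_trans; [apply Rabs_triang|]. lra.
Qed.

(** As the frequencies tend to infinity, all but finitely many distances exceed 1; distinctness
    makes the others positive. *)
Lemma separation (lam : nat -> Cplx) (l : list Cplx) (n0 : nat) :
  (forall K, exists n1, forall n, (n >= n1)%nat -> K <= Im (lam n)) ->
  (forall n k0, (n >= n0)%nat -> In k0 l -> lam n <> k0) ->
  exists c, 0 < c /\ forall n k0, (n >= n0)%nat -> In k0 l -> c <= N2 (Csub (lam n) k0).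
Proof.
  intros Hinf. induction l as [|k1 l IH]; intros Hne.
  - exists 1. split; [lra|]. intros n k0 _ [].
  - destruct IH as (c & Hc & H). { intros n k0 Hn Hk. apply Hne; auto. right; auto. }
    destruct (inf_pos (fun n => N2 (Csub (lam (n0 + n)%nat) k1))) as (c' & Hc' & H').
    + intros n. apply N2_pos. intros E. apply (Hne (n0 + n)%nat k1); [lia|left; auto|].
      replace (lam (n0 + n)%nat) with (Cadd (Csub (lam (n0 + n)%nat) k1) k1) by cring. rewrite E. cring.
    + destruct (Hinf (1 + Rabs (Im k1))) as [n1 Hn1]. exists n1. intros n Hn.
      specialize (Hn1 (n0 + n)%nat ltac:(lia)). unfold N2; cbn -[pow].
      pose proof (Rle_abs (Im k1)). pose proof (pow2_ge_0 (Re (lam (n0 + n)%nat) + - Re k1)). nra.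
    + exists (Rmin c c'). split; [apply Rmin_glb_lt; auto|]. intros n k0 Hn [<-|Hk].
      * eapply Rle_trans; [apply Rmin_r|]. specialize (H' (n - n0)%nat). replace (n0 + (n - n0))%nat with n in H' by lia. auto.
      * eapply Rle_trans; [apply Rmin_l|]. auto.
Qed.

Lemma rsum_weighted_CS (x v y : nat -> R) n : (forall i, (i < n)%nat -> 0 <= v i) -> (forall i, (i < n)%nat -> 0 <= y i) ->
  (forall i, (i < n)%nat -> x i ^ 2 <= v i * y i) -> rsum x n ^ 2 <= rsum v n * rsum y n.
Proof.
  intros Hv Hy H.
  assert (h : Rabs (rsum x n) <= rsum (fun i => sqrt (v i) * sqrt (y i)) n).
  { clear - H Hv Hy. induction n; cbn; [rewrite Rabs_R0; lra|].
    eapply Rle_trans; [apply Rabs_triang|]. apply Rplus_le_compat.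
    - apply IHn; intros; auto.
    - apply Rabs_le_of_sq; [apply Rmult_le_pos; apply sqrt_pos|].
      rewrite Rpow_mult_distr, !pow2_sqrt; auto. }
  rewrite <- pow2_abs.
  apply Rle_trans with (rsum (fun i => sqrt (v i) * sqrt (y i)) n ^ 2).
  - apply pow_incr. split; auto. apply Rabs_pos.
  - eapply Rle_trans; [apply rsum_CS|]. right. f_equal; apply rsum_ext; intros i Hi; apply pow2_sqrt; auto.
Qed.

(** For the terms [R_n e^{r_n t}], [v] will be the summable weights and [y] essentially the
    energies. The factor 2 comes from treating real and imaginary parts separately. *)
Lemma csum_weighted_CS (f : nat -> Cplx) (v y : nat -> R) n : (forall i, (i < n)%nat -> 0 <= v i) -> (forall i, (i < n)%nat -> 0 <= y i) ->
  (forall i, (i < n)%nat -> N2 (f i) <= v i * y i) -> N2 (csum f n) <= 2 * (rsum v n * rsum y n).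
Proof.
  intros Hv Hy H.
  assert (E : Im (csum f n) = rsum (fun i => Im (f i)) n) by (clear; induction n; cbn; [easy|rewrite IHn; easy]).
  unfold N2. rewrite Re_csum, E.
  assert (rsum (fun i => Re (f i)) n ^ 2 <= rsum v n * rsum y n).
  { apply rsum_weighted_CS; auto. intros i Hi. eapply Rle_trans; [|apply H; auto]. apply Re_sq_le_N2. }
  assert (rsum (fun i => Im (f i)) n ^ 2 <= rsum v n * rsum y n).
  { apply rsum_weighted_CS; auto. intros i Hi. eapply Rle_trans; [|apply H; auto]. unfold N2. pose proof (pow2_ge_0 (Re (f i))). lra. }
  lra.
Qed.


(** * Direct inequality *)

(** The coefficients of conjugate exponents are independent, because a filter multiplies them by its
    values at [k] and at the conjugate of [k]. *)
Definition pairsum (lam p q : nat -> Cplx) (n : nat) (t : R) : Cplx :=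
  csum (fun i => Cadd (Cmul (p i) (cexp (lam i) t)) (Cmul (q i) (cexp (Cconj (lam i)) t))) n.

Definition realsum (r : nat -> R) (z : nat -> Cplx) (n : nat) (t : R) : Cplx :=
  csum (fun i => Cmul (z i) (cexp (RtoC (r i)) t)) n.

(** The partial sums of [u_1], indexed from 0, with [lam] and [zet] standing for [i omega] and
    [i zeta]. In its companion [U2] the term [E e^{-eta t}] is left out, so that differences and
    tails have the same form. *)
Definition U1 (lam zet : nat -> Cplx) (r : nat -> R) (C D : nat -> Cplx) (Rr : nat -> R) (n : nat) (t : R) : Cplx :=
  Cadd (pairsum lam C (fun i => Cconj (C i)) n t)
   (Cadd (pairsum zet D (fun i => Cconj (D i)) n t) (realsum r (fun i => RtoC (Rr i)) n t)).

Definition U2 (lam zet c d : nat -> Cplx) (C D : nat -> Cplx) (n : nat) (t : R) : Cplx :=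
  Cadd (pairsum zet (fun i => Cmul (d i) (D i)) (fun i => Cconj (Cmul (d i) (D i))) n t)
    (pairsum lam (fun i => Cmul (c i) (C i)) (fun i => Cconj (Cmul (c i) (C i))) n t).

Definition energy (d C D : nat -> Cplx) (i : nat) : R := N2 (C i) + N2 (Cmul (d i) (D i)).

(** A liminf of gaps equal to [gamma] is used through any [g < gamma], which is eventually a true
    gap. *)
Definition gapped (lam : nat -> Cplx) (y g : R) : Prop :=
  Un_cv (fun n => Re (lam n)) y /\ exists N, forall n, (n >= N)%nat -> g <= Im (lam (S n)) - Im (lam n).

Lemma energy_ge0 d C D i : 0 <= energy d C D i.
Proof. pose proof (N2_ge0 (C i)). pose proof (N2_ge0 (Cmul (d i) (D i))). unfold energy. lra. Qed.

Lemma cont_pairsum lam p q n : cont (pairsum lam p q n).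
Proof.
  apply (cont_csum (fun i t => Cadd (Cmul (p i) (cexp (lam i) t)) (Cmul (q i) (cexp (Cconj (lam i)) t)))).
  intros i. apply cont_add; apply cont_term.
Qed.

Lemma cont_realsum r z n : cont (realsum r z n).
Proof. apply (cont_csum (fun i t => Cmul (z i) (cexp (RtoC (r i)) t))). intros i. apply cont_term. Qed.

Lemma cont_U1 lam zet r C D Rr n : cont (U1 lam zet r C D Rr n).
Proof. apply cont_add; [apply cont_pairsum|]. apply cont_add; [apply cont_pairsum|apply cont_realsum]. Qed.

Lemma cont_U2 lam zet c d C D n : cont (U2 lam zet c d C D n).
Proof. apply cont_add; apply cont_pairsum. Qed.

Lemma N2_term_bound (p k : Cplx) (rho T t : R) : Rabs (Re k) <= rho -> 0 < t < T ->
  N2 (Cmul p (cexp k t)) <= exp (2 * rho * T) * N2 p.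
Proof.
  intros Hk Ht. rewrite N2_mul, N2_ex, Rmult_comm. apply Rmult_le_compat_r; [apply N2_ge0|].
  apply exp_mono. apply Rabs_le_between in Hk. nra.
Qed.

(** Ingham's inequality bounds the terms beyond [n1]; the at most [n1] earlier ones are bounded
    pointwise, with a constant depending on [n1]. *)
Lemma family_upper (lam : nat -> Cplx) (y g T : R) : 0 < T -> 0 < g -> 2 * PI < g * T -> gapped lam y g ->
  exists B, 0 < B /\ forall p q n, RI (pairsum lam p q n) T <= B * rsum (fun i => N2 (p i) + N2 (q i)) n.
Proof.
  intros HT Hg HgT [Hy [N HN]].
  destruct (ingham_two_sided lam y g T N HT Hg HgT Hy HN) as (n1 & A & B & HA & HB & H).
  specialize (H n1 (le_n _)).
  destruct (Un_cv_bounded _ _ Hy) as (rho & Hrho & Hb).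
  set (E := exp (2 * rho * T)). assert (HE : 0 < E) by apply exp_pos.
  assert (Hhead : forall p q n, (n <= n1)%nat -> RI (pairsum lam p q n) T <= (T * (INR n1 * (2 * E))) * rsum (fun i => N2 (p i) + N2 (q i)) n).
  { intros p q n Hn. rewrite Rmult_assoc. apply RI_const_bound; [lra|apply cont_pairsum|].
    intros t Ht. unfold pairsum. eapply Rle_trans; [apply N2_csum_le|]. rewrite !Rmult_assoc.
    apply Rmult_le_compat; [apply pos_INR|apply rsum_ge0; intros; apply N2_ge0|apply le_INR; auto|].
    rewrite <- Rmult_assoc, <- rsum_scal. apply rsum_le; intros i Hi.
    eapply Rle_trans; [apply N2_add|].
    pose proof (N2_term_bound (p i) (lam i) rho T t (Hb i) Ht) as h1.
    pose proof (N2_term_bound (q i) (Cconj (lam i)) rho T t (Hb i) Ht) as h2. fold E in h1, h2. lra. }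
  set (K := T * (INR n1 * (2 * E))) in *.
  assert (HK : 0 <= K). { apply Rmult_le_pos; [lra|]. apply Rmult_le_pos; [apply pos_INR|lra]. }
  exists (2 * K + 2 * B). split; [lra|]. intros p q n.
  assert (Hpos : forall i, 0 <= N2 (p i) + N2 (q i)) by (intros i; pose proof (N2_ge0 (p i)); pose proof (N2_ge0 (q i)); lra).
  destruct (Nat.le_ge_cases n n1) as [h|h].
  - eapply Rle_trans; [apply Hhead; auto|]. apply Rmult_le_compat_r; [|lra]. apply rsum_ge0; auto.
  - replace n with (n1 + (n - n1))%nat by lia. set (m := (n - n1)%nat).
    destruct (H (fun i => p (n1 + i)%nat) (fun i => q (n1 + i)%nat) m) as [_ H2].
    specialize (Hhead p q n1 (le_n _)). rewrite rsum_split.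
    assert (0 <= rsum (fun i => N2 (p i) + N2 (q i)) n1) by (apply rsum_ge0; auto).
    assert (0 <= rsum (fun i => N2 (p (n1 + i)%nat) + N2 (q (n1 + i)%nat)) m) by (apply rsum_ge0; auto).
    set (f := fun t => csum (fun i => Cadd (Cmul (p (n1 + i)%nat) (cexp (lam (n1 + i)%nat) t)) (Cmul (q (n1 + i)%nat) (cexp (Cconj (lam (n1 + i)%nat)) t))) m) in *.
    apply Rle_trans with (2 * RI (pairsum lam p q n1) T + 2 * RI f T).
    + rewrite (RI_ext _ (fun t => Cadd (pairsum lam p q n1 t) (f t))).
      * apply RI_add; [lra|apply cont_pairsum|].
        apply (cont_pairsum (fun i => lam (n1 + i)%nat) (fun i => p (n1 + i)%nat) (fun i => q (n1 + i)%nat)).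
      * intros t. unfold pairsum. rewrite csum_split. reflexivity.
    + nra.
Qed.

(** The exponents [r_n] converge and have no gap; summability of the weights replaces it and gives a
    pointwise bound. *)
Lemma realsum_upper (r : nat -> R) (rho T V : R) : 0 < T -> (forall i, Rabs (r i) <= rho) ->
  forall (z : nat -> Cplx) (v y : nat -> R) n, (forall i, 0 <= v i) -> (forall i, 0 <= y i) -> rsum v n <= V ->
  (forall i, (i < n)%nat -> N2 (z i) <= v i * y i) ->
  RI (realsum r z n) T <= T * (2 * V * exp (2 * rho * T)) * rsum y n.
Proof.
  intros HT Hr z v y n Hv Hy HV H. rewrite Rmult_assoc. apply RI_const_bound; [lra|apply cont_realsum|].
  intros t Ht. unfold realsum.
  eapply Rle_trans; [apply (csum_weighted_CS _ v (fun i => exp (2 * rho * T) * y i))|].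
  - auto.
  - intros i _. apply Rmult_le_pos; [left; apply exp_pos|auto].
  - intros i Hi. eapply Rle_trans; [apply (N2_term_bound (z i) (RtoC (r i)) rho T t); auto; apply Hr|].
    specialize (H i Hi). pose proof (exp_pos (2 * rho * T)). nra.
  - rewrite rsum_scal. assert (0 <= rsum y n) by (apply rsum_ge0; auto).
    pose proof (exp_pos (2 * rho * T)). 
    replace (2 * V * exp (2 * rho * T) * rsum y n) with (2 * (V * (exp (2 * rho * T) * rsum y n))) by ring.
    apply Rmult_le_compat_l; [lra|]. apply Rmult_le_compat_r; auto. apply Rmult_le_pos; lra.
Qed.

Lemma U_upper (lam zet c d : nat -> Cplx) (r v : nat -> R) (yl yz g T rho V kc kd : R) :
  0 < T -> 0 < g -> 2 * PI < g * T -> gapped lam yl g -> gapped zet yz g ->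
  (forall i, Rabs (r i) <= rho) -> (forall i, 0 <= v i) -> (forall n, rsum v n <= V) ->
  0 <= kc -> 0 <= kd ->
  (forall i, N2 (c i) <= kc) -> (forall i, 1 <= kd * N2 (d i)) ->
  exists B, 0 < B /\ forall C D Rr n, (forall i, (i < n)%nat -> Rr i ^ 2 <= v i * energy d C D i) ->
  RI (U1 lam zet r C D Rr n) T + RI (U2 lam zet c d C D n) T <= B * rsum (energy d C D) n.
Proof.
  intros HT Hg HgT Hl Hz Hr Hv HV Hkc Hkd Hc Hd.
  destruct (family_upper lam yl g T HT Hg HgT Hl) as (Bl & HBl & HL).
  destruct (family_upper zet yz g T HT Hg HgT Hz) as (Bz & HBz & HZ).
  set (G := T * (2 * V * exp (2 * rho * T))).
  assert (HV0 : 0 <= V) by (exact (HV O)).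
  assert (HG : 0 <= G). { apply Rmult_le_pos; [lra|]. apply Rmult_le_pos; [lra|left; apply exp_pos]. }
  (* A conjugate pair counts each coefficient twice, and each splitting of a sum costs a further
     factor 2. *)
  exists (4 * Bl + 8 * Bz * kd + 4 * G + 4 * Bz + 4 * Bl * kc + 1). split.
  { assert (0 <= Bz * kd) by nra. assert (0 <= Bl * kc) by nra. lra. }
  intros C D Rr n HR. set (S := rsum (energy d C D) n).
  assert (HS : 0 <= S) by (apply rsum_ge0; intros; apply energy_ge0).
  assert (H0 : RI (pairsum lam C (fun i => Cconj (C i)) n) T <= Bl * (2 * S)).
  { eapply Rle_trans; [apply HL|]. apply Rmult_le_compat_l; [lra|]. unfold S. rewrite <- rsum_scal.
    apply rsum_le; intros i _. rewrite N2_conj. unfold energy. pose proof (N2_ge0 (Cmul (d i) (D i))). lra. }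
  assert (H1 : RI (pairsum zet D (fun i => Cconj (D i)) n) T <= Bz * (2 * kd * S)).
  { eapply Rle_trans; [apply HZ|]. apply Rmult_le_compat_l; [lra|]. unfold S. rewrite <- rsum_scal.
    apply rsum_le; intros i _. rewrite N2_conj. unfold energy. rewrite N2_mul.
    specialize (Hd i). pose proof (N2_ge0 (D i)). pose proof (N2_ge0 (C i)). assert (0 <= kd * N2 (C i)) by nra.
    assert (N2 (D i) <= kd * (N2 (d i) * N2 (D i))) by nra. lra. }
  assert (H2 : RI (realsum r (fun i => RtoC (Rr i)) n) T <= G * S).
  { apply (realsum_upper r rho T V HT Hr _ v); auto; [intros; apply energy_ge0|].
    intros i Hi. unfold N2; cbn [Re Im RtoC]. specialize (HR i Hi). lra. }
  assert (H3 : RI (pairsum zet (fun i => Cmul (d i) (D i)) (fun i => Cconj (Cmul (d i) (D i))) n) T <= Bz * (2 * S)).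
  { eapply Rle_trans; [apply HZ|]. apply Rmult_le_compat_l; [lra|]. unfold S. rewrite <- rsum_scal.
    apply rsum_le; intros i _. rewrite N2_conj. unfold energy. pose proof (N2_ge0 (C i)). lra. }
  assert (H4 : RI (pairsum lam (fun i => Cmul (c i) (C i)) (fun i => Cconj (Cmul (c i) (C i))) n) T <= Bl * (2 * kc * S)).
  { eapply Rle_trans; [apply HL|]. apply Rmult_le_compat_l; [lra|]. unfold S. rewrite <- rsum_scal.
    apply rsum_le; intros i _. rewrite N2_conj, N2_mul. unfold energy. pose proof (N2_ge0 (C i)). pose proof (N2_ge0 (Cmul (d i) (D i))).
    specialize (Hc i). assert (0 <= kc * N2 (Cmul (d i) (D i))) by nra. assert (N2 (c i) * N2 (C i) <= kc * N2 (C i)) by nra. lra. }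
  assert (H5 : RI (U1 lam zet r C D Rr n) T <= 2 * RI (pairsum lam C (fun i => Cconj (C i)) n) T +
     2 * RI (fun t => Cadd (pairsum zet D (fun i => Cconj (D i)) n t) (realsum r (fun i => RtoC (Rr i)) n t)) T).
  { apply RI_add; [lra|apply cont_pairsum|]. apply cont_add; [apply cont_pairsum|apply cont_realsum]. }
  assert (H6 := RI_add (pairsum zet D (fun i => Cconj (D i)) n) (realsum r (fun i => RtoC (Rr i)) n) T
    (Rlt_le _ _ HT) (cont_pairsum _ _ _ _) (cont_realsum _ _ _)).
  assert (H7 : RI (U2 lam zet c d C D n) T <= 2 * RI (pairsum zet (fun i => Cmul (d i) (D i)) (fun i => Cconj (Cmul (d i) (D i))) n) T
     + 2 * RI (pairsum lam (fun i => Cmul (c i) (C i)) (fun i => Cconj (Cmul (c i) (C i))) n) T).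
  { apply RI_add; [lra| |]; apply cont_pairsum. }
  assert (0 <= Bl * S) by nra. assert (0 <= Bz * S) by nra.
  lra.
Qed.

Lemma filt_csum_tail m (f h : nat -> R -> Cplx) n0 n :
  (forall i, (i < n0)%nat -> filt m (f i) (fun _ => C0)) ->
  (forall i, filt m (f (n0 + i)%nat) (h i)) ->
  filt m (fun t => csum (fun i => f i t) (n0 + n)) (fun t => csum (fun i => h i t) n).
Proof.
  intros H1 H2.
  apply filt_ext with (fun t => Cadd (csum (fun i => f i t) n0) (csum (fun i => f (n0 + i)%nat t) n))
    (fun t => Cadd (csum (fun i => C0) n0) (csum (fun i => h i t) n)).
  - intros t. rewrite csum_split. reflexivity.
  - intros t. rewrite csum_zero; auto. cring.
  - apply filt_add.
    + apply (filt_csum m f (fun _ _ => C0)). auto.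
    + apply (filt_csum m (fun i => f (n0 + i)%nat) h). auto.
Qed.

Lemma filt_pairsum m lam p q n0 n :
  (forall i, (i < n0)%nat -> (p i = C0 \/ m (lam i) = C0) /\ (q i = C0 \/ m (Cconj (lam i)) = C0)) ->
  filt m (pairsum lam p q (n0 + n))
   (pairsum (fun i => lam (n0 + i)%nat) (fun i => Cmul (m (lam (n0 + i)%nat)) (p (n0 + i)%nat))
      (fun i => Cmul (m (Cconj (lam (n0 + i)%nat))) (q (n0 + i)%nat)) n).
Proof.
  intros H. unfold pairsum.
  apply (filt_csum_tail m (fun i t => Cadd (Cmul (p i) (cexp (lam i) t)) (Cmul (q i) (cexp (Cconj (lam i)) t)))
    (fun i t => Cadd (Cmul (Cmul (m (lam (n0 + i)%nat)) (p (n0 + i)%nat)) (cexp (lam (n0 + i)%nat) t)) (Cmul (Cmul (m (Cconj (lam (n0 + i)%nat))) (q (n0 + i)%nat)) (cexp (Cconj (lam (n0 + i)%nat)) t)))).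
  - intros i Hi. destruct (H i Hi). apply filt_ext with (fun t => Cadd (Cmul (p i) (cexp (lam i) t)) (Cmul (q i) (cexp (Cconj (lam i)) t))) (fun _ => Cadd C0 C0).
    + auto.
    + intros; cring.
    + apply filt_add; apply filt_kill; auto.
  - intros i. apply filt_add; apply filt_term.
Qed.

Lemma filt_realsum m r z n0 n : (forall i, (i < n0)%nat -> m (RtoC (r i)) = C0) ->
  filt m (realsum r z (n0 + n)) (realsum (fun i => r (n0 + i)%nat) (fun i => Cmul (m (RtoC (r (n0 + i)%nat))) (z (n0 + i)%nat)) n).
Proof.
  intros H. unfold realsum.
  apply (filt_csum_tail m (fun i t => Cmul (z i) (cexp (RtoC (r i)) t))
    (fun i t => Cmul (Cmul (m (RtoC (r (n0 + i)%nat))) (z (n0 + i)%nat)) (cexp (RtoC (r (n0 + i)%nat)) t))).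
  - intros i Hi. apply filt_kill; auto.
  - intros i. apply filt_term.
Qed.


(** * Inverse inequality *)

(** Positive imaginary parts keep these exponents apart from all conjugates and from the real
    exponents; the last three clauses exclude the other coincidences. *)
Definition distinct_spectra (lam zet : nat -> Cplx) : Prop :=
  (forall n, 0 < Im (lam n)) /\ (forall n, 0 < Im (zet n)) /\
  (forall n m, n <> m -> lam n <> lam m) /\ (forall n m, n <> m -> zet n <> zet m) /\
  (forall n m, lam n <> zet m).

(** [- eta] is listed too, so that the same filter removes [E e^{-eta t}]. *)
Definition head_spectrum (lam zet : nat -> Cplx) (r : nat -> R) (eta : R) (n0 : nat) : list Cplx :=
  RtoC (- eta) :: flat_map (fun i => [lam i; Cconj (lam i); zet i; Cconj (zet i); RtoC (r i)]) (seq 0 n0).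

Lemma in_head lam zet r eta n0 k : In k (head_spectrum lam zet r eta n0) ->
  k = RtoC (- eta) \/ exists i, (i < n0)%nat /\
   (k = lam i \/ k = Cconj (lam i) \/ k = zet i \/ k = Cconj (zet i) \/ k = RtoC (r i)).
Proof.
  intros [H|H]; [left; auto|]. right. apply in_flat_map in H. destruct H as (i & Hi & H).
  apply in_seq in Hi. exists i. split; [lia|]. cbn in H. intuition.
Qed.

Lemma head_in lam zet r eta n0 i k : (i < n0)%nat ->
  In k [lam i; Cconj (lam i); zet i; Cconj (zet i); RtoC (r i)] -> In k (head_spectrum lam zet r eta n0).
Proof. intros Hi H. right. apply in_flat_map. exists i. split; auto. apply in_seq. lia. Qed.

Lemma Im_neq (z w : Cplx) : Im z <> Im w -> z <> w.
Proof. intros H E. apply H. rewrite E. reflexivity. Qed.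

(** The claims about [Cconj k] serve the conjugate tail exponents, whose distance to [k] is that of
    the exponent to [Cconj k]. *)
Lemma tail_not_in_head lam zet r eta n0 n k : distinct_spectra lam zet -> (n >= n0)%nat ->
  In k (head_spectrum lam zet r eta n0) ->
  lam n <> k /\ lam n <> Cconj k /\ zet n <> k /\ zet n <> Cconj k.
Proof.
  intros (H1 & H2 & H3 & H4 & H5) Hn Hk. apply in_head in Hk.
  pose proof (H1 n) as hl. pose proof (H2 n) as hz.
  destruct Hk as [->|(i & Hi & Hk)].
  - repeat split; apply Im_neq; cbn; lra.
  - pose proof (H1 i). pose proof (H2 i). assert (hni : n <> i) by lia.
    assert (ec : forall z, Cconj (Cconj z) = z) by (intros; cring).
    destruct Hk as [->|[->|[->|[->| ->]]]]; rewrite ?ec; repeat split; auto; try (apply Im_neq; cbn; lra);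
     intros E; symmetry in E; revert E; apply H5.
Qed.

Lemma gapped_unbounded lam y g : 0 < g -> gapped lam y g ->
  forall K, exists n1, forall n, (n >= n1)%nat -> K <= Im (lam n).
Proof. intros Hg [_ [N HN]]. exact (gap_unbounded _ g N Hg HN). Qed.

Lemma N2_sub_conj z w : N2 (Csub (Cconj z) w) = N2 (Csub z (Cconj w)).
Proof. unfold N2; cbn; ring. Qed.

(** Ingham's inequality acts on [T1], and [T - T1] is the room for the filter. The cross terms can
    be made small by [n0] before the filter is built, because each comparison is between
    coefficients carrying the same multiplier. *)
Lemma tail_lower (lam zet c d : nat -> Cplx) (r v : nat -> R) (yl yz g T1 T rho V chi eta : R) :
  0 < T1 -> T1 < T -> 0 < g -> 2 * PI < g * T1 -> gapped lam yl g -> gapped zet yz g ->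
  0 < rho -> (forall i, Rabs (Re (lam i)) <= rho) -> (forall i, Rabs (Re (zet i)) <= rho) ->
  (forall i, Rabs (r i) <= rho) -> Rabs chi <= rho -> Rabs eta <= rho ->
  (forall i, 0 <= v i) -> (forall n, rsum v n <= V) ->
  (forall e, 0 < e -> exists N, forall n, (n >= N)%nat -> N2 (c n) <= e) ->
  (forall e, 0 < e -> exists N, forall n, (n >= N)%nat -> 1 <= e * N2 (d n)) ->
  Un_cv r chi -> distinct_spectra lam zet ->
  exists n0 K, 0 < K /\ forall C D Rr E n, (forall i, (i < n0 + n)%nat -> Rr i ^ 2 <= v i * energy d C D i) ->
  rsum (fun i => energy d C D (n0 + i)%nat) n <=
   K * (RI (U1 lam zet r C D Rr (n0 + n)) T +
        RI (fun t => Cadd (U2 lam zet c d C D (n0 + n) t) (Cmul (RtoC E) (cexp (RtoC (- eta)) t))) T).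
Proof.
  intros HT1 HT Hg HgT Hl Hz Hrho Hbl Hbz Hbr Hbchi Hbeta Hv HV Hc Hd Hr Hdist.
  pose proof Hl as [Hyl [Nl HNl]]. pose proof Hz as [Hyz [Nz HNz]].
  destruct (ingham_two_sided lam yl g T1 Nl HT1 Hg HgT Hyl HNl) as (nl & Al & Bl & HAl & HBl & HIl).
  destruct (ingham_two_sided zet yz g T1 Nz HT1 Hg HgT Hyz HNz) as (nz & Az & Bz & HAz & HBz & HIz).
  set (A := Rmin Al Az). assert (HA : 0 < A) by (apply Rmin_glb_lt; auto).
  assert (HAAl : A <= Al) by apply Rmin_l. assert (HAAz : A <= Az) by apply Rmin_r.
  (* These thresholds make the cross terms at most [A/8 X] in [u2] and [A/16 Y] in [u1], for the
     filtered energies [X] and [Y] below. *)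
  set (e1 := A / (8 * Bl)). set (e2 := A / (16 * Bz)).
  assert (He1 : 0 < e1) by (apply Rdiv_lt_0_compat; lra).
  assert (He2 : 0 < e2) by (apply Rdiv_lt_0_compat; lra).
  destruct (Hc e1 He1) as [nc Hnc]. destruct (Hd e2 He2) as [nd Hnd].
  destruct (Hr (1/100)) as [nr Hnr]; [lra|].
  destruct (gapped_unbounded lam yl g Hg Hl 1) as [il Hil].
  destruct (gapped_unbounded zet yz g Hg Hz 1) as [iz Hiz].
  set (n0 := (nl + nz + nc + nd + nr + il + iz)%nat).
  set (hd := head_spectrum lam zet r eta n0).
  set (S := fun k => exists n, (n >= n0)%nat /\ (k = lam n \/ k = Cconj (lam n) \/ k = zet n \/ k = Cconj (zet n))).
  set (P := fun x => exists n, (n >= n0)%nat /\ x = r n).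
  assert (Hsep : exists c0, 0 < c0 /\ forall k k0, S k -> In k0 hd -> c0 <= N2 (Csub k k0)).
  { destruct (separation lam (hd ++ map Cconj hd) n0) as (ca & Hca & ha).
    - apply (gapped_unbounded lam yl g Hg Hl).
    - intros n k Hn Hk. apply in_app_iff in Hk. destruct Hk as [Hk|Hk]; [|apply in_map_iff in Hk; destruct Hk as (k' & <- & Hk)];
       apply (tail_not_in_head lam zet r eta n0 n _ Hdist Hn Hk).
    - destruct (separation zet (hd ++ map Cconj hd) n0) as (cb & Hcb & hb).
      + apply (gapped_unbounded zet yz g Hg Hz).
      + intros n k Hn Hk. apply in_app_iff in Hk. destruct Hk as [Hk|Hk]; [|apply in_map_iff in Hk; destruct Hk as (k' & <- & Hk)];
         apply (tail_not_in_head lam zet r eta n0 n _ Hdist Hn Hk).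
      + exists (Rmin ca cb). split; [apply Rmin_glb_lt; auto|].
        intros k k0 (n & Hn & Hk) Hk0.
        assert (i1 : In k0 (hd ++ map Cconj hd)) by (apply in_app_iff; auto).
        assert (i2 : In (Cconj k0) (hd ++ map Cconj hd)) by (apply in_app_iff; right; apply in_map; auto).
        destruct Hk as [->|[->|[->| ->]]]; rewrite ?N2_sub_conj.
        * eapply Rle_trans; [apply Rmin_l|]; auto.
        * eapply Rle_trans; [apply Rmin_l|]; auto.
        * eapply Rle_trans; [apply Rmin_r|]; auto.
        * eapply Rle_trans; [apply Rmin_r|]; auto. }
  destruct Hsep as (c0 & Hc0 & Hsep).
  assert (HV0 : 0 <= V) by (exact (HV O)).
  set (G := T1 * (2 * V * exp (2 * rho * T1))).
  assert (HG : 0 <= G). { apply Rmult_le_pos; [lra|]. apply Rmult_le_pos; [lra|left; apply exp_pos]. }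
  (* Chosen so that [G e3 <= A/16]; the 1 admits [G = 0]. *)
  set (e3 := A / (16 * (G + 1))). assert (He3 : 0 < e3) by (apply Rdiv_lt_0_compat; lra).
  destruct (separating_filter hd S P chi (T - T1) rho c0 e3) as (ks & cm & Hcm & Hks & Hshift & Hkill & Hlow & Hrat); auto; try lra.
  { intros k Hk. apply in_head in Hk. destruct Hk as [->|(i & _ & [->|[->|[->|[->| ->]]]])]; cbn; auto.
    rewrite Rabs_Ropp; auto. }
  { intros k (n & _ & [->|[->|[->| ->]]]); cbn; auto. }
  (* Tail frequencies have modulus at least 1, whereas [chi] is real. *)
  { intros k (n & Hn & Hk). assert (1 <= Im k ^ 2).
    { specialize (Hil n ltac:(unfold n0 in Hn; lia)). specialize (Hiz n ltac:(unfold n0 in Hn; lia)).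
      destruct Hk as [->|[->|[->| ->]]]; cbn -[pow]; nra. }
    unfold N2; cbn -[pow]. pose proof (pow2_ge_0 (Re k + - chi)). nra. }
  { intros x (n & Hn & ->). split; auto. left. apply Hnr. unfold n0 in Hn; lia. }
  set (m := mult ks) in *.
  destruct (filt_norm ks T1) as (KF & HKF & Hfilt); auto; [lra|].
  exists n0, (4 / A / cm * KF). split.
  { apply Rmult_lt_0_compat; auto. apply Rdiv_lt_0_compat; auto. apply Rdiv_lt_0_compat; lra. }
  intros C D Rr E n HR.
  set (pl := fun i => Cmul (m (lam (n0 + i)%nat)) (C (n0 + i)%nat)).
  set (ql := fun i => Cmul (m (Cconj (lam (n0 + i)%nat))) (Cconj (C (n0 + i)%nat))).
  set (pz := fun i => Cmul (m (zet (n0 + i)%nat)) (D (n0 + i)%nat)).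
  set (qz := fun i => Cmul (m (Cconj (zet (n0 + i)%nat))) (Cconj (D (n0 + i)%nat))).
  set (lam' := fun i => lam (n0 + i)%nat). set (zet' := fun i => zet (n0 + i)%nat).
  set (c' := fun i => c (n0 + i)%nat). set (d' := fun i => d (n0 + i)%nat).
  set (r' := fun i => r (n0 + i)%nat).
  set (zr := fun i => Cmul (m (RtoC (r (n0 + i)%nat))) (RtoC (Rr (n0 + i)%nat))).
  set (gl := pairsum lam' pl ql n). set (gz := pairsum zet' pz qz n). set (gr := realsum r' zr n).
  set (hz := pairsum zet' (fun i => Cmul (d' i) (pz i)) (fun i => Cmul (Cconj (d' i)) (qz i)) n).
  set (hl := pairsum lam' (fun i => Cmul (c' i) (pl i)) (fun i => Cmul (Cconj (c' i)) (ql i)) n).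
  set (u1 := U1 lam zet r C D Rr (n0 + n)).
  set (u2 := fun t => Cadd (U2 lam zet c d C D (n0 + n) t) (Cmul (RtoC E) (cexp (RtoC (- eta)) t))).
  assert (Hk4 : forall i, (i < n0)%nat -> m (lam i) = C0 /\ m (Cconj (lam i)) = C0 /\ m (zet i) = C0 /\ m (Cconj (zet i)) = C0 /\ m (RtoC (r i)) = C0).
  { intros i Hi. repeat split; apply Hkill, (head_in lam zet r eta n0 i); auto; cbn; auto 10. }
  set (g1 := fun t => Cadd (gl t) (Cadd (gz t) (gr t))).
  set (g2 := fun t => Cadd (hz t) (hl t)).
  assert (F1 : filt m u1 g1).
  { apply filt_add; [|apply filt_add].
    - apply filt_pairsum. intros i Hi. destruct (Hk4 i Hi) as (-> & -> & _). auto.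
    - apply filt_pairsum. intros i Hi. destruct (Hk4 i Hi) as (_ & _ & -> & -> & _). auto.
    - apply filt_realsum. intros i Hi. apply (Hk4 i Hi). }
  assert (F2 : filt m u2 g2).
  { apply filt_ext with u2 (fun t => Cadd (g2 t) C0); [auto|intros; cring|].
    apply filt_add; [|apply filt_kill; right; apply Hkill; left; auto].
    apply filt_add; eapply filt_ext; [reflexivity| |apply filt_pairsum|reflexivity| |apply filt_pairsum].
    - intros t. unfold hz, pairsum. apply csum_ext; intros i _. unfold d', pz, qz, zet'. cring.
    - intros i Hi. destruct (Hk4 i Hi) as (_ & _ & -> & -> & _). auto.
    - intros t. unfold hl, pairsum. apply csum_ext; intros i _. unfold c', pl, ql, lam'. cring.
    - intros i Hi. destruct (Hk4 i Hi) as (-> & -> & _). auto. }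
  assert (Cl : cont gl) by apply cont_pairsum. assert (Cz : cont gz) by apply cont_pairsum.
  assert (Cr : cont gr) by apply cont_realsum. assert (Chz : cont hz) by apply cont_pairsum.
  assert (Chl : cont hl) by apply cont_pairsum.
  assert (Cg1 : cont g1) by (apply cont_add; [auto|apply cont_add; auto]).
  assert (Cg2 : cont g2) by (apply cont_add; auto).
  assert (Cu1 : cont u1) by (apply cont_U1).
  assert (Cu2 : cont u2) by (apply cont_add; [apply cont_U2|apply cont_term]).
  set (X := rsum (fun i => N2 (pl i) + N2 (ql i)) n).
  set (Y := rsum (fun i => N2 (Cmul (d' i) (pz i)) + N2 (Cmul (Cconj (d' i)) (qz i))) n).
  assert (HX : 0 <= X). { apply rsum_ge0; intros i _. pose proof (N2_ge0 (pl i)). pose proof (N2_ge0 (ql i)). lra. }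
  assert (HY : 0 <= Y). { apply rsum_ge0; intros i _. pose proof (N2_ge0 (Cmul (d' i) (pz i))). pose proof (N2_ge0 (Cmul (Cconj (d' i)) (qz i))). lra. }
  assert (I1 : A * X <= RI gl T1).
  { eapply Rle_trans; [apply Rmult_le_compat_r; [auto|exact HAAl]|]. apply (HIl n0); unfold n0; lia. }
  assert (I2 : A * Y <= RI hz T1).
  { eapply Rle_trans; [apply Rmult_le_compat_r; [auto|exact HAAz]|]. apply (HIz n0); unfold n0; lia. }
  assert (I3 : RI gz T1 <= A / 16 * Y).
  { eapply Rle_trans; [apply (HIz n0); unfold n0; lia|].
    replace (A / 16 * Y) with (Bz * (e2 * Y)) by (unfold e2; field; lra). apply Rmult_le_compat_l; [lra|].
    unfold Y. rewrite <- rsum_scal. apply rsum_le; intros i _. rewrite !N2_mul, N2_conj.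
    assert (h : 1 <= e2 * N2 (d' i)) by (apply Hnd; unfold n0; lia).
    pose proof (N2_ge0 (pz i)). pose proof (N2_ge0 (qz i)). rewrite Rmult_plus_distr_l, <- !Rmult_assoc. nra. }
  assert (I4 : RI hl T1 <= A / 8 * X).
  { eapply Rle_trans; [apply (HIl n0); unfold n0; lia|].
    replace (A / 8 * X) with (Bl * (e1 * X)) by (unfold e1; field; lra). apply Rmult_le_compat_l; [lra|].
    unfold X. rewrite <- rsum_scal. apply rsum_le; intros i _. rewrite !N2_mul, N2_conj.
    assert (h : N2 (c' i) <= e1) by (apply Hnc; unfold n0; lia).
    pose proof (N2_ge0 (pl i)). pose proof (N2_ge0 (ql i)). nra. }
  assert (St : forall i, S (lam' i) /\ S (Cconj (lam' i)) /\ S (zet' i) /\ S (Cconj (zet' i))).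
  { intros i. repeat split; exists (n0 + i)%nat; (split; [lia|auto]). }
  (* The multiplier at [r_n] is compared with that at [lam n] for the part [C_n] of the energy and
     with that at [zet n] for the part [d_n D_n]. *)
  assert (I5 : RI gr T1 <= A / 16 * (X + Y)).
  { apply Rle_trans with (G * (e3 * (X + Y))).
    - unfold X, Y. rewrite <- rsum_plus, <- rsum_scal.
      apply (realsum_upper r' rho T1 V) with (v := fun i => v (n0 + i)%nat); auto; [intros; apply Hbr| | |].
      + intros i. apply Rmult_le_pos; [lra|].
        pose proof (N2_ge0 (pl i)). pose proof (N2_ge0 (ql i)).
        pose proof (N2_ge0 (Cmul (d' i) (pz i))). pose proof (N2_ge0 (Cmul (Cconj (d' i)) (qz i))). lra.
      + pose proof (HV (n0 + n)%nat) as h. rewrite rsum_split in h.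
        assert (0 <= rsum v n0) by (apply rsum_ge0; auto). lra.
      + intros i Hi. unfold zr. rewrite N2_mul. specialize (HR (n0 + i)%nat ltac:(lia)).
        replace (N2 (RtoC (Rr (n0 + i)%nat))) with (Rr (n0 + i)%nat ^ 2) by (unfold N2; cbn; ring).
        assert (Pi : P (r (n0 + i)%nat)) by (exists (n0 + i)%nat; split; [lia|auto]).
        destruct (St i) as (s1 & _ & s3 & _).
        pose proof (Hrat _ _ s1 Pi) as h1. pose proof (Hrat _ _ s3 Pi) as h3.
        set (mr := N2 (m (RtoC (r (n0 + i)%nat)))) in *. assert (0 <= mr) by apply N2_ge0.
        apply Rle_trans with (mr * (v (n0 + i)%nat * energy d C D (n0 + i)%nat)); [apply Rmult_le_compat_l; auto|].
        replace (mr * (v (n0 + i)%nat * energy d C D (n0 + i)%nat)) with (v (n0 + i)%nat * (mr * energy d C D (n0 + i)%nat)) by ring.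
        apply Rmult_le_compat_l; auto.
        assert (h4 : mr * N2 (C (n0 + i)%nat) <= e3 * N2 (pl i)).
        { unfold pl. rewrite N2_mul, <- Rmult_assoc. apply Rmult_le_compat_r; [apply N2_ge0|exact h1]. }
        assert (h5 : mr * N2 (Cmul (d (n0 + i)%nat) (D (n0 + i)%nat)) <= e3 * N2 (Cmul (d' i) (pz i))).
        { unfold pz, d'. rewrite !N2_mul. pose proof (N2_ge0 (d (n0 + i)%nat)). pose proof (N2_ge0 (D (n0 + i)%nat)).
          fold (zet' i). set (a := N2 (d (n0 + i)%nat)) in *. set (b := N2 (D (n0 + i)%nat)) in *.
          replace (e3 * (a * (N2 (m (zet' i)) * b))) with (e3 * N2 (m (zet' i)) * (a * b)) by ring.
          apply Rmult_le_compat_r; [apply Rmult_le_pos; auto|exact h3]. }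
        unfold energy. pose proof (N2_ge0 (ql i)). pose proof (N2_ge0 (Cmul (Cconj (d' i)) (qz i))). nra.
    - unfold e3. replace (G * (A / (16 * (G + 1)) * (X + Y))) with (A / 16 * (X + Y) * (G / (G + 1))) by (field; lra).
      rewrite <- (Rmult_1_r (A / 16 * (X + Y))) at 2. apply Rmult_le_compat_l; [apply Rmult_le_pos; lra|].
      apply Rmult_le_reg_r with (G + 1); [lra|]. unfold Rdiv. rewrite Rmult_assoc, Rinv_l by lra. lra. }
  assert (J1 : RI gl T1 <= 2 * RI g1 T1 + 2 * RI (fun t => Cadd (gz t) (gr t)) T1).
  { apply RI_le2; auto; [lra|apply cont_add; auto|]. intros t _.
    replace (gl t) with (Cadd (g1 t) (Copp (Cadd (gz t) (gr t)))) by (unfold g1; cring).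
    eapply Rle_trans; [apply N2_add|]. replace (N2 (Copp (Cadd (gz t) (gr t)))) with (N2 (Cadd (gz t) (gr t))) by (unfold N2; cbn; ring). lra. }
  assert (J2 := RI_add gz gr T1 (Rlt_le _ _ HT1) Cz Cr).
  assert (J3 : RI hz T1 <= 2 * RI g2 T1 + 2 * RI hl T1).
  { apply RI_le2; auto; [lra|]. intros t _.
    replace (hz t) with (Cadd (g2 t) (Copp (hl t))) by (unfold g2; cring).
    eapply Rle_trans; [apply N2_add|]. replace (N2 (Copp (hl t))) with (N2 (hl t)) by (unfold N2; cbn; ring). lra. }
  (* The two estimates are [A X <= 2 RI g1 + A/4 X + A/2 Y] and [A Y <= 2 RI g2 + A/4 X]. In their
     sum the errors take at most half of [A (X + Y)]. *)
  assert (Hfin : A * (X + Y) <= 4 * (RI g1 T1 + RI g2 T1)) by nra.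
  assert (L1 : RI g1 T1 <= KF * RI u1 T).
  { eapply Rle_trans; [apply Hfilt, F1|]. apply Rmult_le_compat_l; [lra|]. apply RI_incr; auto.
    pose proof (shift_ge0 ks Hks). lra. }
  assert (L2 : RI g2 T1 <= KF * RI u2 T).
  { eapply Rle_trans; [apply Hfilt, F2|]. apply Rmult_le_compat_l; [lra|]. apply RI_incr; auto.
    pose proof (shift_ge0 ks Hks). lra. }
  assert (Hen : cm * rsum (fun i => energy d C D (n0 + i)%nat) n <= X + Y).
  { unfold X, Y. rewrite <- rsum_plus, <- rsum_scal. apply rsum_le; intros i _.
    destruct (St i) as (s1 & _ & s3 & _).
    pose proof (Hlow _ s1) as h1. pose proof (Hlow _ s3) as h3.
    pose proof (N2_ge0 (ql i)). pose proof (N2_ge0 (Cmul (Cconj (d' i)) (qz i))).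
    assert (h4 : cm * N2 (C (n0 + i)%nat) <= N2 (pl i)).
    { unfold pl. rewrite N2_mul. apply Rmult_le_compat_r; [apply N2_ge0|exact h1]. }
    assert (h5 : cm * N2 (Cmul (d (n0 + i)%nat) (D (n0 + i)%nat)) <= N2 (Cmul (d' i) (pz i))).
    { unfold pz, d'. rewrite !N2_mul. pose proof (N2_ge0 (d (n0 + i)%nat)). pose proof (N2_ge0 (D (n0 + i)%nat)).
      fold (zet' i). set (a := N2 (d (n0 + i)%nat)) in *. set (b := N2 (D (n0 + i)%nat)) in *.
      replace (a * (N2 (m (zet' i)) * b)) with (N2 (m (zet' i)) * (a * b)) by ring.
      apply Rmult_le_compat_r; [apply Rmult_le_pos; auto|exact h3]. }
    unfold energy. lra. }
  set (Z := rsum (fun i => energy d C D (n0 + i)%nat) n) in *.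
  assert (Hlast : A * (cm * Z) <= 4 * (KF * (RI u1 T + RI u2 T))).
  { apply Rle_trans with (A * (X + Y)); [apply Rmult_le_compat_l; lra|lra]. }
  apply Rmult_le_reg_l with (A * cm); [apply Rmult_lt_0_compat; auto|].
  replace (A * cm * (4 / A / cm * KF * (RI u1 T + RI u2 T))) with (4 * (KF * (RI u1 T + RI u2 T))) by (field; lra).
  lra.
Qed.


(** * The finitely many leading coefficients *)

Lemma list_separation (k : Cplx) (l : list Cplx) : ~ In k l ->
  exists c, 0 < c /\ forall k0, In k0 l -> c <= N2 (Csub k k0).
Proof.
  induction l as [|k1 l IH]; intros H.
  - exists 1. split; [lra|]. intros k0 [].
  - destruct IH as (c & Hc & h). { intros hk; apply H; right; auto. }
    assert (h1 : 0 < N2 (Csub k k1)).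
    { apply N2_pos. intros E. apply H. left. symmetry.
      replace k with (Cadd (Csub k k1) k1) by cring. rewrite E. cring. }
    exists (Rmin c (N2 (Csub k k1))). split; [apply Rmin_glb_lt; auto|].
    intros k0 [<-|Hk]; [apply Rmin_r|]. eapply Rle_trans; [apply Rmin_l|auto].
Qed.

Lemma pairsum_extract lam p q n j t : (j < n)%nat ->
  pairsum lam p q n t = Cadd (Cmul (p j) (cexp (lam j) t)) (pairsum lam (fun i => if Nat.eqb i j then C0 else p i) q n t).
Proof.
  unfold pairsum. induction n; intros Hj; [lia|]. cbn [csum].
  destruct (Nat.eqb_spec n j) as [->|h].
  - rewrite (csum_ext _ (fun i => Cadd (Cmul (if Nat.eqb i j then C0 else p i) (cexp (lam i) t)) (Cmul (q i) (cexp (Cconj (lam i)) t)))).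
    + cring.
    + intros i Hi. destruct (Nat.eqb_spec i j); [lia|auto].
  - rewrite IHn by lia. cring.
Qed.

Lemma filt_pairsum_zero m lam p q n :
  (forall i, (i < n)%nat -> (p i = C0 \/ m (lam i) = C0) /\ (q i = C0 \/ m (Cconj (lam i)) = C0)) ->
  filt m (pairsum lam p q n) (fun _ => C0).
Proof.
  intros H. pose proof (filt_pairsum m lam p q n 0 H) as F. rewrite Nat.add_0_r in F. exact F.
Qed.

(** With finitely many exponents no gap is involved and any [T > 0] will do: half of the interval
    pays for the filter, and on the other half the single exponential that survives is observed. *)
Lemma head_coefficient (lam zet : nat -> Cplx) (eta T rho : R) (n0 j : nat) :
  0 < T -> 0 < rho -> (forall i, Rabs (Re (lam i)) <= rho) -> (forall i, Rabs (Re (zet i)) <= rho) -> Rabs eta <= rho ->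
  distinct_spectra lam zet -> (j < n0)%nat ->
  exists K, 0 <= K /\ forall c d C D E, N2 (Cmul (d j) (D j)) <=
    K * RI (fun t => Cadd (U2 lam zet c d C D n0 t) (Cmul (RtoC E) (cexp (RtoC (- eta)) t))) T.
Proof.
  intros HT Hrho Hbl Hbz Hbe (H1 & H2 & H3 & H4 & H5) Hj.
  (* [u2] has no terms [R_n e^{r_n t}]; the slot of [r] in the list is filled with [- eta], which is
     to be killed anyway. *)
  set (full := head_spectrum lam zet (fun _ => - eta) eta n0).
  (* Equality of exponents is decided classically, in order to remove [zet j] from the list. *)
  set (l := filter (fun k => if excluded_middle_informative (k = zet j) then false else true) full).
  assert (Hin : forall k, In k full -> k <> zet j -> In k l).
  { intros k Hk h. apply filter_In. split; auto. destruct (excluded_middle_informative (k = zet j)); [contradiction|auto]. }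
  assert (Hnin : forall k, In k l -> In k full /\ k <> zet j).
  { intros k Hk. apply filter_In in Hk. destruct Hk as [h1 h2]. split; auto.
    destruct (excluded_middle_informative (k = zet j)); [discriminate|auto]. }
  destruct (list_separation (zet j) l) as (c0 & Hc0 & Hsep).
  { intros h. apply Hnin in h. destruct h as [_ h]. apply h; auto. }
  destruct (kill_filter l (fun k => k = zet j) (T / 2) rho c0) as (dd & cm & Hdd & Hcm & Hlen & Hlow & _); auto; try lra.
  { intros k Hk. apply Hnin in Hk. destruct Hk as [Hk _]. apply in_head in Hk.
    destruct Hk as [->|(i & _ & [->|[->|[->|[->| ->]]]])]; cbn; rewrite ?Rabs_Ropp; auto. }
  { intros k ->. auto. }
  { intros k k0 ->. auto. }
  set (m := mult (pair_with dd l)) in *.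
  destruct (filt_norm (pair_with dd l) (T / 2)) as (KF & HKF & Hfilt); [lra| |].
  { intros kd H. apply in_map_iff in H. destruct H as (k & <- & _). auto. }
  (* For [t < T / 2] one has [e^{2 Re (zet j) t} >= e^{- rho T}], so [W] undoes the possible decay
     of the observed exponential. *)
  set (W := exp (rho * T)). assert (HW : 0 < W) by apply exp_pos.
  exists (2 / T * (W / cm) * KF). split.
  { apply Rmult_le_pos; [|lra]. apply Rmult_le_pos; left; apply Rdiv_lt_0_compat; lra. }
  intros c d C D E. set (a := Cmul (d j) (D j)).
  set (u := fun t => Cadd (U2 lam zet c d C D n0 t) (Cmul (RtoC E) (cexp (RtoC (- eta)) t))).
  set (g := fun t => Cmul (Cmul (m (zet j)) a) (cexp (zet j) t)).
  assert (Hk : forall i, (i < n0)%nat -> m (lam i) = C0 /\ m (Cconj (lam i)) = C0 /\ m (Cconj (zet i)) = C0 /\ (i = j \/ m (zet i) = C0)).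
  { intros i Hi. pose proof (H1 i). pose proof (H2 i). pose proof (H2 j).
    repeat split.
    - apply mult_kill, Hin; auto. apply (head_in _ _ _ _ _ i); cbn; auto.
    - apply mult_kill, Hin; [apply (head_in _ _ _ _ _ i); cbn; auto|apply Im_neq; cbn; lra].
    - apply mult_kill, Hin; [apply (head_in _ _ _ _ _ i); cbn; auto 10|apply Im_neq; cbn; lra].
    - destruct (Nat.eq_dec i j); [auto|right]. apply mult_kill, Hin; auto. apply (head_in _ _ _ _ _ i); cbn; auto. }
  assert (F : filt m u g).
  { apply filt_ext with (fun t => Cadd (Cadd (Cadd (Cmul a (cexp (zet j) t))
        (pairsum zet (fun i => if Nat.eqb i j then C0 else Cmul (d i) (D i)) (fun i => Cconj (Cmul (d i) (D i))) n0 t))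
        (pairsum lam (fun i => Cmul (c i) (C i)) (fun i => Cconj (Cmul (c i) (C i))) n0 t))
        (Cmul (RtoC E) (cexp (RtoC (- eta)) t))) (fun t => Cadd (Cadd (Cadd (g t) C0) C0) C0).
    - intros t. unfold u, U2. rewrite (pairsum_extract zet (fun i => Cmul (d i) (D i)) _ n0 j) by auto. reflexivity.
    - intros t. cring.
    - apply filt_add; [apply filt_add; [apply filt_add|]|].
      + apply filt_term.
      + apply filt_pairsum_zero. intros i Hi. destruct (Hk i Hi) as (_ & _ & h & h'). split; [|auto].
        destruct (Nat.eqb_spec i j); [auto|]. destruct h'; [contradiction|auto].
      + apply filt_pairsum_zero. intros i Hi. destruct (Hk i Hi) as (h & h' & _). auto.
      + apply filt_kill. right. apply mult_kill, Hin; [left; auto|]. apply Im_neq. cbn. pose proof (H2 j). lra. }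
  assert (Cg : cont g) by apply cont_term.
  assert (Cu : cont u) by (apply (filt_cont _ _ _ F)).
  assert (L0 : 0 <= shift (pair_with dd l) <= T / 2).
  { rewrite shift_pair. split; [|auto]. apply Rmult_le_pos; [apply pos_INR|lra]. }
  assert (L1 : RI g (T / 2) <= KF * RI u T).
  { eapply Rle_trans; [apply Hfilt, F|]. apply Rmult_le_compat_l; [lra|]. apply RI_incr; auto. lra. }
  assert (L2 : RI (fun _ => a) (T / 2) <= W / cm * RI g (T / 2)).
  { apply RI_le; auto; [lra|apply cont_const|]. intros t Ht. unfold g. rewrite !N2_mul, N2_ex.
    pose proof (N2_ge0 a). specialize (Hlow (zet j) eq_refl).
    assert (h : 1 <= W * exp (2 * Re (zet j) * t)).
    { unfold W. rewrite <- exp_plus. apply exp_ge_1. specialize (Hbz j). apply Rabs_le_between in Hbz. nra. }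
    pose proof (exp_pos (2 * Re (zet j) * t)).
    set (e := exp (2 * Re (zet j) * t)) in *. set (mm := N2 (m (zet j))) in *.
    apply Rmult_le_reg_l with cm; auto.
    replace (cm * (W / cm * (mm * N2 a * e))) with (mm * (W * e) * N2 a) by (field; lra).
    apply Rmult_le_compat_r; auto. rewrite <- (Rmult_1_r cm). apply Rmult_le_compat; lra. }
  assert (L3 : RI (fun _ => a) (T / 2) = (T / 2 - 0) * N2 a) by (unfold RI; rewrite RInt_constR; auto).
  rewrite L3 in L2.
  apply Rmult_le_reg_l with (T / 2); [lra|].
  replace (T / 2 * (2 / T * (W / cm) * KF * RI u T)) with (W / cm * (KF * RI u T)) by (field; lra).
  assert (W / cm * RI g (T / 2) <= W / cm * (KF * RI u T)); [|lra].
  apply Rmult_le_compat_l; auto. left; apply Rdiv_lt_0_compat; auto.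
Qed.

Lemma head_lower (lam zet : nat -> Cplx) (eta T rho : R) (n0 : nat) :
  0 < T -> 0 < rho -> (forall i, Rabs (Re (lam i)) <= rho) -> (forall i, Rabs (Re (zet i)) <= rho) -> Rabs eta <= rho ->
  distinct_spectra lam zet ->
  exists K, 0 <= K /\ forall c d C D E, rsum (fun i => N2 (Cmul (d i) (D i))) n0 <=
    K * RI (fun t => Cadd (U2 lam zet c d C D n0 t) (Cmul (RtoC E) (cexp (RtoC (- eta)) t))) T.
Proof.
  intros HT Hrho Hbl Hbz Hbe Hd.
  assert (h : forall m, (m <= n0)%nat -> exists K, 0 <= K /\ forall c d C D E, rsum (fun i => N2 (Cmul (d i) (D i))) m <=
    K * RI (fun t => Cadd (U2 lam zet c d C D n0 t) (Cmul (RtoC E) (cexp (RtoC (- eta)) t))) T); [|apply h; auto].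
  induction m as [|m IH]; intros Hm.
  - exists 0. split; [lra|]. intros. cbn [rsum]. lra.
  - destruct IH as (K & HK & h); [lia|].
    destruct (head_coefficient lam zet eta T rho n0 m) as (K' & HK' & h'); auto.
    exists (K + K'). split; [lra|]. intros c d C D E. cbn [rsum]. rewrite Rmult_plus_distr_r.
    apply Rplus_le_compat; auto.
Qed.

(** Truncation from below turns a difference of partial sums into a sum of the same kind, to which
    the direct inequality applies. This serves both the removal of the tail and the Cauchy
    property. *)
Definition from (n0 : nat) (f : nat -> Cplx) (i : nat) : Cplx := if Nat.ltb i n0 then C0 else f i.

Lemma csum_from n0 n f g : (forall i, (i < n0)%nat -> g i = C0) -> (forall i, (n0 <= i)%nat -> g i = f i) ->
  csum g (n0 + n) = Csub (csum f (n0 + n)) (csum f n0).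
Proof.
  intros H1 H2. rewrite !csum_split, (csum_zero g) by auto.
  rewrite (csum_ext (fun i => g (n0 + i)%nat) (fun i => f (n0 + i)%nat)) by (intros; apply H2; lia). cring.
Qed.

Lemma pairsum_from lam p q p' q' n0 n t :
  (forall i, (i < n0)%nat -> p' i = C0 /\ q' i = C0) -> (forall i, (n0 <= i)%nat -> p' i = p i /\ q' i = q i) ->
  pairsum lam p' q' (n0 + n) t = Csub (pairsum lam p q (n0 + n) t) (pairsum lam p q n0 t).
Proof.
  intros H1 H2. apply csum_from.
  - intros i Hi. destruct (H1 i Hi) as [-> ->]. cring.
  - intros i Hi. destruct (H2 i Hi) as [-> ->]. auto.
Qed.

Lemma from_lt n0 f i : (i < n0)%nat -> from n0 f i = C0.
Proof. intros H. unfold from. destruct (Nat.ltb_spec i n0); [auto|lia]. Qed.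

Lemma from_ge n0 f i : (n0 <= i)%nat -> from n0 f i = f i.
Proof. intros H. unfold from. destruct (Nat.ltb_spec i n0); [lia|auto]. Qed.

Lemma U1_from lam zet r C D Rr n0 n t :
  U1 lam zet r (from n0 C) (from n0 D) (fun i => if Nat.ltb i n0 then 0 else Rr i) (n0 + n) t =
  Csub (U1 lam zet r C D Rr (n0 + n) t) (U1 lam zet r C D Rr n0 t).
Proof.
  unfold U1.
  rewrite (pairsum_from lam C (fun i => Cconj (C i))), (pairsum_from zet D (fun i => Cconj (D i))).
  - assert (E : realsum r (fun i => RtoC (if Nat.ltb i n0 then 0 else Rr i)) (n0 + n) t =
      Csub (realsum r (fun i => RtoC (Rr i)) (n0 + n) t) (realsum r (fun i => RtoC (Rr i)) n0 t)).
    { apply csum_from.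
      - intros i Hi. destruct (Nat.ltb_spec i n0); [cring|lia].
      - intros i Hi. destruct (Nat.ltb_spec i n0); [lia|auto]. }
    rewrite E. cring.
  - intros i Hi. rewrite from_lt by auto. split; [auto|cring].
  - intros i Hi. rewrite from_ge by auto. auto.
  - intros i Hi. rewrite from_lt by auto. split; [auto|cring].
  - intros i Hi. rewrite from_ge by auto. auto.
Qed.

Lemma U2_from lam zet c d C D n0 n t :
  U2 lam zet c d (from n0 C) (from n0 D) (n0 + n) t =
  Csub (U2 lam zet c d C D (n0 + n) t) (U2 lam zet c d C D n0 t).
Proof.
  unfold U2.
  rewrite (pairsum_from zet (fun i => Cmul (d i) (D i)) (fun i => Cconj (Cmul (d i) (D i)))),
    (pairsum_from lam (fun i => Cmul (c i) (C i)) (fun i => Cconj (Cmul (c i) (C i)))).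
  - cring.
  - intros i Hi. rewrite from_lt by auto. split; cring.
  - intros i Hi. rewrite from_ge by auto. auto.
  - intros i Hi. rewrite from_lt by auto. split; cring.
  - intros i Hi. rewrite from_ge by auto. auto.
Qed.

Lemma energy_from d C D n0 n :
  rsum (energy d (from n0 C) (from n0 D)) (n0 + n) = rsum (fun i => energy d C D (n0 + i)%nat) n.
Proof.
  rewrite rsum_split, rsum_zero.
  - rewrite Rplus_0_l. apply rsum_ext; intros i _. unfold energy. rewrite !from_ge by lia. auto.
  - intros i Hi. unfold energy. rewrite !from_lt by auto. rewrite N2_mul, N2_C0. ring.
Qed.

(* The tail of [u2] is controlled by the tail energy, so that the observation of
   the full sums gives an observation of the finitely many leading terms. *)
Lemma U_lower (lam zet c d : nat -> Cplx) (r v : nat -> R) (yl yz g T1 T rho V chi eta kc kd M : R) :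
  0 < T1 -> T1 < T -> 0 < g -> 2 * PI < g * T1 -> gapped lam yl g -> gapped zet yz g ->
  0 < rho -> (forall i, Rabs (Re (lam i)) <= rho) -> (forall i, Rabs (Re (zet i)) <= rho) ->
  (forall i, Rabs (r i) <= rho) -> Rabs chi <= rho -> Rabs eta <= rho ->
  (forall i, 0 <= v i) -> (forall n, rsum v n <= V) ->
  (forall e, 0 < e -> exists N, forall n, (n >= N)%nat -> N2 (c n) <= e) ->
  (forall e, 0 < e -> exists N, forall n, (n >= N)%nat -> 1 <= e * N2 (d n)) ->
  0 <= kc -> 0 <= kd -> (forall i, N2 (c i) <= kc) -> (forall i, 1 <= kd * N2 (d i)) ->
  Un_cv r chi -> distinct_spectra lam zet ->
  exists n0 K, 0 < K /\ forall C D Rr E n, (forall i, Rr i ^ 2 <= v i * energy d C D i) ->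
  (forall i, N2 (C i) <= M ^ 2 * N2 (Cmul (d i) (D i))) ->
  rsum (energy d C D) (n0 + n) <=
   K * (RI (U1 lam zet r C D Rr (n0 + n)) T +
        RI (fun t => Cadd (U2 lam zet c d C D (n0 + n) t) (Cmul (RtoC E) (cexp (RtoC (- eta)) t))) T).
Proof.
  intros HT1 HT Hg HgT Hl Hz Hrho Hbl Hbz Hbr Hbchi Hbeta Hv HV Hc Hd Hkc0 Hkd0 Hkc Hkd Hr Hdist.
  assert (HT0 : 0 < T) by lra.
  destruct (tail_lower lam zet c d r v yl yz g T1 T rho V chi eta) as (n0 & K & HK & Htail); auto.
  destruct (U_upper lam zet c d r v yl yz g T rho V kc kd) as (B & HB & Hup); auto; [nra|].
  destruct (head_lower lam zet eta T rho n0) as (K' & HK' & Hhead); auto.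
  (* [2 + 2 B K] bounds the leading part of [u2] left after subtracting the tail, [K'] recovers the
     [d_n D_n], the factor [1 + M^2] adds the [C_n], and the last [K] is for the tail energy. *)
  exists n0, ((1 + M ^ 2) * (K' * (2 + 2 * (B * K))) + K).
  assert (HM : 0 <= M ^ 2) by apply pow2_ge_0.
  split. { assert (0 <= (1 + M ^ 2) * (K' * (2 + 2 * (B * K)))); [|lra].
    apply Rmult_le_pos; [lra|]. apply Rmult_le_pos; auto. nra. }
  intros C D Rr E n HR HCD.
  set (u1 := U1 lam zet r C D Rr (n0 + n)).
  set (e := fun t => Cmul (RtoC E) (cexp (RtoC (- eta)) t)).
  set (u2 := fun t => Cadd (U2 lam zet c d C D (n0 + n) t) (e t)).
  set (h := fun t => Cadd (U2 lam zet c d C D n0 t) (e t)).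
  assert (Ce : cont e) by apply cont_term.
  assert (Cu2 : cont u2) by (apply cont_add; [apply cont_U2|auto]).
  assert (Ch : cont h) by (apply cont_add; [apply cont_U2|auto]).
  assert (Cu1 : cont u1) by (apply cont_U1).
  set (I := RI u1 T + RI u2 T). set (Z := rsum (fun i => energy d C D (n0 + i)%nat) n).
  assert (h1 : Z <= K * I) by (apply Htail; intros; apply HR).
  set (w := U2 lam zet c d (from n0 C) (from n0 D) (n0 + n)).
  assert (h2 : RI w T <= B * Z).
  { unfold Z. rewrite <- energy_from.
    (* [R_n] does not occur in [U2], so the direct inequality is used with all of them zero. *)
    eapply Rle_trans; [|apply (Hup (from n0 C) (from n0 D) (fun i => 0))].
    - assert (0 <= RI (U1 lam zet r (from n0 C) (from n0 D) (fun _ => 0) (n0 + n)) T) by (apply RI_ge0; [lra|apply cont_U1]).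
      unfold w. lra.
    - intros i _. rewrite pow_i by lia. apply Rmult_le_pos; [auto|apply energy_ge0]. }
  assert (h3 : RI h T <= 2 * RI u2 T + 2 * RI w T).
  { apply RI_le2; auto; [lra|apply cont_U2|]. intros t _.
    replace (h t) with (Cadd (u2 t) (Copp (w t))).
    - eapply Rle_trans; [apply N2_add|]. replace (N2 (Copp (w t))) with (N2 (w t)) by (unfold N2; cbn -[w]; ring). lra.
    - unfold w. rewrite U2_from. unfold u2, h. cring. }
  assert (h4 := Hhead c d C D E). fold e in h4. change (fun t => Cadd (U2 lam zet c d C D n0 t) (Cmul (RtoC E) (cexp (RtoC (- eta)) t))) with h in h4.
  assert (Hu1 : 0 <= RI u1 T) by (apply RI_ge0; auto; lra).
  assert (h5 : rsum (energy d C D) n0 <= (1 + M ^ 2) * rsum (fun i => N2 (Cmul (d i) (D i))) n0).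
  { rewrite <- rsum_scal. apply rsum_le; intros i _. unfold energy. specialize (HCD i). lra. }
  assert (h6 : RI h T <= (2 + 2 * (B * K)) * I).
  { assert (B * Z <= B * (K * I)) by (apply Rmult_le_compat_l; lra). unfold I in *. lra. }
  rewrite rsum_split. fold Z. rewrite (Rmult_plus_distr_r _ K). apply Rplus_le_compat; auto.
  eapply Rle_trans; [exact h5|]. rewrite !Rmult_assoc. apply Rmult_le_compat_l; [lra|].
  eapply Rle_trans; [exact h4|]. apply Rmult_le_compat_l; auto.
Qed.


(** * Passage to the limit *)

(** Comparison with the integral of [x^{-s}]: the induction carries the sharper bound
    [1 + (1 - n^{1-s}) / (s - 1)], and the mean value theorem for [x^{1-s}] gives the step. *)
Lemma p_series (s : R) : 1 < s -> forall n,
  rsum (fun i => Rpower (INR (S i)) (- s)) n <= 1 + / (s - 1).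
Proof.
  intros Hs.
  assert (Hinv : 0 < / (s - 1)) by (apply Rinv_0_lt_compat; lra).
  assert (H : forall n, rsum (fun i => Rpower (INR (S i)) (- s)) (S n) <=
     1 + / (s - 1) * (1 - Rpower (INR (S n)) (1 - s))).
  { induction n.
    - cbn. unfold Rpower. rewrite ln_1, !Rmult_0_r, exp_0. lra.
    - change (rsum (fun i => Rpower (INR (S i)) (- s)) (S n) + Rpower (INR (S (S n))) (- s) <=
        1 + / (s - 1) * (1 - Rpower (INR (S (S n))) (1 - s))).
      set (a := INR (S n)) in *. assert (Ha : 1 <= a) by (unfold a; apply (le_INR 1); lia).
      replace (INR (S (S n))) with (a + 1) by (unfold a; rewrite (S_INR (S n)); auto).
      destruct (MVT_cor2 (fun x => Rpower x (1 - s)) (fun x => (1 - s) * Rpower x (1 - s - 1)) a (a + 1)) as (x & Hx & Hx').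
      + lra.
      + intros x Hx. apply derivable_pt_lim_power. lra.
      + replace (1 - s - 1) with (- s) in Hx by ring.
        assert (h : Rpower (a + 1) (- s) <= Rpower x (- s)).
        { unfold Rpower. apply exp_mono. assert (ln x <= ln (a + 1)) by (left; apply ln_increasing; lra). nra. }
        assert (E : / (s - 1) * (Rpower a (1 - s) - Rpower (a + 1) (1 - s)) = Rpower x (- s)).
        { replace (Rpower a (1 - s) - Rpower (a + 1) (1 - s)) with ((s - 1) * Rpower x (- s)) by lra. field. lra. }
        lra. }
  intros [|n].
  - cbn. lra.
  - eapply Rle_trans; [apply H|]. assert (0 < Rpower (INR (S n)) (1 - s)) by apply exp_pos. nra.
Qed.

(** The square of the factor bounding [R_n] at [n = S i]. At [n = n'], where both bounds are
    available, the decaying one is taken. *)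
Definition weight (mu nu : R) (n' i : nat) : R :=
  mu ^ 2 * (if Nat.leb n' (S i) then Rpower (INR (S i)) (- (2 * nu)) else 1).

Lemma weight_ge0 mu nu n' i : 0 <= weight mu nu n' i.
Proof.
  apply Rmult_le_pos; [apply pow2_ge_0|]. destruct (Nat.leb n' (S i)); [left; apply exp_pos|lra].
Qed.

Lemma weight_sum mu nu n' : 1 < 2 * nu -> forall n,
  rsum (weight mu nu n') n <= mu ^ 2 * (1 + / (2 * nu - 1) + INR n').
Proof.
  intros Hnu n. unfold weight. rewrite rsum_scal. apply Rmult_le_compat_l; [apply pow2_ge_0|].
  apply Rle_trans with (rsum (fun i => Rpower (INR (S i)) (- (2 * nu)) + (if Nat.leb n' (S i) then 0 else 1)) n).
  - apply rsum_le; intros i _. assert (0 < Rpower (INR (S i)) (- (2 * nu))) by apply exp_pos.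
    destruct (Nat.leb n' (S i)); lra.
  - rewrite rsum_plus. apply Rplus_le_compat; [apply p_series; auto|].
    assert (h : forall n, rsum (fun i => if Nat.leb n' (S i) then 0 else 1) n <= INR (Nat.min n n')).
    { clear. induction n; [cbn; lra|]. cbn [rsum]. destruct (Nat.leb_spec n' (S n)).
      - assert (INR (Nat.min n n') <= INR (Nat.min (S n) n')) by (apply le_INR; lia). lra.
      - replace (Nat.min (S n) n') with (S n) by lia. rewrite Nat.min_l in IHn by lia. rewrite S_INR. lra. }
    eapply Rle_trans; [apply h|]. apply le_INR. lia.
Qed.

(** * From the partial sums of the statement to [U1] and [U2], and convergence of the integrals *)

Lemma csum1_csum (f : nat -> Cplx) n : csum1 f n = csum (fun i => f (S i)) n.
Proof. induction n; cbn; [auto|rewrite IHn; auto]. Qed.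

Lemma Cexp_ex (z : Cplx) (t : R) : Cexp (Cmul Ci (Cmul z (RtoC t))) = cexp (Cmul Ci z) t.
Proof. unfold Cexp, cexp; cbn -[exp cos sin]. f_equal; f_equal; f_equal; ring. Qed.

Lemma Cexp_ex_conj (z : Cplx) (t : R) : Cexp (Copp (Cmul Ci (Cmul (Cconj z) (RtoC t)))) = cexp (Cconj (Cmul Ci z)) t.
Proof. unfold Cexp, cexp; cbn -[exp cos sin]. f_equal; f_equal; f_equal; ring. Qed.

Lemma u1N_U1 om ze Cc Dd r Rr N t : u1N om ze Cc Dd r Rr N t =
  U1 (fun i => Cmul Ci (om (S i))) (fun i => Cmul Ci (ze (S i))) (fun i => r (S i))
     (fun i => Cc (S i)) (fun i => Dd (S i)) (fun i => Rr (S i)) N t.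
Proof.
  unfold u1N, U1, pairsum, realsum. rewrite csum1_csum, <- !csum_add. apply csum_ext; intros i _.
  unfold term1. rewrite !Cexp_ex, !Cexp_ex_conj, ex_real. cring.
Qed.

Lemma u2N_U2 om ze Cc Dd c d E eta N t : u2N om ze Cc Dd c d E eta N t =
  Cadd (U2 (fun i => Cmul Ci (om (S i))) (fun i => Cmul Ci (ze (S i))) (fun i => c (S i)) (fun i => d (S i))
     (fun i => Cc (S i)) (fun i => Dd (S i)) N t) (Cmul (RtoC E) (cexp (RtoC (- eta)) t)).
Proof.
  unfold u2N, U2, pairsum. rewrite csum1_csum, <- !csum_add, ex_real.
  replace (Cmul (RtoC E) (RtoC (exp (- eta * t)))) with (RtoC (E * exp (- eta * t))) by cring.
  f_equal. apply csum_ext; intros i _. unfold term2. rewrite !Cexp_ex, !Cexp_ex_conj. cring.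
Qed.

Lemma RInt_is_RI (f : R -> R) (g h : R -> Cplx) (T : R) : cont g -> cont h ->
  (forall t, f t = N2 (g t) + N2 (h t)) -> RInt_is f 0 T (RI g T + RI h T).
Proof.
  intros Hg Hh H.
  assert (E : ex_RInt f 0 T).
  { apply ex_RInt_ext with (fun t => N2 (g t) + N2 (h t)); [intros; auto|].
    apply ex_RInt_plusR; apply ex_RI; auto. }
  exists (ex_RInt_Reals_0 f 0 T E). rewrite <- RInt_Reals. unfold RI.
  rewrite <- RInt_plusR by (apply ex_RI; auto). apply RInt_extR. auto.
Qed.

(** Young's inequality with a free parameter: a factor close to 1 on [x] is what makes the squared
    norm continuous. *)
Lemma N2_add_weighted (x y : Cplx) (th : R) : 0 < th -> N2 (Cadd x y) <= (1 + th) * N2 x + (1 + / th) * N2 y.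
Proof.
  intros Hth. assert (Hi : 0 < / th) by (apply Rinv_0_lt_compat; auto).
  assert (h : forall a b, (a + b) ^ 2 <= (1 + th) * a ^ 2 + (1 + / th) * b ^ 2).
  { intros a b. assert (0 <= (th * a - b) ^ 2 * / th) by (apply Rmult_le_pos; [apply pow2_ge_0|lra]).
    replace ((th * a - b) ^ 2 * / th) with (th * a ^ 2 - 2 * a * b + / th * b ^ 2) in H by (field; lra). nra. }
  unfold N2. cbn -[pow]. pose proof (h (Re x) (Re y)). pose proof (h (Im x) (Im y)). lra.
Qed.

(** Closeness in L2 is transferred to the squared norms without constructing a limit function: by
    Young's inequality they differ by at most [th W + (1 + 1 / th) B |e n - e k|]. *)
Lemma RI_cv (f g : nat -> R -> Cplx) (T W B l : R) (e : nat -> R) : 0 < T -> 0 < B ->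
  (forall n, cont (f n)) -> (forall n, cont (g n)) ->
  (forall n, RI (f n) T + RI (g n) T <= W) -> Un_cv e l ->
  (forall n k, RI (fun t => Csub (f n t) (f k t)) T + RI (fun t => Csub (g n t) (g k t)) T <= B * Rabs (e n - e k)) ->
  exists I, Un_cv (fun n => RI (f n) T + RI (g n) T) I.
Proof.
  intros HT HB Hf Hg HW He Hd.
  enough (HC : Cauchy_crit (fun n => RI (f n) T + RI (g n) T)).
  { destruct (Rcomplete.R_complete _ HC) as [I HI]. exists I. exact HI. }
  assert (HW0 : 0 <= W).
  { eapply Rle_trans; [|apply (HW O)]. assert (0 <= RI (f O) T) by (apply RI_ge0; auto; lra).
    assert (0 <= RI (g O) T) by (apply RI_ge0; auto; lra). lra. }
  assert (Hone : forall th n k, 0 < th -> RI (f n) T + RI (g n) T - (RI (f k) T + RI (g k) T) <= th * W + (1 + / th) * (B * Rabs (e n - e k))).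
  { intros th n k Hth. assert (Hi : 0 < / th) by (apply Rinv_0_lt_compat; auto).
    assert (h : forall a : nat -> R -> Cplx, (forall n, cont (a n)) -> RI (a n) T <= (1 + th) * RI (a k) T + (1 + / th) * RI (fun t => Csub (a n t) (a k t)) T).
    { intros a Ha. apply RI_le2; auto; [lra|apply cont_sub; auto|]. intros t _.
      replace (a n t) with (Cadd (a k t) (Csub (a n t) (a k t))) at 1 by cring. apply N2_add_weighted; auto. }
    pose proof (h f Hf) as h1. pose proof (h g Hg) as h2. specialize (Hd n k). specialize (HW k).
    assert ((1 + / th) * (RI (fun t => Csub (f n t) (f k t)) T + RI (fun t => Csub (g n t) (g k t)) T) <= (1 + / th) * (B * Rabs (e n - e k)))
      by (apply Rmult_le_compat_l; lra).
    nra. }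
  (* [th] is fixed first so that [th W < eps / 2]; the required closeness of the [e n] may then
     depend on [1 / th]. *)
  intros eps Heps. set (th := eps / (2 * (W + 1))). assert (Hth : 0 < th) by (apply Rdiv_lt_0_compat; lra).
  assert (Hi : 0 < / th) by (apply Rinv_0_lt_compat; auto).
  assert (HthW : th * W < eps / 2).
  { unfold th. apply Rmult_lt_reg_r with (2 * (W + 1)); [lra|].
    replace (eps / (2 * (W + 1)) * W * (2 * (W + 1))) with (eps * W) by (field; lra). nra. }
  set (del := eps / (2 * ((1 + / th) * B))).
  assert (Hpos : 0 < (1 + / th) * B) by (apply Rmult_lt_0_compat; lra).
  assert (Hdel : 0 < del) by (apply Rdiv_lt_0_compat; lra).
  destruct (He (del / 2)) as [N HN]; [lra|]. exists N. intros n k Hn Hk.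
  assert (Hnk : Rabs (e n - e k) < del).
  { pose proof (HN n Hn) as h1. pose proof (HN k Hk) as h2. unfold R_dist in *.
    replace (e n - e k) with ((e n - l) + (l - e k)) by ring.
    eapply Rle_lt_trans; [apply Rabs_triang|]. rewrite (Rabs_minus_sym l). lra. }
  assert (Hs : (1 + / th) * (B * Rabs (e n - e k)) <= eps / 2).
  { rewrite <- Rmult_assoc. apply Rle_trans with ((1 + / th) * B * del); [apply Rmult_le_compat_l; lra|].
    right. unfold del. field. split; lra. }
  pose proof (Hone th n k Hth) as h1. pose proof (Hone th k n Hth) as h2.
  rewrite (Rabs_minus_sym (e k)) in h2. unfold R_dist. apply Rabs_def1; lra.
Qed.

Lemma Un_cv_S (x : nat -> R) l : Un_cv x l -> Un_cv (fun n => x (S n)) l.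
Proof. intros H e He. destruct (H e He) as [N HN]. exists N. intros n Hn. apply HN. lia. Qed.

(** Multiplication by [i] turns real parts into imaginary parts and imaginary parts into the
    negatives of real parts, whence the limit [- y]. *)
Lemma gapped_Ci (om : nat -> Cplx) (y gamma g : R) : g < gamma ->
  is_liminf (fun n => Re (om (S n)) - Re (om n)) gamma -> Un_cv (fun n => Im (om n)) y ->
  gapped (fun i => Cmul Ci (om (S i))) (- y) g.
Proof.
  intros Hg [H _] Hy. split.
  - intros e He. destruct (Hy e He) as [N HN]. exists N. intros n Hn. specialize (HN (S n) ltac:(lia)).
    unfold R_dist in *. cbn. replace (0 * Re (om (S n)) - 1 * Im (om (S n)) - - y) with (- (Im (om (S n)) - y)) by ring.
    rewrite Rabs_Ropp. auto.
  - destruct (H (gamma - g)) as [N HN]; [lra|]. exists N. intros n Hn. specialize (HN (S n) ltac:(lia)). cbn. lra.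
Qed.

Lemma rsum_sum_f_R0 (x : nat -> R) n : rsum x (S n) = sum_f_R0 x n.
Proof. induction n; [cbn; ring|]. change (rsum x (S n) + x (S n) = sum_f_R0 x n + x (S n)). rewrite IHn; auto. Qed.

Theorem theorem5p17
  (om ze c d : nat -> Cplx) (r : nat -> R)
  (gamma alpha chi : R) (n' : nat) (mu nu M c1 c2 eta T : R)
  (Hgamma : gamma > 0) (Halpha : alpha > 0) (Hchi : chi < 0)
  (Hmu : mu > 0) (Hnu : nu > 1/2) (HM : M > 0) (Hc1 : 0 < c1) (Hc12 : c1 <= c2)
  (* (H1) *)
  (H1om : is_liminf (fun n => Re (om (S n)) - Re (om n)) gamma)
  (H1ze : is_liminf (fun n => Re (ze (S n)) - Re (ze n)) gamma)
  (* (H2) *)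
  (H2om : Un_cv (fun n => Im (om n)) alpha)
  (H2r : Un_cv r chi)
  (H2ze : Un_cv (fun n => Im (ze n)) 0)
  (* (H3) *)
  (H3om : forall n, (n >= 1)%nat -> om n <> C0)
  (H3ze : forall n, (n >= 1)%nat -> ze n <> C0)
  (H3d : forall n, (n >= 1)%nat -> c1 * Cmod (ze n) <= Cmod (d n) /\ Cmod (d n) <= c2 * Cmod (ze n))
  (H3c : forall n, (n >= 1)%nat -> Cmod (c n) <= M / Cmod (om n))
  (* (D) : distinctness *)
  (Dom : forall n m, (n >= 1)%nat -> (m >= 1)%nat -> n <> m -> om n <> om m)
  (Dr : forall n m, (n >= 1)%nat -> (m >= 1)%nat -> n <> m -> r n <> r m)
  (Dze : forall n m, (n >= 1)%nat -> (m >= 1)%nat -> n <> m -> ze n <> ze m)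
  (Domze : forall n m, (n >= 1)%nat -> (m >= 1)%nat ->
     om n <> ze m /\ om n <> Cconj (ze m))
  (Drom : forall n m, (n >= 1)%nat -> (m >= 1)%nat ->
     RtoC (r n) <> Cmul Ci (om m) /\ RtoC (r n) <> Cmul Ci (ze m))
  (Dreta : forall n, (n >= 1)%nat -> r n <> - eta)
  (Dpos : forall n, (n >= 1)%nat -> Re (om n) > 0 /\ Re (ze n) > 0)
  (HT : T > 2 * PI / gamma) :
  exists A B : R, 0 < A /\ A <= B /\
  forall (Cc Dd : nat -> Cplx) (Rr : nat -> R) (E S : R),
    (* (H4) *)
    (forall n, (n >= n')%nat -> (n >= 1)%nat ->
       Rabs (Rr n) <= mu * Rpower (INR n) (- nu) *
         sqrt (Cmod (Cc n) ^ 2 + Cmod (Cmul (d n) (Dd n)) ^ 2)) ->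
    (forall n, (n <= n')%nat -> (n >= 1)%nat ->
       Rabs (Rr n) <= mu * sqrt (Cmod (Cc n) ^ 2 + Cmod (Cmul (d n) (Dd n)) ^ 2)) ->
    (* (H5), with S the value of the series *)
    series1 (fun n => Cmod (Cc n) ^ 2 + Cmod (Cmul (d n) (Dd n)) ^ 2) S ->
    (* bound on E *)
    Rabs E ^ 2 <= M * S ->
    (* extra hypothesis of the theorem *)
    (forall n, (n >= 1)%nat -> Cmod (Cc n) <= M * Cmod (Cmul (d n) (Dd n))) ->
    (* the partial sums of (u_1, u_2) are Cauchy in L^2(0,T) ... *)
    (forall eps, eps > 0 -> exists N0, forall N N', (N >= N0)%nat -> (N' >= N0)%nat ->
       exists I, RInt_is (fun t =>
           Cmod (Csub (u1N om ze Cc Dd r Rr N t) (u1N om ze Cc Dd r Rr N' t)) ^ 2 +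
           Cmod (Csub (u2N om ze Cc Dd c d E eta N t) (u2N om ze Cc Dd c d E eta N' t)) ^ 2)
         0 T I /\ I < eps) /\
    (* ... and int_0^T (|u_1|^2 + |u_2|^2) dt = lim of the partial-sum integrals
       lies between A S and B S *)
    (exists (Iseq : nat -> R) (I : R),
       (forall N, RInt_is (fun t =>
           Cmod (u1N om ze Cc Dd r Rr N t) ^ 2 + Cmod (u2N om ze Cc Dd c d E eta N t) ^ 2)
         0 T (Iseq N)) /\
       Un_cv Iseq I /\ A * S <= I /\ I <= B * S).
Proof.
  set (lam := fun i => Cmul Ci (om (Datatypes.S i))). set (zet := fun i => Cmul Ci (ze (Datatypes.S i))).
  set (cs := fun i => c (Datatypes.S i)). set (ds := fun i => d (Datatypes.S i)). set (rs := fun i => r (Datatypes.S i)).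
  pose proof PI_RGT_0 as Hpi.
  assert (HT2 : 0 < 2 * PI / gamma) by (apply Rdiv_lt_0_compat; lra).
  (* [T1] lies halfway between [2 pi / gamma] and [T], and [g] below halfway between [2 pi / T1] and
     [gamma], so that [2 pi < g T1] with strict room on both sides. *)
  set (T1 := (T + 2 * PI / gamma) / 2).
  assert (HT1 : 2 * PI / gamma < T1) by (unfold T1; lra).
  assert (HT1T : T1 < T) by (unfold T1; lra).
  assert (HgT1 : 2 * PI / T1 < gamma).
  { apply Rmult_lt_reg_r with T1; [lra|]. replace (2 * PI / T1 * T1) with (2 * PI / gamma * gamma) by (field; lra).
    rewrite (Rmult_comm gamma). apply Rmult_lt_compat_r; lra. }
  set (g := (gamma + 2 * PI / T1) / 2).
  assert (Hg0 : 0 < 2 * PI / T1) by (apply Rdiv_lt_0_compat; lra).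
  assert (Hg : g < gamma) by (unfold g; lra).
  assert (HgT : 2 * PI < g * T1).
  { apply Rle_lt_trans with (2 * PI / T1 * T1); [right; field; lra|]. apply Rmult_lt_compat_r; [lra|unfold g; lra]. }
  assert (Hg1 : 0 < g) by (unfold g; lra).
  assert (Gl : gapped lam (- alpha) g) by (apply (gapped_Ci om alpha gamma); auto).
  assert (Gz : gapped zet (- 0) g) by (apply (gapped_Ci ze 0 gamma); auto).
  assert (Nl : forall i, N2 (lam i) = N2 (om (Datatypes.S i))) by (intros; unfold lam, N2; cbn; ring).
  assert (Nz : forall i, N2 (zet i) = N2 (ze (Datatypes.S i))) by (intros; unfold zet, N2; cbn; ring).
  assert (Il : forall i, Im (lam i) = Re (om (Datatypes.S i))) by (intros; unfold lam; cbn; ring).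
  assert (Iz : forall i, Im (zet i) = Re (ze (Datatypes.S i))) by (intros; unfold zet; cbn; ring).
  assert (Large : forall (k : nat -> Cplx) y, gapped k y g -> forall K, exists n1, forall n, (n >= n1)%nat -> K <= N2 (k n)).
  { intros k y Gk K. destruct (gapped_unbounded k y g Hg1 Gk (1 + Rabs K)) as [n1 H]. exists n1. intros n Hn.
    specialize (H n Hn). pose proof (Rle_abs K). pose proof (Rabs_pos K). unfold N2. pose proof (pow2_ge_0 (Re (k n))). nra. }
  assert (Hdist : distinct_spectra lam zet).
  { assert (inj : forall z w, Cmul Ci z = Cmul Ci w -> z = w).
    { intros z w H. apply Cplx_eq.
      - assert (h : Im (Cmul Ci z) = Im (Cmul Ci w)) by (rewrite H; auto). cbn in h. lra.
      - assert (h : Re (Cmul Ci z) = Re (Cmul Ci w)) by (rewrite H; auto). cbn in h. lra. }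
    split; [|split; [|split; [|split]]].
    - intros n. rewrite Il. apply Dpos; lia.
    - intros n. rewrite Iz. apply Dpos; lia.
    - intros n m Hnm H. apply inj in H. revert H. apply Dom; lia.
    - intros n m Hnm H. apply inj in H. revert H. apply Dze; lia.
    - intros n m H. apply inj in H. revert H. apply Domze; lia. }
  (* Nonvanishing together with growth bounds [omega_n] and [zeta_n] away from 0, which bounds [c_n]
     from above and [d_n] from below for all indices. *)
  assert (inf_l : exists c, 0 < c /\ forall n, c <= N2 (lam n)).
  { apply inf_pos; [|apply (Large lam _ Gl 1)]. intros n. rewrite Nl. apply N2_pos, H3om. lia. }
  assert (inf_z : exists c, 0 < c /\ forall n, c <= N2 (zet n)).
  { apply inf_pos; [|apply (Large zet _ Gz 1)]. intros n. rewrite Nz. apply N2_pos, H3ze. lia. }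
  destruct inf_l as (il & Hil & inf_l). destruct inf_z as (iz & Hiz & inf_z).
  assert (Bc : forall n, N2 (cs n) * N2 (lam n) <= M ^ 2).
  { intros n. rewrite Nl. pose proof (H3c (Datatypes.S n) ltac:(lia)) as h.
    rewrite <- !Cmod_sq, <- Rpow_mult_distr. apply pow_incr.
    pose proof (Cmod_ge0 (om (Datatypes.S n))). pose proof (Cmod_ge0 (cs n)).
    assert (0 < Cmod (om (Datatypes.S n))).
    { destruct (Req_dec (Cmod (om (Datatypes.S n))) 0) as [e|]; [|lra].
      pose proof (inf_l n) as hh. rewrite Nl, <- Cmod_sq, e in hh. lra. }
    split; [apply Rmult_le_pos; auto|].
    apply Rle_trans with (M / Cmod (om (Datatypes.S n)) * Cmod (om (Datatypes.S n))); [apply Rmult_le_compat_r; auto|].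
    right. field. lra. }
  assert (Bd : forall n, c1 ^ 2 * N2 (zet n) <= N2 (ds n)).
  { intros n. rewrite Nz. pose proof (H3d (Datatypes.S n) ltac:(lia)) as [h _].
    rewrite <- !Cmod_sq, <- Rpow_mult_distr. apply pow_incr. split; auto.
    apply Rmult_le_pos; [lra|apply Cmod_ge0]. }
  assert (Hc1sq : 0 < c1 ^ 2) by (apply pow_lt; auto).
  assert (HM2 : 0 < M ^ 2) by (apply pow_lt; auto).
  set (kc := M ^ 2 / il). set (kd := / (c1 ^ 2 * iz)).
  assert (Hkc0 : 0 <= kc) by (left; apply Rdiv_lt_0_compat; auto).
  assert (Hkd0 : 0 < kd) by (apply Rinv_0_lt_compat, Rmult_lt_0_compat; auto).
  assert (Hkc : forall i, N2 (cs i) <= kc).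
  { intros i. apply Rmult_le_reg_r with il; auto. unfold kc. replace (M ^ 2 / il * il) with (M ^ 2) by (field; lra).
    eapply Rle_trans; [|apply (Bc i)]. apply Rmult_le_compat_l; [apply N2_ge0|auto]. }
  assert (Hkd : forall i, 1 <= kd * N2 (ds i)).
  { intros i. apply Rle_trans with (kd * (c1 ^ 2 * iz)); [right; unfold kd; field; split; lra|].
    apply Rmult_le_compat_l; [lra|]. eapply Rle_trans; [|apply Bd]. apply Rmult_le_compat_l; [lra|auto]. }
  assert (Hcs : forall e, 0 < e -> exists N, forall n, (n >= N)%nat -> N2 (cs n) <= e).
  { intros e He. destruct (Large lam _ Gl (M ^ 2 / e)) as [N HN]. exists N. intros n Hn. specialize (HN n Hn).
    specialize (Bc n). pose proof (N2_ge0 (cs n)).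
    assert (0 < M ^ 2 / e) by (apply Rdiv_lt_0_compat; auto).
    apply Rmult_le_reg_r with (M ^ 2 / e); auto. replace (e * (M ^ 2 / e)) with (M ^ 2) by (field; lra).
    eapply Rle_trans; [|exact Bc]. apply Rmult_le_compat_l; auto. }
  assert (Hds : forall e, 0 < e -> exists N, forall n, (n >= N)%nat -> 1 <= e * N2 (ds n)).
  { intros e He. destruct (Large zet _ Gz (/ (e * c1 ^ 2))) as [N HN]. exists N. intros n Hn. specialize (HN n Hn).
    specialize (Bd n). apply Rle_trans with (e * (c1 ^ 2 * / (e * c1 ^ 2))); [right; field; split; lra|].
    apply Rmult_le_compat_l; [lra|]. eapply Rle_trans; [|exact Bd]. apply Rmult_le_compat_l; lra. }
  assert (Hr : Un_cv rs chi) by (apply (Un_cv_S r); auto).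
  destruct (Un_cv_bounded _ _ (proj1 Gl)) as (b1 & Hb1 & Bl).
  destruct (Un_cv_bounded _ _ (proj1 Gz)) as (b2 & Hb2 & Bz).
  destruct (Un_cv_bounded _ _ Hr) as (b3 & Hb3 & Br).
  set (rho := b1 + b2 + b3 + Rabs chi + Rabs eta).
  pose proof (Rabs_pos chi) as Hac. pose proof (Rabs_pos eta) as Hae.
  assert (Hrho : 0 < rho) by (unfold rho; lra).
  assert (Rl : forall i, Rabs (Re (lam i)) <= rho) by (intros i; specialize (Bl i); unfold rho; lra).
  assert (Rz : forall i, Rabs (Re (zet i)) <= rho) by (intros i; specialize (Bz i); unfold rho; lra).
  assert (Rrr : forall i, Rabs (rs i) <= rho) by (intros i; specialize (Br i); unfold rho; lra).
  assert (Rchi : Rabs chi <= rho) by (unfold rho; lra).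
  assert (Reta : Rabs eta <= rho) by (unfold rho; lra).
  set (v := weight mu nu n'). set (V := mu ^ 2 * (1 + / (2 * nu - 1) + INR n')).
  assert (Hv : forall i, 0 <= v i) by (intros; apply weight_ge0).
  assert (HV : forall n, rsum v n <= V) by (apply weight_sum; lra).
  destruct (U_lower lam zet cs ds rs v (- alpha) (- 0) g T1 T rho V chi eta kc kd M)
    as (n0 & K & HK & Hlow); auto; try lra.
  destruct (U_upper lam zet cs ds rs v (- alpha) (- 0) g T rho V kc kd) as (B & HB & Hup); auto; try lra.
  { eapply Rlt_trans; [exact HgT|]. apply Rmult_lt_compat_l; auto. }
  set (W := T * exp (2 * rho * T)). assert (HW : 0 < W) by (apply Rmult_lt_0_compat; [lra|apply exp_pos]).
  (* [2 B] comes from the direct inequality and [2 W M] from the term [E e^{-eta t}]; the summand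
     [/ K] ensures that the lower constant does not exceed the upper one. *)
  exists (/ K), (2 * B + 2 * (W * M) + / K).
  assert (HKi : 0 < / K) by (apply Rinv_0_lt_compat; auto).
  assert (HWM : 0 < W * M) by (apply Rmult_lt_0_compat; auto).
  split; [auto|]. split; [lra|].
  intros Cc Dd Rr E S HR1 HR2 HS HE HCD.
  set (C := fun i => Cc (Datatypes.S i)). set (D := fun i => Dd (Datatypes.S i)). set (Rs := fun i => Rr (Datatypes.S i)).
  assert (Een : forall i, Cmod (Cc (Datatypes.S i)) ^ 2 + Cmod (Cmul (d (Datatypes.S i)) (Dd (Datatypes.S i))) ^ 2 = energy ds C D i).
  { intros i. rewrite !Cmod_sq. reflexivity. }
  assert (HRv : forall i, Rs i ^ 2 <= v i * energy ds C D i).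
  { intros i. pose proof (energy_ge0 ds C D i) as h0. unfold v, weight. rewrite <- (pow2_abs (Rs i)).
    destruct (Nat.leb_spec n' (Datatypes.S i)) as [h|h].
    - specialize (HR1 (Datatypes.S i) h ltac:(lia)). rewrite Een in HR1.
      replace (mu ^ 2 * Rpower (INR (Datatypes.S i)) (- (2 * nu)) * energy ds C D i)
        with ((mu * Rpower (INR (Datatypes.S i)) (- nu) * sqrt (energy ds C D i)) ^ 2).
      + apply pow_incr. split; [apply Rabs_pos|exact HR1].
      + rewrite !Rpow_mult_distr, pow2_sqrt by auto.
        replace (- (2 * nu)) with (- nu + - nu) by ring. rewrite Rpower_plus. ring.
    - specialize (HR2 (Datatypes.S i) ltac:(lia) ltac:(lia)). rewrite Een in HR2.
      replace (mu ^ 2 * 1 * energy ds C D i) with ((mu * sqrt (energy ds C D i)) ^ 2).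
      + apply pow_incr. split; [apply Rabs_pos|exact HR2].
      + rewrite Rpow_mult_distr, pow2_sqrt by auto. ring. }
  assert (HCD2 : forall i, N2 (C i) <= M ^ 2 * N2 (Cmul (ds i) (D i))).
  { intros i. rewrite <- !Cmod_sq, <- Rpow_mult_distr. apply pow_incr. split; [apply Cmod_ge0|]. apply HCD; lia. }
  set (e := rsum (energy ds C D)).
  assert (He : Un_cv e S).
  (* [sum_f_R0] includes its last index, so the partial sum of index [N] is [e] at [N + 1]. *)
  { intros eps Heps. destruct (HS eps Heps) as [N HN]. exists (Datatypes.S N). intros n Hn.
    destruct n as [|n]; [lia|]. unfold e. rewrite rsum_sum_f_R0.
    specialize (HN n ltac:(lia)). erewrite sum_eq; [exact HN|]. intros i _. symmetry. apply Een. }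
  assert (HeS : forall n, e n <= S).
  { intros n. apply (growing_ineq e S); auto. intros k. unfold e. cbn [rsum]. pose proof (energy_ge0 ds C D k). lra. }
  assert (HS0 : 0 <= S) by (exact (HeS O)).
  set (f1 := fun N => u1N om ze Cc Dd r Rr N). set (f2 := fun N => u2N om ze Cc Dd c d E eta N).
  assert (Ef1 : forall N t, f1 N t = U1 lam zet rs C D Rs N t) by (intros; apply u1N_U1).
  assert (Ef2 : forall N t, f2 N t = Cadd (U2 lam zet cs ds C D N t) (Cmul (RtoC E) (cexp (RtoC (- eta)) t))) by (intros; apply u2N_U2).
  assert (Cf1 : forall N, cont (f1 N)).
  { intros N. apply cont_ext with (U1 lam zet rs C D Rs N); [auto|apply cont_U1]. }
  assert (Cf2 : forall N, cont (f2 N)).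
  { intros N. eapply cont_ext; [intros t; symmetry; apply Ef2|]. apply cont_add; [apply cont_U2|apply cont_term]. }
  (* The term [E e^{-eta t}] cancels in the difference, and what remains is a sum with truncated
     coefficients, bounded by the energy between the two indices. *)
  assert (Hdiff1 : forall n k, RI (fun t => Csub (f1 (n + k)%nat t) (f1 n t)) T + RI (fun t => Csub (f2 (n + k)%nat t) (f2 n t)) T
      <= B * (e (n + k)%nat - e n)).
  { intros n k. unfold e at 1. rewrite rsum_split. fold e.
    replace (e n + rsum (fun i => energy ds C D (n + i)%nat) k - e n) with (rsum (energy ds (from n C) (from n D)) (n + k)) by (rewrite energy_from; unfold e; ring).
    rewrite (RI_ext _ (U1 lam zet rs (from n C) (from n D) (fun i => if Nat.ltb i n then 0 else Rs i) (n + k))).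
    - rewrite (RI_ext (fun t => Csub (f2 (n + k)%nat t) (f2 n t)) (U2 lam zet cs ds (from n C) (from n D) (n + k))).
      + apply Hup. intros i Hi. destruct (Nat.ltb_spec i n) as [h|h].
        * rewrite pow_i by lia. apply Rmult_le_pos; [auto|apply energy_ge0].
        * replace (energy ds (from n C) (from n D) i) with (energy ds C D i); auto.
          unfold energy. rewrite !from_ge; auto.
      + intros t. rewrite U2_from, !Ef2. cring.
    - intros t. rewrite U1_from, !Ef1. auto. }
  assert (Hdiff : forall n k, RI (fun t => Csub (f1 n t) (f1 k t)) T + RI (fun t => Csub (f2 n t) (f2 k t)) T <= B * Rabs (e n - e k)).
  { intros n k. destruct (Nat.le_ge_cases k n) as [h|h].
    - pose proof (Hdiff1 k (n - k)%nat) as h1. replace (k + (n - k))%nat with n in h1 by lia.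
      eapply Rle_trans; [exact h1|]. apply Rmult_le_compat_l; [lra|apply Rle_abs].
    - pose proof (Hdiff1 n (k - n)%nat) as h1. replace (n + (k - n))%nat with k in h1 by lia.
      assert (sym : forall f : nat -> R -> Cplx, RI (fun t => Csub (f n t) (f k t)) T = RI (fun t => Csub (f k t) (f n t)) T).
      { intros f. unfold RI. apply RInt_extR. intros t. unfold N2; cbn; ring. }
      rewrite (sym f1), (sym f2), Rabs_minus_sym.
      eapply Rle_trans; [exact h1|]. apply Rmult_le_compat_l; [lra|apply Rle_abs]. }
  assert (HupN : forall N, RI (f1 N) T + RI (f2 N) T <= (2 * B + 2 * (W * M)) * S).
  { intros N. pose proof (Hup C D Rs N (fun i _ => HRv i)) as h. fold e in h.
    rewrite (RI_ext (f1 N) _ T (Ef1 N)), (RI_ext (f2 N) _ T (Ef2 N)).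
    pose proof (RI_add (U2 lam zet cs ds C D N) (fun t => Cmul (RtoC E) (cexp (RtoC (- eta)) t)) T ltac:(lra) (cont_U2 _ _ _ _ _ _ _) (cont_term _ _)) as h1.
    cbv beta in h1.
    assert (h2 : RI (fun t => Cmul (RtoC E) (cexp (RtoC (- eta)) t)) T <= W * (M * S)).
    { unfold W. rewrite Rmult_assoc. apply RI_const_bound; [lra|apply cont_term|]. intros t Ht.
      eapply Rle_trans; [apply (N2_term_bound _ (RtoC (- eta)) rho T t); auto; cbn; rewrite Rabs_Ropp; auto|].
      apply Rmult_le_compat_l; [left; apply exp_pos|]. eapply Rle_trans; [|exact HE]. rewrite pow2_abs.
      unfold N2; cbn; lra. }
    assert (h3 : 0 <= RI (U1 lam zet rs C D Rs N) T) by (apply RI_ge0; [lra|apply cont_U1]).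
    assert (h4 : B * e N <= B * S) by (apply Rmult_le_compat_l; [lra|auto]).
    lra. }
  destruct (RI_cv f1 f2 T ((2 * B + 2 * (W * M)) * S) B S e) as [I HI]; auto; [lra|].
  split.
  - intros eps Heps. destruct (He (eps / (2 * B) / 2)) as [N0 HN0].
    { assert (0 < eps / (2 * B)) by (apply Rdiv_lt_0_compat; lra). lra. }
    exists N0. intros N N' HN HN'.
    exists (RI (fun t => Csub (f1 N t) (f1 N' t)) T + RI (fun t => Csub (f2 N t) (f2 N' t)) T). split.
    + apply RInt_is_RI; [apply cont_sub; auto|apply cont_sub; auto|]. intros t. rewrite !Cmod_sq. reflexivity.
    + eapply Rle_lt_trans; [apply Hdiff|].
      assert (h : Rabs (e N - e N') < eps / (2 * B)).
      { pose proof (HN0 N HN) as h1. pose proof (HN0 N' HN') as h2. unfold R_dist in *.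
        replace (e N - e N') with ((e N - S) + (S - e N')) by ring.
        eapply Rle_lt_trans; [apply Rabs_triang|]. rewrite (Rabs_minus_sym S). lra. }
      apply Rlt_trans with (B * (eps / (2 * B))); [apply Rmult_lt_compat_l; auto|].
      replace (B * (eps / (2 * B))) with (eps / 2) by (field; lra). lra.
  - exists (fun N => RI (f1 N) T + RI (f2 N) T), I. split; [|split; [|split]].
    + intros N. apply RInt_is_RI; auto. intros t. rewrite !Cmod_sq. reflexivity.
    + exact HI.
    + assert (h : S <= K * I).
      (* The inverse inequality is available for sums of at least [n0] terms, hence the shift by
         [n0] before passing to the limit. *)
      { apply (@Rle_cv_lim (fun n => e (n + n0)%nat) (fun n => K * (RI (f1 (n + n0)%nat) T + RI (f2 (n + n0)%nat) T))).
        - intros n. rewrite (Nat.add_comm n n0), (RI_ext (f1 _) _ T (Ef1 _)), (RI_ext (f2 _) _ T (Ef2 _)).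
          apply Hlow; auto.
        - apply (CV_shift' e n0 S He).
        - apply (CV_mult (fun _ => K)).
          + intros eps Heps. exists O. intros. unfold R_dist. rewrite Rminus_diag, Rabs_R0. auto.
          + apply (CV_shift' (fun n => RI (f1 n) T + RI (f2 n) T) n0 I HI). }
      apply Rmult_le_reg_l with K; auto. rewrite <- Rmult_assoc, Rinv_r by lra. lra.
    + apply Rle_trans with ((2 * B + 2 * (W * M)) * S).
      * apply (@Rle_cv_lim (fun N => RI (f1 N) T + RI (f2 N) T) (fun _ => (2 * B + 2 * (W * M)) * S)); auto.
        intros eps Heps. exists O. intros. unfold R_dist. rewrite Rminus_diag, Rabs_R0. auto.
      * apply Rmult_le_compat_r; lra.
Qed.
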